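(* Let $\mathbf K$ be a 2-category which admits the construction of vector fields, and assume that for each tangentad $(\mathbb X,\mathbb T)$ of $\mathbf K$ and each positive integer $n$ the $n$-fold 2-pullback $\mathrm{VF}_n(\mathbb X,\mathbb T)$ of $U:\mathrm{VF}(\mathbb X,\mathbb T)\to(\mathbb X,\mathbb T)$ along itself exists in $\mathbf K$. Then the 2-endofunctor $\mathrm{VF}:\mathsf{Tng}(\mathbf K)\to\mathsf{Tng}(\mathbf K)$ together with the 2-natural transformations $$\eta_{(\mathbb X,\mathbb T)}:(\mathbb X,\mathbb T)\to\mathrm{VF}(\mathbb X,\mathbb T),\qquad \mu_{(\mathbb X,\mathbb T)}:\mathrm{VF}^2(\mathbb X,\mathbb T)\to\mathrm{VF}(\mathbb X,\mathbb T),$$ where $\eta=0$ and $\mu=+\circ\langle U_{\mathrm{VF}(\mathbb X,\mathbb T)},\mathrm{VF}(U)\rangle$, is a 2-monad on $\mathsf{Tng}(\mathbf K)$.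
   Context: Let $\mathbf K$ be a 2-category. For a 2-morphism $\varphi$ and a 1-morphism $H$, write $H\varphi$ and $\varphi_H$ for the whiskerings (post- and precomposition with $H$). A pullback in $\mathbf K(\mathbb X,\mathbb Y)$ is pointwise if it is preserved by $\mathbf K(F,\mathbb Y)$ for every 1-morphism $F:\mathbb X'\to\mathbb X$. Tangentad: a tangentad $(\mathbb X,\mathbb T)$ in $\mathbf K$ is an object $\mathbb X$ with a tangent structure $\mathbb T=(T,p,z,s,l,c)$: a 1-morphism $T:\mathbb X\to\mathbb X$ and 2-morphisms $p:T\Rightarrow\mathrm{id}$, $z:\mathrm{id}\Rightarrow T$, $s:T_2\Rightarrow T$, $l:T\Rightarrow T^2$, $c:T^2\Rightarrow T^2$ such that: (1) for each $n\ge1$ the $n$-fold pullback $T_n$ of $p$ along itself (projections $\pi_k:T_n\Rightarrow T$) exists in $\mathbf K(\mathbb X,\mathbb X)$, is pointwise, and is preserved by postcomposition with all iterates $T^m$; (2) $pz=\mathrm{id}$, $ps=p\pi_1$, and $s$ is associative, commutative and unital with unit $z$; (3) $Tp\circ l=z\circ p$, $l\circ z=Tz\circ z$, $l\circ s=Ts\circ\langle l\pi_1,l\pi_2\rangle$; (4) $p_T\circ c=Tp$, $c\circ Tz=z_T$, $c\circ Ts=s_T\circ\langle c\circ T\pi_1,c\circ T\pi_2\rangle$; (5) $Tl\circ l=l_T\circ l$, $c\circ l=l$, $c_T\circ Tc\circ l_T=Tl\circ c$, $c\circ c=\mathrm{id}$, $Tc\circ c_T\circ Tc=c_T\circ Tc\circ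 c_T$; (6) the square with top $Ts\circ\langle l\pi_1,z_T\pi_2\rangle:T_2\Rightarrow T^2$, left side $p\pi_1:T_2\Rightarrow\mathrm{id}$, right side $Tp:T^2\Rightarrow T$ and bottom $z:\mathrm{id}\Rightarrow T$ is a pointwise pullback. A tangent category is a tangentad in the 2-category $\mathsf{Cat}$. Morphisms: a lax tangent morphism $(F,\alpha):(\mathbb X,\mathbb T)\to(\mathbb X',\mathbb T')$ is a 1-morphism $F:\mathbb X\to\mathbb X'$ with a 2-morphism $\alpha:F\circ T\Rightarrow T'\circ F$ such that $p'_F\circ\alpha=Fp$, $\alpha\circ Fz=z'_F$, $\alpha\circ Fs=s'_F\circ\langle\alpha\circ F\pi_1,\alpha\circ F\pi_2\rangle$, $l'_F\circ\alpha=T'\alpha\circ\alpha_T\circ Fl$, $c'_F\circ T'\alpha\circ\alpha_T=T'\alpha\circ\alpha_T\circ Fc$. It is strong if $\alpha$ is invertible, strict if $\alpha$ is an identity. A tangent 2-morphism $\varphi:(F,\alpha)\Rightarrow(G,\beta)$ is a 2-morphism $\varphi:F\Rightarrow G$ with $T'\varphi\circ\alpha=\beta\circ\varphi_T$. $\mathsf{Tng}(\mathbf K)$ is the 2-category of tangentads of $\mathbf K$, lax tangent morphisms and tangent 2-morphisms. Hom-tangent category: $[\mathbb X',\mathbb T'\mid\mathbb X,\mathbb T]$ is the category $\mathsf{Tng}(\mathbf K)((\mathbb X',\mathbb T'),(\mathbb X,\mathbb T))$ with the pointwise tangent structure: $\bar T(F,\alpha)=(T,c)\circ(F,\alpha)=(T\circ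 F,c_F\circ T\alpha)$, $\bar T\varphi=T\varphi$, structural transformations $p_F,z_F,s_F,l_F,c_F$. Vector fields: a vector field on an object $M$ of a tangent category is $v:M\to TM$ with $p_M\circ v=\mathrm{id}_M$. The sum of vector fields $u,v$ on $M$ is $u+v=s\circ\langle u,v\rangle$. For a tangent category $(\mathbb Y,\mathbb T)$, $\mathrm{VF}(\mathbb Y,\mathbb T)$ is the tangent category of pairs $(M,v)$, $v$ a vector field on $M$; morphisms $f:(M,v)\to(N,u)$ are $f:M\to N$ with $Tf\circ v=u\circ f$; tangent bundle functor $(M,v)\mapsto(TM,c_M\circ Tv)$, $f\mapsto Tf$; structural transformations as in $(\mathbb Y,\mathbb T)$. $\mathrm{VF}[\mathbb X',\mathbb T'\mid\mathbb X,\mathbb T]$ is this construction applied to the Hom-tangent category. Construction of vector fields: for a strict tangent morphism $U:(\mathbb V,\mathbb T^{\mathbb V})\to(\mathbb X,\mathbb T)$ and a vector field $\mathbf v:U\Rightarrow\bar TU$ on $U$ in $[\mathbb V,\mathbb T^{\mathbb V}\mid\mathbb X,\mathbb T]$, for each tangentad $(\mathbb X',\mathbb T')$ let $\Gamma_{\mathbf v}:[\mathbb X',\mathbb T'\mid\mathbb V,\mathbb T^{\mathbb V}]\to\mathrm{VF}[\mathbb X',\mathbb T'\mid\mathbb X,\mathbb T]$ be the strict tangent morphism $(H,\gamma)\mapsto(U\circ(H,\gamma),\mathbf v_H)$, $\varphi\mapsto U\varphi$. A tangentad $(\mathbb X,\mathbb T)$ admits the construction of vector fields if there are a tangentad $\mathrm{VF}(\mathbb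 X,\mathbb T)$ (the tangentad of vector fields), a strict tangent morphism $U=U_{(\mathbb X,\mathbb T)}:\mathrm{VF}(\mathbb X,\mathbb T)\to(\mathbb X,\mathbb T)$ and a vector field $\mathbf v$ on $U$ in $[\mathrm{VF}(\mathbb X,\mathbb T)\mid\mathbb X,\mathbb T]$ (the universal vector field) such that $\Gamma_{\mathbf v}$ is invertible for every $(\mathbb X',\mathbb T')$. $\mathbf K$ admits the construction of vector fields if every tangentad of $\mathbf K$ does. The 2-functor $\mathrm{VF}$: for a lax tangent morphism $(F,\alpha):(\mathbb X,\mathbb T)\to(\mathbb X',\mathbb T')$, $\mathrm{VF}(F,\alpha)$ is the lax tangent morphism corresponding under $\Gamma_{\mathbf v'}$ ($\mathbf v'$ the universal vector field of $(\mathbb X',\mathbb T')$) to the vector field $\alpha_U\circ F\mathbf v$ on $(F,\alpha)\circ U$; for a tangent 2-morphism $\varphi$, $\mathrm{VF}(\varphi)$ corresponds under $\Gamma_{\mathbf v'}$ to $\varphi_U$. The 2-pullbacks $\mathrm{VF}_n(\mathbb X,\mathbb T)$ carry an induced tangent structure making them $n$-fold 2-pullbacks in $\mathsf{Tng}(\mathbf K)$ with strict projections $\pi_k:\mathrm{VF}_n(\mathbb X,\mathbb T)\to\mathrm{VF}(\mathbb X,\mathbb T)$. Under $\Gamma_{\mathbf v}$, the tangent morphism $0:(\mathbb X,\mathbb T)\to\mathrm{VF}(\mathbb X,\mathbb T)$ corresponds to the vector field $z$ on $\mathrm{id}_{(\mathbb X,\mathbb T)}$, and $+:\mathrm{VF}_2(\mathbb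 X,\mathbb T)\to\mathrm{VF}(\mathbb X,\mathbb T)$ corresponds to the sum $\mathbf v_1+\mathbf v_2$ of the vector fields $\mathbf v_k=\mathbf v_{\pi_k}$ on $U\circ\pi_1=U\circ\pi_2$. The morphism $\langle U_{\mathrm{VF}(\mathbb X,\mathbb T)},\mathrm{VF}(U)\rangle:\mathrm{VF}(\mathrm{VF}(\mathbb X,\mathbb T))\to\mathrm{VF}_2(\mathbb X,\mathbb T)$ is induced by the 2-pullback (note $U\circ U_{\mathrm{VF}(\mathbb X,\mathbb T)}=U\circ\mathrm{VF}(U)$). *)

(* Defs.v *)
From mathcomp Require Import all_boot.
From Stdlib Require Import ProofIrrelevance ClassicalEpsilon.

Set Implicit Arguments.
Unset Strict Implicit.
Unset Printing Implicit Defensive.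

Definition cell (O : Type) (H : O -> O -> Type) := {FG : O * O & H FG.1 FG.2}.

Definition tot (O : Type) (H : O -> O -> Type) (F G : O) (a : H F G) : cell H :=
  existT (fun FG => H FG.1 FG.2) (F, G) a.

(* In a strict 2-category F (G H) and (F G) H are equal but not convertible, so
   equal 2-morphisms may have types that differ: "a ≡ b" says that the end
   points of a and b are equal and that a and b are equal over this.           *)
Notation "a ≡ b" := (tot a = tot b) (at level 70, no associativity).

(* wl H a is the whiskering H a and wr a E is the whiskering a_E; horizontal
   composition of 2-morphisms is either side of interchange.                   *)
Record TwoCat := MkTwoCat {
  ob :> Type;
  hom1 : ob -> ob -> Type;
  hom2 : forall X Y, hom1 X Y -> hom1 X Y -> Type;
  id1 : forall X, hom1 X X;
  comp1 : forall X Y Z, hom1 Y Z -> hom1 X Y -> hom1 X Z;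
  id2 : forall X Y (F : hom1 X Y), hom2 F F;
  vc : forall X Y (F G H : hom1 X Y), hom2 G H -> hom2 F G -> hom2 F H;
  wl : forall X Y Z (H : hom1 Y Z) (F G : hom1 X Y),
    hom2 F G -> hom2 (comp1 H F) (comp1 H G);
  wr : forall X Y Z (F G : hom1 Y Z),
    hom2 F G -> forall E : hom1 X Y, hom2 (comp1 F E) (comp1 G E);
  comp1A : forall W X Y Z (H : hom1 Y Z) (G : hom1 X Y) (F : hom1 W X),
    comp1 H (comp1 G F) = comp1 (comp1 H G) F;
  comp1l : forall X Y (F : hom1 X Y), comp1 (id1 Y) F = F;
  comp1r : forall X Y (F : hom1 X Y), comp1 F (id1 X) = F;
  vcA : forall X Y (F G H I : hom1 X Y) (c : hom2 H I) (b : hom2 G H) (a : hom2 F G),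
    vc c (vc b a) = vc (vc c b) a;
  vcl : forall X Y (F G : hom1 X Y) (a : hom2 F G), vc (id2 G) a = a;
  vcr : forall X Y (F G : hom1 X Y) (a : hom2 F G), vc a (id2 F) = a;
  wl_id2 : forall X Y Z (H : hom1 Y Z) (F : hom1 X Y),
    wl H (id2 F) = id2 (comp1 H F);
  wr_id2 : forall X Y Z (F : hom1 Y Z) (E : hom1 X Y),
    wr (id2 F) E = id2 (comp1 F E);
  wl_vc : forall X Y Z (I : hom1 Y Z) (F G H : hom1 X Y) (b : hom2 G H) (a : hom2 F G),
    wl I (vc b a) = vc (wl I b) (wl I a);
  wr_vc : forall X Y Z (F G H : hom1 Y Z) (b : hom2 G H) (a : hom2 F G) (E : hom1 X Y),
    wr (vc b a) E = vc (wr b E) (wr a E);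
  wl_id1 : forall X Y (F G : hom1 X Y) (a : hom2 F G), wl (id1 Y) a ≡ a;
  wr_id1 : forall X Y (F G : hom1 X Y) (a : hom2 F G), wr a (id1 X) ≡ a;
  wl_comp1 : forall W X Y Z (I : hom1 Y Z) (H : hom1 X Y) (F G : hom1 W X) (a : hom2 F G),
    wl (comp1 I H) a ≡ wl I (wl H a);
  wr_comp1 : forall W X Y Z (F G : hom1 Y Z) (a : hom2 F G) (E : hom1 X Y) (D : hom1 W X),
    wr a (comp1 E D) ≡ wr (wr a E) D;
  wl_wr : forall W X Y Z (H : hom1 Y Z) (F G : hom1 X Y) (a : hom2 F G) (E : hom1 W X),
    wl H (wr a E) ≡ wr (wl H a) E;
  interchange : forall X Y Z (H I : hom1 Y Z) (F G : hom1 X Y) (b : hom2 H I) (a : hom2 F G),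
    vc (wr b G) (wl H a) = vc (wl I a) (wr b F)
}.

Arguments hom1 {t}.
Arguments hom2 {t X Y}.
Arguments id1 {t}.
Arguments comp1 {t X Y Z}.
Arguments id2 {t X Y}.
Arguments vc {t X Y F G H}.
Arguments wl {t X Y Z} H {F G}.
Arguments wr {t X Y Z F G} a E : rename.
Arguments comp1A {t W X Y Z}.
Arguments comp1l {t X Y}.
Arguments comp1r {t X Y}.

Declare Scope twocat_scope.
Delimit Scope twocat_scope with tw.
Local Open Scope twocat_scope.
Notation "G ∘ F" := (comp1 G F) (at level 40, left associativity) : twocat_scope.
Notation "F ⇒ G" := (hom2 F G) (at level 60, no associativity) : twocat_scope.

Section Casts.
Variables (K : TwoCat) (X Y : K).
Implicit Types F G H : hom1 X Y.

Definition cast F G F' G' (a : F ⇒ G) (eF : F = F') (eG : G = G') : F' ⇒ G' :=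
  match eF in _ = F1, eG in _ = G1 return F1 ⇒ G1 with
  | erefl, erefl => a
  end.

Definition vcomp F G G' H (b : G' ⇒ H) (a : F ⇒ G) (e : G = G') : F ⇒ H :=
  vc b (cast a erefl e).

Lemma tot_cast F G F' G' (a : F ⇒ G) (eF : F = F') (eG : G = G') :
  cast a eF eG ≡ a.
Proof. by case: F' / eF; case: G' / eG. Qed.

Lemma tot_inj F G (a b : F ⇒ G) : a ≡ b -> a = b.
Proof. exact: ProofIrrelevanceTheory.EqdepTheory.inj_pair2. Qed.

End Casts.

Ltac strict1 := first [reflexivity | by rewrite ?(comp1A, comp1l, comp1r)].

(* Vertical composite, and a 2-morphism with its end points replaced by equal
   ones; the equalities hold by associativity and unitality of comp1.          *)
Notation "b • a" := (vcomp b a ltac:(strict1))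
  (at level 50, left associativity, only parsing) : twocat_scope.
Notation "b • a" := (vcomp b a _)
  (at level 50, left associativity, only printing) : twocat_scope.
Notation "⟦ a : F ⇒ G ⟧" :=
  (@cast _ _ _ _ _ F G a ltac:(strict1) ltac:(strict1))
  (at level 0, a at level 99, F at level 59, G at level 59, only parsing) : twocat_scope.
Notation "⟦ a : F ⇒ G ⟧" := (@cast _ _ _ _ _ F G a _ _)
  (at level 0, a at level 99, F at level 59, G at level 59, only printing) : twocat_scope.

Section Cells.
Variables (K : TwoCat).

Section Hom.
Variables (X Y : K).
Notation cellXY := (cell (@hom2 K X Y)).

Definition csrc (a : cellXY) := (projT1 a).1.
Definition ctgt (a : cellXY) := (projT1 a).2.

(* Total vertical composition on untyped cells, used in proofs only; it returns
   a when a and b are not composable.                                          *)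
Definition cc (b a : cellXY) : cellXY :=
  match excluded_middle_informative (ctgt a = csrc b) with
  | left e => tot (vcomp (projT2 b) (projT2 a) e)
  | right _ => a
  end.

Lemma tot_vcomp F G G' H (b : @hom2 K X Y G' H) (a : F ⇒ G) e :
  tot (vcomp b a e) = cc (tot b) (tot a).
Proof.
rewrite /cc; case: excluded_middle_informative => [e'|//].
by rewrite (proof_irrelevance _ e e').
Qed.

Lemma tot_vc F G H (b : @hom2 K X Y G H) (a : F ⇒ G) :
  tot (vc b a) = cc (tot b) (tot a).
Proof. by rewrite -(tot_vcomp b a erefl). Qed.

Lemma csrc_cc b a : csrc (cc b a) = csrc a.
Proof. by rewrite /cc; case: excluded_middle_informative. Qed.

Lemma ctgt_cc b a : ctgt a = csrc b -> ctgt (cc b a) = ctgt b.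
Proof. by rewrite /cc; case: excluded_middle_informative. Qed.

Lemma ccA c b a : ctgt a = csrc b -> ctgt b = csrc c ->
  cc c (cc b a) = cc (cc c b) a.
Proof.
case: a b c => [[F G] /= a] [[G' H] /= b] [[H' I] /= c].
rewrite /csrc /ctgt /= => e e'; case: G' / e b; case: H' / e' c => c b.
by have := congr1 (@tot _ _ _ _) (vcA c b a); rewrite !tot_vc.
Qed.

Lemma cellW (P : cellXY -> Prop) :
  (forall F G (a : @hom2 K X Y F G), P (tot a)) -> forall a, P a.
Proof. by move=> Pt [[F G] a]; exact: Pt. Qed.

Lemma cc1l a F : ctgt a = F -> cc (tot (id2 F)) a = a.
Proof. by elim/cellW: a => G H a <-; rewrite -tot_vc vcl. Qed.

Lemma cc1r a F : csrc a = F -> cc a (tot (id2 F)) = a.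
Proof. by elim/cellW: a => G H a <-; rewrite -tot_vc vcr. Qed.

End Hom.

Definition cl X Y Z (H : @hom1 K Y Z) (a : cell (@hom2 K X Y)) : cell (@hom2 K X Z) :=
  tot (wl H (projT2 a)).
Definition cr X Y Z (a : cell (@hom2 K Y Z)) (E : @hom1 K X Y) : cell (@hom2 K X Z) :=
  tot (wr (projT2 a) E).

Lemma tot_wl X Y Z (H : @hom1 K Y Z) (F G : hom1 X Y) (a : F ⇒ G) :
  tot (wl H a) = cl H (tot a).
Proof. by []. Qed.
Lemma tot_wr X Y Z (F G : @hom1 K Y Z) (a : F ⇒ G) (E : hom1 X Y) :
  tot (wr a E) = cr (tot a) E.
Proof. by []. Qed.

Lemma csrc_cl X Y Z (H : @hom1 K Y Z) (a : cell (@hom2 K X Y)) :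
  csrc (cl H a) = H ∘ csrc a. Proof. by []. Qed.
Lemma ctgt_cl X Y Z (H : @hom1 K Y Z) (a : cell (@hom2 K X Y)) :
  ctgt (cl H a) = H ∘ ctgt a. Proof. by []. Qed.
Lemma csrc_cr X Y Z (a : cell (@hom2 K Y Z)) (E : hom1 X Y) :
  csrc (cr a E) = csrc a ∘ E. Proof. by []. Qed.
Lemma ctgt_cr X Y Z (a : cell (@hom2 K Y Z)) (E : hom1 X Y) :
  ctgt (cr a E) = ctgt a ∘ E. Proof. by []. Qed.
Lemma csrc_tot X Y (F G : @hom1 K X Y) (a : F ⇒ G) : csrc (tot a) = F.
Proof. by []. Qed.
Lemma ctgt_tot X Y (F G : @hom1 K X Y) (a : F ⇒ G) : ctgt (tot a) = G.
Proof. by []. Qed.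

Lemma cl_cc X Y Z (H : @hom1 K Y Z) (b a : cell (@hom2 K X Y)) :
  ctgt a = csrc b -> cl H (cc b a) = cc (cl H b) (cl H a).
Proof.
elim/cellW: a; elim/cellW: b => G' I b F G a; rewrite /csrc /ctgt /= => e.
case: G' / e b => b; by rewrite -!tot_vc -!tot_wl wl_vc tot_vc.
Qed.

Lemma cr_cc X Y Z (b a : cell (@hom2 K Y Z)) (E : hom1 X Y) :
  ctgt a = csrc b -> cr (cc b a) E = cc (cr b E) (cr a E).
Proof.
elim/cellW: a; elim/cellW: b => G' I b F G a; rewrite /csrc /ctgt /= => e.
case: G' / e b => b; by rewrite -!tot_vc -!tot_wr wr_vc tot_vc.
Qed.

Lemma cl_id2 X Y Z (H : @hom1 K Y Z) (F : hom1 X Y) :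
  cl H (tot (id2 F)) = tot (id2 (H ∘ F)).
Proof. by rewrite -tot_wl wl_id2. Qed.
Lemma cr_id2 X Y Z (F : @hom1 K Y Z) (E : hom1 X Y) :
  cr (tot (id2 F)) E = tot (id2 (F ∘ E)).
Proof. by rewrite -tot_wr wr_id2. Qed.

Lemma cl_id1 X Y (a : cell (@hom2 K X Y)) : cl (id1 Y) a = a.
Proof. by elim/cellW: a => F G a; exact: wl_id1. Qed.
Lemma cr_id1 X Y (a : cell (@hom2 K X Y)) : cr a (id1 X) = a.
Proof. by elim/cellW: a => F G a; exact: wr_id1. Qed.
Lemma cl_cl W X Y Z (I : @hom1 K Y Z) (H : hom1 X Y) (a : cell (@hom2 K W X)) :
  cl I (cl H a) = cl (I ∘ H) a.
Proof. by elim/cellW: a => F G a; rewrite -!tot_wl wl_comp1. Qed.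
Lemma cr_cr W X Y Z (a : cell (@hom2 K Y Z)) (E : hom1 X Y) (D : hom1 W X) :
  cr (cr a E) D = cr a (E ∘ D).
Proof. by elim/cellW: a => F G a; rewrite -!tot_wr wr_comp1. Qed.
Lemma cr_cl W X Y Z (H : @hom1 K Y Z) (a : cell (@hom2 K X Y)) (E : hom1 W X) :
  cr (cl H a) E = cl H (cr a E).
Proof. by elim/cellW: a => F G a; rewrite -!(tot_wl, tot_wr) wl_wr. Qed.
Lemma ccX X Y Z (b : cell (@hom2 K Y Z)) (a : cell (@hom2 K X Y)) :
  cc (cr b (ctgt a)) (cl (csrc b) a) = cc (cl (ctgt b) a) (cr b (csrc a)).
Proof.
elim/cellW: a; elim/cellW: b => H I b F G a.
by have := congr1 (@tot _ _ _ _) (interchange b a); rewrite !tot_vc.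
Qed.

Lemma cell_ends X Y (F G F' G' : @hom1 K X Y) (a : F ⇒ G) (b : F' ⇒ G') :
  a ≡ b -> F = F' /\ G = G'.
Proof. by move=> e; have := congr1 (fun c => projT1 c) e => -[-> ->]. Qed.

End Cells.

Definition totE := (tot_cast, tot_vcomp, tot_vc, tot_wl, tot_wr).

Ltac cst := solve [repeat first
  [ rewrite !(csrc_cl, ctgt_cl, csrc_cr, ctgt_cr, csrc_tot, ctgt_tot, csrc_cc)
  | rewrite ctgt_cc; [|cst] ];
  rewrite ?(comp1A, comp1l, comp1r); reflexivity].

Ltac cnorm := rewrite ?totE;
  repeat first [rewrite cl_cc; [|cst] | rewrite cr_cc; [|cst]];
  rewrite ?(cr_cl, cl_cl, cr_cr, cl_id1, cr_id1, cl_id2, cr_id2,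
            comp1A, comp1l, comp1r);
  repeat (rewrite -ccA; [|cst|cst]);
  repeat first [rewrite cc1l; [|cst] | rewrite cc1r; [|cst]].

Ltac cnorm_in E := rewrite ?totE in E;
  repeat first [rewrite cl_cc in E; [|cst] | rewrite cr_cc in E; [|cst]];
  rewrite ?(cr_cl, cl_cl, cr_cr, cl_id1, cr_id1, cl_id2, cr_id2,
            comp1A, comp1l, comp1r) in E;
  repeat (rewrite -ccA in E; [|cst|cst]);
  repeat first [rewrite cc1l in E; [|cst] | rewrite cc1r in E; [|cst]].

Section Pullbacks.
Variables (K : TwoCat) (X Y : K).

Definition is_nfold_pb (T S P : hom1 X Y) (p : T ⇒ S) n (pi : 'I_n -> P ⇒ T) : Prop :=
  (forall i j, p • pi i = p • pi j) /\
  forall (Q : hom1 X Y) (q : 'I_n -> Q ⇒ T), (forall i j, p • q i = p • q j) ->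
    exists! u : Q ⇒ P, forall i, pi i • u = q i.

Definition is_pb (P A B C : hom1 X Y) (a : P ⇒ A) (b : P ⇒ B) (f : A ⇒ C) (g : B ⇒ C)
    : Prop :=
  f • a = g • b /\
  forall (Q : hom1 X Y) (a' : Q ⇒ A) (b' : Q ⇒ B), f • a' = g • b' ->
    exists! u : Q ⇒ P, a • u = a' /\ b • u = b'.

(* u is the pairing <a, b> into a two-fold pullback with projections pi. *)
Definition is_pair (T P Q : hom1 X Y) (pi : 'I_2 -> P ⇒ T) (u : Q ⇒ P) (a b : Q ⇒ T)
    : Prop :=
  pi ord0 • u = a /\ pi ord_max • u = b.

End Pullbacks.

Section Pointwise.
Variables (K : TwoCat) (X Y : K).

Definition pointwise_nfold_pb (T S P : hom1 X Y) (p : T ⇒ S) n (pi : 'I_n -> P ⇒ T)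
    : Prop :=
  is_nfold_pb p pi /\
  forall (X' : K) (F : hom1 X' X), is_nfold_pb (wr p F) (fun k => wr (pi k) F).

Definition pointwise_pb (P A B C : hom1 X Y) (a : P ⇒ A) (b : P ⇒ B) (f : A ⇒ C)
    (g : B ⇒ C) : Prop :=
  is_pb a b f g /\
  forall (X' : K) (F : hom1 X' X), is_pb (wr a F) (wr b F) (wr f F) (wr g F).

End Pointwise.

Fixpoint tpow (K : TwoCat) (X : K) (T : hom1 X X) (m : nat) : hom1 X X :=
  if m is m'.+1 then T ∘ tpow T m' else id1 X.

(* tn n is the n-fold pullback T_n for 0 < n; tn 0 is unconstrained.  The
   pairings <_, _> in ts_assoc, ts_comm, ts_unit, tl_s, tc_s and tl_univ exist
   and are unique by tn_pb and tn_pow; the axioms bind them existentially.     *)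
Record tangent_structure (K : TwoCat) (X : K) := TangentStructure {
  tT : hom1 X X;
  tn : nat -> hom1 X X;
  tpr : forall n, 'I_n -> tn n ⇒ tT;
  tp : tT ⇒ id1 X;
  tz : id1 X ⇒ tT;
  ts : tn 2 ⇒ tT;
  tl : tT ⇒ tT ∘ tT;
  tc : tT ∘ tT ⇒ tT ∘ tT;

  tn_pb : forall n, 0 < n -> pointwise_nfold_pb tp (@tpr n);
  tn_pow : forall m n, 0 < n ->
    pointwise_nfold_pb (wl (tpow tT m) tp) (fun k => wl (tpow tT m) (@tpr n k));

  tpz : tp • tz = id2 (id1 X);
  tps : tp • ts = tp • @tpr 2 ord0;
  ts_assoc : exists u12 u23 v w : tn 3 ⇒ tn 2,
    [/\ is_pair (@tpr 2) u12 (@tpr 3 ord0) (@tpr 3 (lift ord0 ord0)),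
        is_pair (@tpr 2) u23 (@tpr 3 (lift ord0 ord0)) (@tpr 3 ord_max),
        is_pair (@tpr 2) v (ts • u12) (@tpr 3 ord_max),
        is_pair (@tpr 2) w (@tpr 3 ord0) (ts • u23) &
        ts • v = ts • w];
  ts_comm : exists u : tn 2 ⇒ tn 2,
    is_pair (@tpr 2) u (@tpr 2 ord_max) (@tpr 2 ord0) /\ ts • u = ts;
  ts_unit : exists u v : tT ⇒ tn 2,
    [/\ is_pair (@tpr 2) u (tz • tp) (id2 tT), ts • u = id2 tT,
        is_pair (@tpr 2) v (id2 tT) (tz • tp) & ts • v = id2 tT];

  tl_p : wl tT tp • tl ≡ tz • tp;
  tl_z : tl • tz ≡ wl tT tz • tz;
  tl_s : exists u : tn 2 ⇒ tT ∘ tn 2,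
    is_pair (fun k => wl tT (@tpr 2 k)) u (tl • @tpr 2 ord0) (tl • @tpr 2 ord_max) /\
    tl • ts = wl tT ts • u;

  tc_p : wr tp tT • tc ≡ wl tT tp;
  tc_z : tc • wl tT tz ≡ wr tz tT;
  tc_s : exists u : tT ∘ tn 2 ⇒ tn 2 ∘ tT,
    is_pair (fun k => wr (@tpr 2 k) tT) u
      (tc • wl tT (@tpr 2 ord0)) (tc • wl tT (@tpr 2 ord_max)) /\
    tc • wl tT ts = wr ts tT • u;

  tl_l : wl tT tl • tl ≡ wr tl tT • tl;
  tc_l : tc • tl = tl;
  tcc_l : wr tc tT • wl tT tc • wr tl tT ≡ wl tT tl • tc;
  tcc : tc • tc = id2 (tT ∘ tT);
  tYB : wl tT tc • wr tc tT • wl tT tc ≡ wr tc tT • wl tT tc • wr tc tT;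

  tl_univ : exists u : tn 2 ⇒ tT ∘ tn 2,
    is_pair (fun k => wl tT (@tpr 2 k)) u
      (tl • @tpr 2 ord0) (⟦ wr tz tT : tT ⇒ tT ∘ tT ⟧ • @tpr 2 ord_max) /\
    pointwise_pb (wl tT ts • u) (tp • @tpr 2 ord0)
      ⟦ wl tT tp : tT ∘ tT ⇒ tT ⟧ tz
}.

Arguments tpr {K X} t n _.

Record tangentad (K : TwoCat) := Tangentad {
  tobj :> K;
  tstr :> tangent_structure tobj
}.

Record is_lax (K : TwoCat) (X X' : tangentad K) (F : @hom1 K X X')
    (a : F ∘ tT X ⇒ tT X' ∘ F) : Prop := IsLax {
  lax_p : wr (tp X') F • a ≡ wl F (tp X);
  lax_z : a • wl F (tz X) ≡ wr (tz X') F;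
  lax_s : exists u : F ∘ tn X 2 ⇒ tn X' 2 ∘ F,
    is_pair (fun k => wr (tpr X' 2 k) F) u
      (a • wl F (tpr X 2 ord0)) (a • wl F (tpr X 2 ord_max)) /\
    a • wl F (ts X) = wr (ts X') F • u;
  lax_l : wr (tl X') F • a ≡ wl (tT X') a • wr a (tT X) • wl F (tl X);
  lax_c : wr (tc X') F • (wl (tT X') a • wr a (tT X)) ≡
          wl (tT X') a • wr a (tT X) • wl F (tc X)
}.

Record lax_tangent_morphism (K : TwoCat) (X X' : tangentad K) := LaxTangentMorphism {
  lF :> @hom1 K X X';
  la : lF ∘ tT X ⇒ tT X' ∘ lF;
  laP : is_lax la
}.

Record tangent_2morphism (K : TwoCat) (X X' : tangentad K)
    (F G : lax_tangent_morphism X X') := Tangent2Morphism {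
  t2 :> lF F ⇒ lF G;
  t2P : wl (tT X') t2 • la F = la G • wr t2 (tT X)
}.

Lemma lax_eq K (X X' : tangentad K) (F G : lax_tangent_morphism X X') :
  lF F = lF G -> la F ≡ la G -> F = G.
Proof.
case: F G => [F a aP] [G b bP] /= e.
case: G / e b bP => b bP /tot_inj e; case: b / e bP => bP.
by congr LaxTangentMorphism; exact: proof_irrelevance.
Qed.

Lemma t2_eq K (X X' : tangentad K) (F G : lax_tangent_morphism X X')
  (a b : tangent_2morphism F G) : t2 a = t2 b -> a = b.
Proof.
case: a b => [a aP] [b bP] /= e; case: b / e bP => bP.
by congr Tangent2Morphism; exact: proof_irrelevance.
Qed.

Lemma t2_toteq K (X X' : tangentad K) (F G F' G' : lax_tangent_morphism X X')
  (a : tangent_2morphism F G) (b : tangent_2morphism F' G') :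
  F = F' -> G = G' -> t2 a ≡ t2 b -> a ≡ b.
Proof.
move=> eF eG; case: F' / eF b => b; case: G' / eG b => b /tot_inj e.
by congr tot; exact: t2_eq.
Qed.

Section Composition.
Variables (K : TwoCat) (X Y Z : tangentad K).
Variables (G : lax_tangent_morphism Y Z) (F : lax_tangent_morphism X Y).

Definition la_comp : (lF G ∘ lF F) ∘ tT X ⇒ tT Z ∘ (lF G ∘ lF F) :=
  ⟦ wr (la G) F • wl G (la F) : (lF G ∘ lF F) ∘ tT X ⇒ tT Z ∘ (lF G ∘ lF F) ⟧.

Lemma la_compP : is_lax la_comp.
Proof.
split.
- have EG := congr1 (fun c => cc (cr c F) (cl G (tot (la F)))) (lax_p (laP G)).
have EF := congr1 (cl G) (lax_p (laP F)).
cnorm_in EG; cnorm_in EF; cnorm.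
by rewrite EG EF.
- have EG := congr1 (fun c => cr c F) (lax_z (laP G)).
have EF := congr1 (fun c => cc (cr (tot (la G)) F) (cl G c)) (lax_z (laP F)).
cnorm_in EG; cnorm_in EF; cnorm.
by rewrite EF EG.
- have [u [[u1 u2] su]] := lax_s (laP F); have [v [[v1 v2] sv]] := lax_s (laP G).
exists ⟦ wr v F • wl G u : (lF G ∘ lF F) ∘ tn X 2 ⇒ tn Z 2 ∘ (lF G ∘ lF F) ⟧.
have key (a' : tn X 2 ⇒ tT X) (b' : tn Y 2 ⇒ tT Y) (c' : tn Z 2 ⇒ tT Z) :
    wr c' G • v = la G • wl G b' -> wr b' F • u = la F • wl F a' ->
  wr c' (lF G ∘ lF F) •
    ⟦ wr v F • wl G u : (lF G ∘ lF F) ∘ tn X 2 ⇒ tn Z 2 ∘ (lF G ∘ lF F) ⟧ =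
  la_comp • wl (lF G ∘ lF F) a'.
  move=> Eb Ea; apply: tot_inj.
  have EG := congr1 (fun c => cc (cr (tot c) F) (cl G (tot u))) Eb.
  have EF := congr1 (fun c => cc (cr (tot (la G)) F) (cl G (tot c))) Ea.
  by cnorm_in EG; cnorm_in EF; cnorm; rewrite EG EF.
by split; [split; [exact: key v1 u1 | exact: key v2 u2] | rewrite (key _ _ _ (esym sv) (esym su))].
- have EG := congr1 (fun c => cc (cr c F) (cl G (tot (la F)))) (lax_l (laP G)).
have EF := congr1 (cl G) (lax_l (laP F)).
have EI := ccX (tot (la G)) (tot (la F)).
cnorm_in EG; cnorm_in EF; cnorm; rewrite EG EF.
have {}EI := congr1 (fun c => cc (cl (tT Z) (cr (tot (la G)) F)) (cc c
   (cc (cl G (cr (tot (la F)) (tT X))) (cl (lF G ∘ lF F) (tot (tl X)))))) EI.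
rewrite /csrc /ctgt /= in EI; cnorm_in EI.
by rewrite EI.
- have EG := congr1 (fun c => cc (cr c F)
  (cl G (cc (cl (tT Y) (tot (la F))) (cr (tot (la F)) (tT X))))) (lax_c (laP G)).
have EF := congr1 (cl G) (lax_c (laP F)).
have EI := ccX (tot (la G)) (tot (la F)).
have EI1 := congr1 (fun c => cc (cr (tot (tc Z)) (lF G ∘ lF F))
  (cc (cl (tT Z) (cr (tot (la G)) F)) (cc c (cl G (cr (tot (la F)) (tT X)))))) EI.
have EI2 := congr1 (fun c => cc (cl (tT Z) (cr (tot (la G)) F)) (cc c
   (cc (cl G (cr (tot (la F)) (tT X))) (cl (lF G ∘ lF F) (tot (tc X)))))) EI.
rewrite /csrc /ctgt /= in EI1 EI2; cnorm_in EI1; cnorm_in EI2.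
by cnorm_in EG; cnorm_in EF; cnorm; rewrite -EI1 EG EF EI2.
Qed.

Definition lax_comp : lax_tangent_morphism X Z := LaxTangentMorphism la_compP.

End Composition.

Section Identity.
Variables (K : TwoCat) (X : tangentad K).

Definition la_id : id1 X ∘ tT X ⇒ tT X ∘ id1 X :=
  ⟦ id2 (tT X) : id1 X ∘ tT X ⇒ tT X ∘ id1 X ⟧.

Lemma la_idP : is_lax la_id.
Proof.
split.
- by cnorm.
- by cnorm.
- exists ⟦ id2 (tn X 2) : id1 X ∘ tn X 2 ⇒ tn X 2 ∘ id1 X ⟧.
  by split; [split|]; apply: tot_inj; cnorm.
- by cnorm.
- by cnorm.
Qed.

Definition lax_id : lax_tangent_morphism X X := LaxTangentMorphism la_idP.

End Identity.

Section TangentCells.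
Variables (K : TwoCat) (X Y Z : tangentad K).

Fact t2_idP (F : lax_tangent_morphism X Y) :
  wl (tT Y) (id2 (lF F)) • la F = la F • wr (id2 (lF F)) (tT X).
Proof. by apply: tot_inj; cnorm. Qed.

Definition t2_id (F : lax_tangent_morphism X Y) : tangent_2morphism F F :=
  Tangent2Morphism (t2_idP F).

Fact t2_compP (F G H : lax_tangent_morphism X Y)
    (b : tangent_2morphism G H) (a : tangent_2morphism F G) :
  wl (tT Y) (b • a) • la F = la H • wr (b • a) (tT X).
Proof.
have Ea := congr1 (fun c => cc (cl (tT Y) (tot (t2 b))) (tot c)) (t2P a).
have Eb := congr1 (fun c => cc (tot c) (cr (tot (t2 a)) (tT X))) (t2P b).
by apply: tot_inj; cnorm_in Ea; cnorm_in Eb; cnorm; rewrite Ea Eb.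
Qed.

Definition t2_comp (F G H : lax_tangent_morphism X Y)
    (b : tangent_2morphism G H) (a : tangent_2morphism F G) : tangent_2morphism F H :=
  Tangent2Morphism (t2_compP b a).

Fact t2_wlP (H : lax_tangent_morphism Y Z) (F G : lax_tangent_morphism X Y)
    (a : tangent_2morphism F G) :
  wl (tT Z) (wl (lF H) a) • la (lax_comp H F) = la (lax_comp H G) • wr (wl (lF H) a) (tT X).
Proof.
have Ea := congr1 (fun c => cc (cr (tot (la H)) (lF G)) (cl (lF H) (tot c))) (t2P a).
have EI := congr1 (fun c => cc c (cl (lF H) (tot (la F)))) (ccX (tot (la H)) (tot (t2 a))).
rewrite /csrc /ctgt /= in EI.
by apply: tot_inj; cnorm_in Ea; cnorm_in EI; cnorm; rewrite -EI Ea.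
Qed.

Definition t2_wl (H : lax_tangent_morphism Y Z) (F G : lax_tangent_morphism X Y)
    (a : tangent_2morphism F G) : tangent_2morphism (lax_comp H F) (lax_comp H G) :=
  @Tangent2Morphism _ _ _ (lax_comp H F) (lax_comp H G) _ (t2_wlP H a).

Fact t2_wrP (F G : lax_tangent_morphism Y Z) (a : tangent_2morphism F G)
    (E : lax_tangent_morphism X Y) :
  wl (tT Z) (wr (t2 a) E) • la (lax_comp F E) = la (lax_comp G E) • wr (wr (t2 a) E) (tT X).
Proof.
have Ea := congr1 (fun c => cc (cr (tot c) (lF E)) (cl (lF F) (tot (la E)))) (t2P a).
have EI := congr1 (cc (cr (tot (la G)) (lF E))) (ccX (tot (t2 a)) (tot (la E))).
rewrite /csrc /ctgt /= in EI.
by apply: tot_inj; cnorm_in Ea; cnorm_in EI; cnorm; rewrite Ea EI.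
Qed.

Definition t2_wr (F G : lax_tangent_morphism Y Z) (a : tangent_2morphism F G)
    (E : lax_tangent_morphism X Y) : tangent_2morphism (lax_comp F E) (lax_comp G E) :=
  @Tangent2Morphism _ _ _ (lax_comp F E) (lax_comp G E) _ (t2_wrP a E).

End TangentCells.

Section Tng.
Variable K : TwoCat.
Implicit Types X Y Z W : tangentad K.

Fact lax_compA W X Y Z (H : lax_tangent_morphism Y Z) (G : lax_tangent_morphism X Y)
    (F : lax_tangent_morphism W X) :
  lax_comp H (lax_comp G F) = lax_comp (lax_comp H G) F.
Proof. by apply: lax_eq; [exact: comp1A | cnorm]. Qed.

Fact lax_comp1l X Y (F : lax_tangent_morphism X Y) : lax_comp (lax_id Y) F = F.
Proof. by apply: lax_eq; [exact: comp1l | cnorm]. Qed.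

Fact lax_comp1r X Y (F : lax_tangent_morphism X Y) : lax_comp F (lax_id X) = F.
Proof. by apply: lax_eq; [exact: comp1r | cnorm]. Qed.

Definition Tng : TwoCat.
Proof.
refine (@MkTwoCat (tangentad K) (@lax_tangent_morphism K) (@tangent_2morphism K)
  (@lax_id K) (fun X Y Z G F => lax_comp G F) (fun X Y F => t2_id F)
  (fun X Y F G H b a => t2_comp b a) (fun X Y Z H F G a => t2_wl H a)
  (fun X Y Z F G a E => t2_wr a E)
  lax_compA lax_comp1l lax_comp1r _ _ _ _ _ _ _ _ _ _ _ _ _).
- abstract (by move=> *; apply: t2_eq; exact: vcA).
- abstract (by move=> *; apply: t2_eq; exact: vcl).
- abstract (by move=> *; apply: t2_eq; exact: vcr).
- abstract (by move=> *; apply: t2_eq; exact: wl_id2).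
- abstract (by move=> *; apply: t2_eq; exact: wr_id2).
- abstract (by move=> *; apply: t2_eq; exact: wl_vc).
- abstract (by move=> *; apply: t2_eq; exact: wr_vc).
- abstract (by move=> *; apply: t2_toteq; [exact: lax_comp1l..|exact: wl_id1]).
- abstract (by move=> *; apply: t2_toteq; [exact: lax_comp1r..|exact: wr_id1]).
- abstract (by move=> *; apply: t2_toteq; [exact/esym/lax_compA..|exact: wl_comp1]).
- abstract (by move=> *; apply: t2_toteq; [exact: lax_compA..|exact: wr_comp1]).
- abstract (by move=> *; apply: t2_toteq; [exact: lax_compA..|exact: wl_wr]).
- abstract (by move=> *; apply: t2_eq; exact: interchange).
Defined.

End Tng.
Arguments Tng K : simpl never.

Lemma cc_invK (K : TwoCat) (X Y : K) (F : hom1 X Y) (b x : cell (@hom2 K X Y)) :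
  cc b b = tot (id2 F) -> ctgt b = F -> csrc b = F -> ctgt x = F ->
  cc b (cc b x) = x.
Proof. by move=> bb tb sb tx; rewrite ccA ?bb ?cc1l ?tx ?sb ?tb. Qed.

Section HomTangent.
Variable K : TwoCat.
Implicit Types X Y : tangentad K.

Fact tcK X : cc (tot (tc X)) (tot (tc X)) = tot (id2 (tT X ∘ tT X)).
Proof. by rewrite -tot_vcomp; congr tot; exact: tcc. Qed.

Fact tcKl X (Y : K) (E : @hom1 K Y X) (x : cell (@hom2 K Y X)) :
  ctgt x = tT X ∘ tT X ∘ E -> cc (cr (tot (tc X)) E) (cc (cr (tot (tc X)) E) x) = x.
Proof.
by move=> tx; rewrite (@cc_invK _ _ _ (tT X ∘ tT X ∘ E)) // -cr_cc // tcK cr_id2.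
Qed.

Fact tcKTl X x : ctgt x = tT X ∘ tT X ∘ tT X ->
  cc (cl (tT X) (tot (tc X))) (cc (cl (tT X) (tot (tc X))) x) = x.
Proof.
move=> tx; rewrite (@cc_invK _ _ _ (tT X ∘ (tT X ∘ tT X))) //; last by rewrite comp1A.
by rewrite -cl_cc // tcK cl_id2.
Qed.

Lemma tc_lax X : is_lax (tc X).
Proof.
split.
- exact: tc_p.
- exact: tc_z.
- exact: tc_s.
- have E := congr1 (fun c => cc (cl (tT X) (tot (tc X))) (cc (cr (tot (tc X)) (tT X))
    (cc c (tot (tc X))))) (tcc_l X).
  cnorm_in E; rewrite tcK in E; cnorm_in E; cnorm.
  rewrite -E (@tcKl X X (tT X)); last cst; rewrite tcKTl //; cst.
- by have := tYB X; move=> E; cnorm_in E; cnorm.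
Qed.

Definition Tbar X : @hom1 (Tng K) X X := LaxTangentMorphism (tc_lax X).

Fact pbarP X : wl (tT X) (tp X) • la (Tbar X) = la (lax_id X) • wr (tp X) (tT X).
Proof.
apply: tot_inj; have E := congr1 (fun c => cc c (tot (tc X))) (tc_p X).
by cnorm_in E; cnorm; rewrite tcK in E; cnorm_in E; rewrite E.
Qed.

Definition pbar X : Tbar X ⇒ @id1 (Tng K) X :=
  @Tangent2Morphism _ _ _ (Tbar X) (lax_id X) _ (pbarP X).

Fact zbarP X : wl (tT X) (tz X) • la (lax_id X) = la (Tbar X) • wr (tz X) (tT X).
Proof.
apply: tot_inj; have E := congr1 (fun c => cc (tot (tc X)) c) (tc_z X).
cnorm_in E; cnorm; rewrite -E (cc_invK (tcK X)) //; cst.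
Qed.

Definition zbar X : @id1 (Tng K) X ⇒ Tbar X :=
  @Tangent2Morphism _ _ _ (lax_id X) (Tbar X) _ (zbarP X).

Fact lbarP X Y (F : lax_tangent_morphism X Y) :
  wl (tT Y) (la F) • la (lax_comp F (Tbar X)) =
  la (lax_comp (Tbar Y) F) • wr (la F) (tT X).
Proof. by apply: tot_inj; have E := lax_c (laP F); cnorm_in E; cnorm; rewrite E. Qed.

Definition labar X Y (F : @hom1 (Tng K) X Y) : F ∘ Tbar X ⇒ Tbar Y ∘ F :=
  @Tangent2Morphism _ _ _ (lax_comp F (Tbar X)) (lax_comp (Tbar Y) F) _ (lbarP F).

End HomTangent.

Record category := Category {
  cob :> Type;
  chom : cob -> cob -> Type;
  cid : forall x, chom x x;
  ccomp : forall x y z, chom y z -> chom x y -> chom x z;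
  ccompA : forall w x y z (h : chom y z) (g : chom x y) (f : chom w x),
    ccomp h (ccomp g f) = ccomp (ccomp h g) f;
  ccompl : forall x y (f : chom x y), ccomp (cid y) f = f;
  ccompr : forall x y (f : chom x y), ccomp f (cid x) = f
}.
Arguments chom {c}.
Arguments cid {c}.
Arguments ccomp {c x y z}.

Record functor (C D : category) := Functor {
  fob :> C -> D;
  fmap : forall x y, chom x y -> chom (fob x) (fob y);
  fmap_id : forall x, fmap (cid x) = cid (fob x);
  fmap_comp : forall x y z (g : chom y z) (f : chom x y),
    fmap (ccomp g f) = ccomp (fmap g) (fmap f)
}.
Arguments fmap {C D} f {x y} : rename.

(* G F is the identity functor. *)
Definition functor_cancel (C D : category) (F : functor C D) (G : functor D C) : Prop :=
  (forall x, G (F x) = x) /\ forall x y (f : chom x y), fmap G (fmap F f) ≡ f.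

Definition invertible (C D : category) (F : functor C D) : Prop :=
  exists G : functor D C, functor_cancel F G /\ functor_cancel G F.

Definition hom_category (K : TwoCat) (X Y : K) : category :=
  @Category (hom1 X Y) hom2 id2 (@vc K X Y) (@vcA K X Y) (@vcl K X Y) (@vcr K X Y).

(* The Hom-tangent category [X', T' | X, T] is hom_category (K := Tng K) X' X,
   with tangent bundle functor F |-> Tbar X ∘ F.                               *)
Section VectorFields.
Variable K : TwoCat.
Implicit Types X Y V : tangentad K.

Record vector_field X' X (F : @hom1 (Tng K) X' X) := VectorField {
  vf :> F ⇒ Tbar X ∘ F;
  vfP : wr (pbar X) F • vf ≡ id2 F
}.

Record vf_obj X' X := VFObj {
  vob :> @hom1 (Tng K) X' X;
  vfield :> vector_field vob
}.

Record vf_hom X' X (v w : vf_obj X' X) := VFHom {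
  vh :> vob v ⇒ vob w;
  vhP : wl (Tbar X) vh • vfield v = vfield w • vh
}.

Lemma vf_obj_eq X' X (v w : vf_obj X' X) :
  vob v = vob w -> vf (vfield v) ≡ vf (vfield w) -> v = w.
Proof.
case: v w => [F [v vP]] [G [w wP]] /= e; case: G / e w wP => w wP.
move/(@tot_inj (Tng K)) => e.
by case: w / e wP => wP; congr (VFObj (VectorField _)); exact: proof_irrelevance.
Qed.

Lemma vf_hom_eq X' X (v w : vf_obj X' X) (f g : vf_hom v w) : vh f = vh g -> f = g.
Proof.
case: f g => [f fP] [g gP] /= e; case: g / e gP => gP.
by congr VFHom; exact: proof_irrelevance.
Qed.

Definition vf_hom_id X' X (v : vf_obj X' X) : vf_hom v v.
Proof. by exists (id2 (vob v)); abstract (by apply: tot_inj; cnorm). Defined.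

Definition vf_hom_comp X' X (u v w : vf_obj X' X) (g : vf_hom v w) (f : vf_hom u v) :
  vf_hom u w.
Proof.
exists (vh g • vh f); abstract (
  have Ef := congr1 (fun c => cc (cl (Tbar X) (tot (vh g))) (tot c)) (vhP f);
  have Eg := congr1 (fun c => cc (tot c) (tot (vh f))) (vhP g);
  by apply: tot_inj; cnorm_in Ef; cnorm_in Eg; cnorm; rewrite Ef Eg).
Defined.

Definition VF_category X' X : category.
Proof.
refine (@Category (vf_obj X' X) (@vf_hom X' X) (@vf_hom_id X' X) (@vf_hom_comp X' X)
  _ _ _).
- abstract (by move=> *; apply: vf_hom_eq; exact: (@vcA (Tng K))).
- abstract (by move=> *; apply: vf_hom_eq; exact: (@vcl (Tng K))).
- abstract (by move=> *; apply: vf_hom_eq; exact: (@vcr (Tng K))).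
Defined.

Section Gamma.
Variables (V X X' : tangentad K) (U : @hom1 (Tng K) V X) (v : vector_field U).

Fact Gamma_vfP (H : @hom1 (Tng K) X' V) :
  wr (pbar X) (U ∘ H) • ⟦ wr (vf v) H : U ∘ H ⇒ Tbar X ∘ (U ∘ H) ⟧ ≡ id2 (U ∘ H).
Proof.
have E := congr1 (fun c => cr c H) (vfP v).
by cnorm_in E; cnorm.
Qed.

Definition Gamma_ob (H : hom_category (K := Tng K) X' V) : VF_category X' X :=
  VFObj (VectorField (Gamma_vfP H)).

Fact Gamma_mapP (H H' : @hom1 (Tng K) X' V) (a : H ⇒ H') :
  wl (Tbar X) (wl U a) • vfield (Gamma_ob H) = vfield (Gamma_ob H') • wl U a.
Proof.
have E := ccX (tot (vf v)) (tot a); rewrite /csrc /ctgt /= in E.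
by apply: tot_inj; cnorm_in E; cnorm; rewrite -E.
Qed.

Definition Gamma : functor (hom_category (K := Tng K) X' V) (VF_category X' X).
Proof.
refine (@Functor _ (VF_category X' X) Gamma_ob
  (fun H H' a => @VFHom X' X (Gamma_ob H) (Gamma_ob H') _ (Gamma_mapP a)) _ _).
- abstract (by move=> H; apply: vf_hom_eq; exact: (@wl_id2 (Tng K))).
- abstract (by move=> *; apply: vf_hom_eq; exact: (@wl_vc (Tng K))).
Defined.

End Gamma.

End VectorFields.

Section Sum.
Variable K : TwoCat.

Definition t2_cell (X Y : tangentad K) (c : cell (@hom2 (Tng K) X Y)) :
    cell (@hom2 K X Y) := tot (t2 (projT2 c)).

Fact t2_tot (X Y : tangentad K) (F G F' G' : @hom1 (Tng K) X Y) (a : F ⇒ G)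
  (b : F' ⇒ G') : a ≡ b -> t2 a ≡ t2 b.
Proof. exact: (congr1 (@t2_cell X Y)). Qed.

Fact t2_vcomp (X Y : tangentad K) (F G G' H : @hom1 (Tng K) X Y) (b : G' ⇒ H)
  (a : F ⇒ G) (e : G = G') : tot (t2 (vcomp b a e)) = cc (tot (t2 b)) (tot (t2 a)).
Proof. by case: G' / e b => b; rewrite -tot_vc. Qed.

Fact nfold_pb_inj (X Y : K) (T S P Q : hom1 X Y) (p : T ⇒ S) n (pi : 'I_n -> P ⇒ T)
  (a b : Q ⇒ P) : is_nfold_pb p pi -> (forall k, pi k • a = pi k • b) -> a = b.
Proof.
case=> piE piU ab.
have [|u [_ uE]] := piU Q (fun k => pi k • a).
  move=> i j; have E := congr1 (fun c => cc (tot c) (tot a)) (piE i j).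
  by apply: tot_inj; cnorm_in E; cnorm.
by rewrite -(uE a) // -(uE b) // => i; rewrite ab.
Qed.

Lemma ord2P (k : 'I_2) : k = ord0 \/ k = ord_max.
Proof. by case: k => [[|[|k]] lt_k] //; [left|right]; apply: val_inj. Qed.

Variables (X' X : tangentad K) (F : @hom1 (Tng K) X' X) (u w : vector_field F).

Fact vf_underP (v : vector_field F) :
  wr (tp X) (lF F) • t2 (vf v) ≡ id2 (lF F).
Proof. by rewrite tot_vcomp; have := t2_tot (vfP v); rewrite t2_vcomp. Qed.

Fact vf_pairP : exists! t : lF F ⇒ tn X 2 ∘ lF F,
  is_pair (fun k => wr (tpr X 2 k) F) t (t2 (vf u)) (t2 (vf w)).
Proof.
have [_ /(_ _ (lF F)) pbF] := tn_pb X (isT : 0 < 2).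
pose q (k : 'I_2) := if k == ord0 then t2 (vf u) else t2 (vf w).
have [i j|t [tE tU]] := pbF.2 (lF F) q.
  rewrite /q; apply: tot_inj.
  by case: ifP; case: ifP => _ _; rewrite ?vf_underP.
exists t; split; first by split; [exact: (tE ord0)|exact: (tE ord_max)].
move=> t' [t0 t1]; apply: tU => k.
by case: (ord2P k) => ->; [exact: t0|exact: t1].
Qed.

Definition vf_pair : lF F ⇒ tn X 2 ∘ lF F :=
  proj1_sig (constructive_definite_description _ vf_pairP).

Fact vf_pairE :
  is_pair (fun k => wr (tpr X 2 k) F) vf_pair (t2 (vf u)) (t2 (vf w)).
Proof. exact: (proj2_sig (constructive_definite_description _ vf_pairP)). Qed.

Fact vf_sum_t2P :
  wl (tT X) (wr (ts X) F • vf_pair) • la F =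
  la (lax_comp (Tbar X) F) • wr (wr (ts X) F • vf_pair) (tT X').
Proof.
have [q [[q0 q1] qs]] := tc_s X; have [t0 t1] := vf_pairE.
have key (k : 'I_2) (v : vector_field F) :
    wr (tpr X 2 k) (lF F) • vf_pair = t2 (vf v) ->
    wr (tpr X 2 k) (tT X) • q = tc X • wl (tT X) (tpr X 2 k) ->
  wr (tpr X 2 k) (tT X ∘ lF F) •
   ⟦ wr q F • wl (tT X) vf_pair • la F : lF F ∘ tT X' ⇒ tn X 2 ∘ (tT X ∘ lF F) ⟧ =
  wr (tpr X 2 k) (tT X ∘ lF F) •
   ⟦ wl (tn X 2) (la F) • wr vf_pair (tT X') :
     lF F ∘ tT X' ⇒ tn X 2 ∘ (tT X ∘ lF F) ⟧.
  move=> tE qE; apply: tot_inj.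
  have E1 := congr1 (fun c => cc (cr (tot c) (lF F))
    (cc (cl (tT X) (tot vf_pair)) (tot (la F)))) qE.
  have E2 := congr1 (fun c => cc (cr (tot (tc X)) (lF F))
    (cc (cl (tT X) (tot c)) (tot (la F)))) tE.
  have E3 := congr1 (fun c => cc (cr (tot (tc X)) (lF F)) (tot c)) (t2P (vf v)).
  have E4 := congr1 (fun c => cc c (cr (tot vf_pair) (tT X')))
    (ccX (tot (tpr X 2 k)) (tot (la F))).
  have E5 := congr1 (fun c => cc (cl (tT X) (tot (la F))) (cr (tot c) (tT X'))) tE.
  rewrite /csrc /ctgt /= in E4.
  cnorm_in E1; cnorm_in E2; cnorm_in E3; cnorm_in E4; cnorm_in E5; cnorm.
  rewrite E1 E2 E3 E4 E5 (@tcKl _ X X' (lF F)) //; cst.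
have pbTF := (tn_pb X (isT : 0 < 2)).2 _ (tT X ∘ lF F).
have : ⟦ wr q F • wl (tT X) vf_pair • la F : lF F ∘ tT X' ⇒ tn X 2 ∘ (tT X ∘ lF F) ⟧ =
   ⟦ wl (tn X 2) (la F) • wr vf_pair (tT X') :
     lF F ∘ tT X' ⇒ tn X 2 ∘ (tT X ∘ lF F) ⟧.
  apply: (nfold_pb_inj pbTF) => k.
  by case: (ord2P k) => ->; [exact: key t0 q0|exact: key t1 q1].
move/(congr1 (fun c => cc (cr (tot (tc X)) (lF F))
  (cc (cr (tot (ts X)) (tT X ∘ lF F)) (tot c)))) => E.
have E1 := congr1 (fun c => cc (cr (tot (tc X)) (lF F)) (cc (cr (tot c) (lF F))
    (cc (cl (tT X) (tot vf_pair)) (tot (la F))))) qs.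
have E2 := congr1 (fun c => cc (cr (tot (tc X)) (lF F))
  (cc c (cr (tot vf_pair) (tT X')))) (ccX (tot (ts X)) (tot (la F))).
rewrite /csrc /ctgt /= in E2.
apply: tot_inj; cnorm_in E; cnorm_in E1; cnorm_in E2; cnorm.
by rewrite -E2 -E -E1 (@tcKl _ X X' (lF F)) //; cst.
Qed.

Definition vf_sum : vector_field F.
Proof.
exists (@Tangent2Morphism _ _ _ F (lax_comp (Tbar X) F) _ vf_sum_t2P).
abstract (
  apply: t2_toteq; [by []|exact: lax_comp1l|];
  have [t0 _] := vf_pairE;
  have E1 := congr1 (fun c => cc (cr (tot c) (lF F)) (tot vf_pair)) (tps X);
  have E2 := congr1 (fun c => cc (cr (tot (tp X)) (lF F)) (tot c)) t0;
  have E3 := vf_underP u;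
  rewrite t2_vcomp; cnorm_in E1; cnorm_in E2; cnorm_in E3;
  rewrite -tot_vcomp /=; cnorm; by rewrite E1 E2 E3).
Defined.

End Sum.

Record prefunctor2 (K L : TwoCat) := Prefunctor2 {
  f0 :> K -> L;
  f1 : forall X Y, hom1 X Y -> hom1 (f0 X) (f0 Y);
  f2 : forall X Y (F G : hom1 X Y), F ⇒ G -> f1 F ⇒ f1 G
}.
Arguments f1 {K L} p {X Y} F : rename.
Arguments f2 {K L} p {X Y F G} a : rename.

Record is_2functor (K L : TwoCat) (P : prefunctor2 K L) : Prop := Is2Functor {
  f1_id : forall X, f1 P (id1 X) = id1 (P X);
  f1_comp : forall X Y Z (G : hom1 Y Z) (F : hom1 X Y),
    f1 P (G ∘ F) = f1 P G ∘ f1 P F;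
  f2_id : forall X Y (F : hom1 X Y), f2 P (id2 F) = id2 (f1 P F);
  f2_vc : forall X Y (F G H : hom1 X Y) (b : G ⇒ H) (a : F ⇒ G),
    f2 P (vc b a) = vc (f2 P b) (f2 P a);
  f2_wl : forall X Y Z (H : hom1 Y Z) (F G : hom1 X Y) (a : F ⇒ G),
    f2 P (wl H a) ≡ wl (f1 P H) (f2 P a);
  f2_wr : forall X Y Z (F G : hom1 Y Z) (a : F ⇒ G) (E : hom1 X Y),
    f2 P (wr a E) ≡ wr (f2 P a) (f1 P E)
}.

Definition id_2functor (K : TwoCat) : prefunctor2 K K :=
  @Prefunctor2 K K id (fun _ _ F => F) (fun _ _ _ _ a => a).

Definition comp_2functor (K L M : TwoCat) (Q : prefunctor2 L M) (P : prefunctor2 K L) :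
    prefunctor2 K M :=
  @Prefunctor2 K M (fun X => Q (P X)) (fun _ _ F => f1 Q (f1 P F))
    (fun _ _ _ _ a => f2 Q (f2 P a)).

Definition is_2natural (K L : TwoCat) (P Q : prefunctor2 K L)
    (e : forall X, hom1 (P X) (Q X)) : Prop :=
  (forall X Y (F : hom1 X Y), e Y ∘ f1 P F = f1 Q F ∘ e X) /\
  (forall X Y (F G : hom1 X Y) (a : F ⇒ G), wl (e Y) (f2 P a) ≡ wr (f2 Q a) (e X)).

Arguments is_2natural {K L} P Q e.

Record is_2monad (K : TwoCat) (P : prefunctor2 K K)
    (eta : forall X, hom1 X (P X)) (mu : forall X, hom1 (P (P X)) (P X)) : Prop := Is2Monad {
  monad_2functor : is_2functor P;
  eta_2natural : is_2natural (id_2functor K) P eta;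
  mu_2natural : is_2natural (comp_2functor P P) P mu;
  mu_eta_l : forall X, mu X ∘ eta (P X) = id1 (P X);
  mu_eta_r : forall X, mu X ∘ f1 P (eta X) = id1 (P X);
  mu_mu : forall X, mu X ∘ mu (P X) = mu X ∘ f1 P (mu X)
}.

Arguments is_2monad {K} P eta mu.

(* P with projections pi is the n-fold 2-pullback of U along itself. *)
Record is_nfold_2pb (K : TwoCat) (V X : K) (U : hom1 V X) n (P : K)
    (pi : 'I_n -> hom1 P V) : Prop := IsNfold2Pb {
  pb2_comm : forall i j, U ∘ pi i = U ∘ pi j;
  pb2_one : forall (A : K) (h : 'I_n -> hom1 A V),
    (forall i j, U ∘ h i = U ∘ h j) ->
    exists! f : hom1 A P, forall k, pi k ∘ f = h k;
  pb2_two : forall (A : K) (f g : hom1 A P) (a : forall k, pi k ∘ f ⇒ pi k ∘ g),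
    (forall i j, wl U (a i) ≡ wl U (a j)) ->
    exists! b : f ⇒ g, forall k, wl (pi k) b = a k
}.

Definition is_strict (K : TwoCat) (X Y : tangentad K) (F : lax_tangent_morphism X Y) :
    Prop :=
  la F ≡ id2 (lF F ∘ tT X).

(* Gamma strictly preserves all the tangent structure, hence so does its inverse
   functor: invertibility as a functor and as a strict tangent morphism agree. *)
Record vf_construction (K : TwoCat) (X : tangentad K) := VFConstruction {
  VFt : tangentad K;
  VFU : @hom1 (Tng K) VFt X;
  VFU_strict : is_strict VFU;
  VFv : vector_field VFU;
  Gamma_inv : forall X' : tangentad K, invertible (Gamma X' VFv)
}.

Section VF.
Variables (K : TwoCat) (C : forall X : tangentad K, vf_construction X).
Implicit Types X Y : tangentad K.

Definition VF X : tangentad K := VFt (C X).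
Definition U X : @hom1 (Tng K) (VF X) X := VFU (C X).
Definition univ X : vector_field (U X) := VFv (C X).

(* The inverse of Gamma. *)
Definition classify X' X : functor (VF_category X' X) (hom_category (K := Tng K) X' (VF X)) :=
  proj1_sig (constructive_indefinite_description _ (Gamma_inv (C X) X')).

Lemma classifyK X' X :
  functor_cancel (Gamma X' (univ X)) (classify X' X) /\
  functor_cancel (classify X' X) (Gamma X' (univ X)).
Proof.
exact: (proj2_sig (constructive_indefinite_description _ (Gamma_inv (C X) X'))).
Qed.

Lemma labar_p X Y (F : @hom1 (Tng K) X Y) : wr (pbar Y) F • labar F ≡ wl F (pbar X).
Proof.
apply: t2_toteq; [by []|by rewrite comp1l comp1r|].
rewrite t2_vcomp -(lax_p (laP F)); by cnorm.
Qed.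

Fact VF_mor_vfP X Y (F : @hom1 (Tng K) X Y) :
  wr (pbar Y) (F ∘ U X) •
    ⟦ wr (labar F) (U X) • wl F (vf (univ X)) : F ∘ U X ⇒ Tbar Y ∘ (F ∘ U X) ⟧
  ≡ id2 (F ∘ U X).
Proof.
have E1 := congr1 (fun c => cc (cr c (U X)) (cl F (tot (vf (univ X))))) (labar_p F).
have E2 := congr1 (cl F) (vfP (univ X)).
by cnorm_in E1; cnorm_in E2; cnorm; rewrite E1 E2.
Qed.

Definition VF_mor_vf X Y (F : @hom1 (Tng K) X Y) : VF_category (VF X) Y :=
  VFObj (VectorField (VF_mor_vfP F)).

Fact VF_cell_vfP X Y (F G : @hom1 (Tng K) X Y) (a : F ⇒ G) :
  wl (Tbar Y) (wr a (U X)) • vfield (VF_mor_vf F) = vfield (VF_mor_vf G) • wr a (U X).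
Proof.
apply: tot_inj.
have E0 : cc (cl (Tbar Y) (tot a)) (tot (labar F)) =
          cc (tot (labar G)) (cr (tot a) (Tbar X)).
  rewrite -tot_wl -tot_wr -!tot_vc; congr tot; apply: t2_eq; apply: tot_inj.
  by have := congr1 (@tot _ _ _ _) (t2P a); rewrite !totE.
have E1 := congr1 (fun c => cc (cr c (U X)) (cl F (tot (vf (univ X))))) E0.
have E2 := congr1 (cc (cr (tot (labar G)) (U X))) (ccX (tot a) (tot (vf (univ X)))).
rewrite /csrc /ctgt /= in E2.
by cnorm_in E1; cnorm_in E2; cnorm; rewrite E1 E2.
Qed.

Definition VF_cell_vf X Y (F G : @hom1 (Tng K) X Y) (a : F ⇒ G) :
    chom (VF_mor_vf F) (VF_mor_vf G) :=
  @VFHom _ _ _ (VF_mor_vf F) (VF_mor_vf G) _ (VF_cell_vfP a).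

Definition VF_2functor : prefunctor2 (Tng K) (Tng K) :=
  @Prefunctor2 (Tng K) (Tng K) VF
    (fun X Y F => classify (VF X) Y (VF_mor_vf F))
    (fun X Y F G a => fmap (classify (VF X) Y) (VF_cell_vf a)).

Fact zero_vfP X :
  wr (pbar X) (@id1 (Tng K) X) • ⟦ zbar X : @id1 (Tng K) X ⇒ Tbar X ∘ @id1 (Tng K) X ⟧
  ≡ id2 (@id1 (Tng K) X).
Proof.
rewrite !totE cr_id1 -tot_vc; congr tot; apply: t2_eq; exact: tpz.
Qed.

Definition zero_vf X : VF_category X X := VFObj (VectorField (zero_vfP X)).

Definition eta X : @hom1 (Tng K) X (VF X) := classify X X (zero_vf X).

(* VF_n (X, T): an n-fold 2-pullback in K with a tangent structure for which the
   projections are strict and which makes it an n-fold 2-pullback in Tng K.    *)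
Record vf_power n X := VFPower {
  VFn : tangentad K;
  VFpi : 'I_n -> @hom1 (Tng K) VFn (VF X);
  VFpi_strict : forall k, is_strict (VFpi k);
  VFn_2pb : is_nfold_2pb (lF (U X)) (fun k => lF (VFpi k));
  VFn_2pb_Tng : is_nfold_2pb (U X) VFpi
}.

Section Plus.
Variables (X : tangentad K) (W : vf_power 2 X).

Fact VFpiE : U X ∘ VFpi W ord0 = U X ∘ VFpi W ord_max.
Proof. exact: (pb2_comm (VFn_2pb_Tng W)). Qed.

(* The vector fields v_{pi_1} and v_{pi_2} are the images of pi_1 and pi_2
   under Gamma; the second is moved along the equality of 1-morphisms
   U o pi_2 = U o pi_1.                                                       *)
Definition univ1 : vector_field (U X ∘ VFpi W ord0) :=
  vfield (Gamma (VFn W) (univ X) (VFpi W ord0)).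

Definition univ2 : vector_field (U X ∘ VFpi W ord0) :=
  ecast F (vector_field F) (esym VFpiE) (vfield (Gamma (VFn W) (univ X) (VFpi W ord_max))).

Definition plus : @hom1 (Tng K) (VFn W) (VF X) := classify (VFn W) X (VFObj (vf_sum univ1 univ2)).

Definition mu_legs (k : 'I_2) : @hom1 (Tng K) (VF (VF X)) (VF X) :=
  if k == ord0 then U (VF X) else f1 VF_2functor (U X).

Fact mu_legsP (i j : 'I_2) : U X ∘ mu_legs i = U X ∘ mu_legs j.
Proof.
have E : U X ∘ f1 VF_2functor (U X) = U X ∘ U (VF X).
  exact: (congr1 (@vob K _ _) ((classifyK _ _).2.1 (VF_mor_vf (U X)))).
by rewrite /mu_legs; case: ifP; case: ifP => // _ _; rewrite E.
Qed.

Definition mu_pair : @hom1 (Tng K) (VF (VF X)) (VFn W) :=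
  proj1_sig (constructive_definite_description _
    (pb2_one (VFn_2pb_Tng W) mu_legsP)).

Definition mu_at : @hom1 (Tng K) (VF (VF X)) (VF X) := plus ∘ mu_pair.

End Plus.

Definition mu (W : forall X, vf_power 2 X) X : @hom1 (Tng K) (VF (VF X)) (VF X) :=
  mu_at (W X).

End VF.

(* Main.v *)
(* Write V = VF X, with universal vector field v on the strict U : V -> X.  By the
   universal property, a tangent morphism G into V is determined by U G and the
   vector field v_G, and a tangent 2-morphism into V by its image under U.  The
   morphism mu is thus determined by U mu = U U_V and v_mu = v_{U_V} + U(v^V),
   where v^V is the universal vector field of V.  As sums are preserved by
   precomposition and by lax tangent morphisms, naturality of mu reduces to this
   additivity, the unit laws to those of +, and associativity of mu to that of +.

   For the tangent structure on a 2-pullback P of copies of U, the functor T_n of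
   P should have components T_n of V, but U need not commute strictly with T_n.
   Now T_n is a lax tangent endomorphism of X, and Hn = VF(T_n) satisfies
   U Hn = T_n U; it is isomorphic to T_n of V, because the comparison
   U T_n -> T_n U is a morphism of vector fields and so lifts along U.  Hence the
   T_n of P can be taken with components Hn, and each axiom on P follows from
   those of V and X. *)

Require Import Defs.
From mathcomp Require Import all_boot.
From Stdlib Require Import ClassicalEpsilon.

Set Implicit Arguments.
Unset Strict Implicit.
Unset Printing Implicit Defensive.
Local Open Scope twocat_scope.

(** * Untyped cells and sums of generalised elements *)

(** In a strict 2-category, composites of 1-morphisms are equal without being convertible, and
    pairings into [T_2] occur with many such end points. Two devices keep this manageable. Equations
    are computed on untyped cells with the total composite [cc], and end points are restored only
    where a universal property is applied. Pairings are replaced by the relation [vsum]: it says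
    that [c] is the sum of the generalised elements [a] and [b] of [L T F], hides the pairing behind
    an existential, and is stable under whiskering and under morphisms. This matters most for the
    powers: neither [U] nor the projections of [P] need commute strictly with [T_2], so an equation
    between composites of pairings has no direct image under them, whereas a sum does. The axioms of
    a tangent structure are therefore restated for generalised elements, checked in that form on
    [P], and turned back into the original form. *)

Section Ends.
Variables (K : TwoCat) (X Y : K).
Implicit Types (F G H : hom1 X Y) (a b : cell (@hom2 K X Y)).

(** End points are kept as propositional equalities, so that they can be established by rewriting
    with associativity; [typed] and [endsP] then give back a genuine 2-morphism. *)
Definition ends a F G : Prop := csrc a = F /\ ctgt a = G.

Definition typed a F G (e : ends a F G) : F ⇒ G := cast (projT2 a) e.1 e.2.

Lemma tot_typed a F G (e : ends a F G) : tot (typed e) = a.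
Proof. by rewrite /typed tot_cast; elim/cellW: a {e}. Qed.

Lemma endsP a F G : ends a F G -> exists a' : F ⇒ G, a = tot a'.
Proof. by move=> e; exists (typed e); rewrite tot_typed. Qed.

Lemma ends_tot F G (a : F ⇒ G) : ends (tot a) F G.
Proof. by []. Qed.

Lemma ends_cc b a F G H : ends b G H -> ends a F G -> ends (cc b a) F H.
Proof.
by case=> sb tb [sa ta]; split; rewrite ?csrc_cc ?ctgt_cc // ta sb.
Qed.

End Ends.

Lemma ends_cl (K : TwoCat) (X Y Z : K) (H : hom1 Y Z) (F G : hom1 X Y) a :
  ends a F G -> ends (cl H a) (H ∘ F) (H ∘ G).
Proof. by case=> <- <-. Qed.

Lemma ends_cr (K : TwoCat) (X Y Z : K) (H : hom1 X Y) (F G : hom1 Y Z) a :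
  ends a F G -> ends (cr a H) (F ∘ H) (G ∘ H).
Proof. by case=> <- <-. Qed.

Ltac est := by split; cst.

(** Evaluates an equation between typed composites, such as a component of [is_pair], at a
    generalised element [x]. *)
Lemma vcomp_at (K : TwoCat) (X Y A : K) (F : hom1 A X) (G G' H I : @hom1 K X Y)
  (g : G' ⇒ H) (f : I ⇒ G) (e : G = G') (h : I ⇒ H) x :
  vcomp g f e = h -> ctgt x = I ∘ F ->
  cc (cr (tot g) F) (cc (cr (tot f) F) x) = cc (cr (tot h) F) x.
Proof.
move=> <- xE; case: G' / e g => g.
by rewrite tot_vcomp cr_cc // ccA.
Qed.

Section Pullback.
Variables (K : TwoCat) (X Y : K).
Implicit Types (F G H P T S Q : @hom1 K X Y).

(* is_nfold_pb, for cells whose end points are equal but need not be convertible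
   to the expected ones. *)
Definition cpb n (p : cell (@hom2 K X Y)) (pi : 'I_n -> cell (@hom2 K X Y)) P T
    : Prop :=
  [/\ forall k, ends (pi k) P T,
      forall i j, cc p (pi i) = cc p (pi j),
      forall Q (q : 'I_n -> cell (@hom2 K X Y)), (forall k, ends (q k) Q T) ->
        (forall i j, cc p (q i) = cc p (q j)) ->
        exists u : Q ⇒ P, forall k, cc (pi k) (tot u) = q k &
      forall Q (u u' : Q ⇒ P),
        (forall k, cc (pi k) (tot u) = cc (pi k) (tot u')) -> u = u'].

Lemma cpbP n P T S (p : T ⇒ S) (pi : 'I_n -> P ⇒ T) :
  is_nfold_pb p pi <-> cpb (tot p) (fun k => tot (pi k)) P T.
Proof.
split=> [pb|[_ pc pe pu]].
  case: (pb) => pc pe; split=> //.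
  - by move=> i j; have := congr1 (@tot _ _ _ _) (pc i j); rewrite !tot_vcomp.
  - move=> Q q eq cq; have [i j|u [uE _]] := pe Q (fun k => typed (eq k)).
      by apply: tot_inj; rewrite !tot_vcomp !tot_typed.
    by exists u => k; have := congr1 (@tot _ _ _ _) (uE k); rewrite tot_vcomp tot_typed.
  move=> Q u u' uE; apply: (nfold_pb_inj pb) => k; apply: tot_inj.
  by rewrite !tot_vcomp.
split=> [i j|Q q cq]; first by apply: tot_inj; rewrite !tot_vcomp.
have [//|i j|u uE] := pe Q (fun k => tot (q k)).
  by have := congr1 (@tot _ _ _ _) (cq i j); rewrite !tot_vcomp.
exists u; split=> [k|u' u'E]; first by apply: tot_inj; rewrite tot_vcomp.
by apply: pu => k; rewrite uE -u'E tot_vcomp.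
Qed.

Lemma cpb_ext n p p' (pi pi' : 'I_n -> cell (@hom2 K X Y)) P P' T T' :
  p = p' -> (forall k, pi k = pi' k) -> P = P' -> T = T' -> cpb p pi P T ->
  cpb p' pi' P' T'.
Proof.
move=> <- e <- <- [pE pc pe pu]; split.
- by move=> k; rewrite -e.
- by move=> i j; rewrite -!e.
- by move=> Q q /pe H /H [u uE]; exists u => k; rewrite -e uE.
by move=> Q u u' uE; apply: pu => k; rewrite !e.
Qed.

End Pullback.

Section Raw.
Variable K : TwoCat.

(** The data of a tangent structure without its axioms: on a 2-pullback the data are lifted first
    and the axioms are checked afterwards. *)
Record raw (X : K) := Raw {
  rT : hom1 X X;
  rn : nat -> hom1 X X;
  rpr : forall n, 'I_n -> rn n ⇒ rT;
  rp : rT ⇒ id1 X;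
  rz : id1 X ⇒ rT;
  rs : rn 2 ⇒ rT;
  rl : rT ⇒ rT ∘ rT;
  rc : rT ∘ rT ⇒ rT ∘ rT
}.

Definition raw_of (X : K) (S : tangent_structure X) : raw X :=
  Raw (tpr S) (tp S) (tz S) (ts S) (tl S) (tc S).

End Raw.
Arguments rpr {K X} r n _.

Section Sum.
Variables (K : TwoCat) (X : K) (R : raw X).
Implicit Types (A Y : K).

(** Quantifying over [F] makes the pullback pointwise; [L] is the identity for the pullback itself
    and an iterate of [T] for its preservation. *)
Definition preserves n Y (L : hom1 X Y) : Prop :=
  forall A (F : hom1 A X), cpb (cl L (cr (tot (rp R)) F))
    (fun k => cl L (cr (tot (rpr R n k)) F)) (L ∘ rn R n ∘ F) (L ∘ rT R ∘ F).

(* c = L(s) ∘ <a, b>, for generalised elements a, b of L T F over L F. *)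
Definition vsum A Y (L : hom1 X Y) (F : hom1 A X) (a b c : cell (@hom2 K A Y))
    : Prop :=
  exists Q (t : Q ⇒ L ∘ rn R 2 ∘ F),
    [/\ a = cc (cl L (cr (tot (rpr R 2 ord0)) F)) (tot t),
        b = cc (cl L (cr (tot (rpr R 2 ord_max)) F)) (tot t) &
        c = cc (cl L (cr (tot (rs R)) F)) (tot t)].

Lemma pair_inj Y (L : hom1 X Y) A (F : hom1 A X) Q (t t' : Q ⇒ L ∘ rn R 2 ∘ F) :
  preserves 2 L ->
  cc (cl L (cr (tot (rpr R 2 ord0)) F)) (tot t) =
  cc (cl L (cr (tot (rpr R 2 ord0)) F)) (tot t') ->
  cc (cl L (cr (tot (rpr R 2 ord_max)) F)) (tot t) =
  cc (cl L (cr (tot (rpr R 2 ord_max)) F)) (tot t') -> t = t'.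
Proof.
move=> /(_ _ F)[_ _ _ pu] e0 e1; apply: pu => k.
by case: (ord2P k) => ->.
Qed.

Lemma pair_ex Y (L : hom1 X Y) A (F : hom1 A X) Q a b :
  preserves 2 L -> ends a Q (L ∘ rT R ∘ F) -> ends b Q (L ∘ rT R ∘ F) ->
  cc (cl L (cr (tot (rp R)) F)) a = cc (cl L (cr (tot (rp R)) F)) b ->
  exists t : Q ⇒ L ∘ rn R 2 ∘ F,
    cc (cl L (cr (tot (rpr R 2 ord0)) F)) (tot t) = a /\
    cc (cl L (cr (tot (rpr R 2 ord_max)) F)) (tot t) = b.
Proof.
move=> /(_ _ F)[_ _ pe _] ea eb ab.
have [k|i j|t tE] := pe Q (fun k => if k == ord0 then a else b).
- by case: ifP.
- by case: ifP; case: ifP.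
by exists t; split; [exact: (tE ord0)|exact: (tE ord_max)].
Qed.

Lemma vsum_inj Y (L : hom1 X Y) A (F : hom1 A X) a b c c' :
  preserves 2 L -> vsum L F a b c -> vsum L F a b c' -> c = c'.
Proof.
move=> pL [Q [t [a0 b0 ->]]] [Q' [t' [a1 b1 ->]]].
have eQ : Q = Q' by have := congr1 (@csrc _ _ _) a0; rewrite a1 !csrc_cc.
case: Q' / eQ t' a1 b1 => t' a1 b1.
by rewrite (pair_inj (t := t) (t' := t') pL) // -?a0 -?b0.
Qed.

Lemma vsum_ex Y (L : hom1 X Y) A (F : hom1 A X) Q a b :
  preserves 2 L -> ends a Q (L ∘ rT R ∘ F) -> ends b Q (L ∘ rT R ∘ F) ->
  cc (cl L (cr (tot (rp R)) F)) a = cc (cl L (cr (tot (rp R)) F)) b ->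
  exists2 c, ends c Q (L ∘ rT R ∘ F) & vsum L F a b c.
Proof.
move=> pL ea eb ab; have [t [ta tb]] := pair_ex pL ea eb ab.
exists (cc (cl L (cr (tot (rs R)) F)) (tot t)); first by est.
by exists Q, t; rewrite ta tb.
Qed.

Lemma vsum_nat Y (L : hom1 X Y) A (F F' : hom1 A X) (f : F ⇒ F') a b c :
  vsum L F a b c ->
  vsum L F' (cc (cl (L ∘ rT R) (tot f)) a) (cc (cl (L ∘ rT R) (tot f)) b)
    (cc (cl (L ∘ rT R) (tot f)) c).
Proof.
move=> [Q [t [-> -> ->]]]; exists Q.
have [t' t'E] : exists t' : Q ⇒ L ∘ rn R 2 ∘ F',
  cc (cl (L ∘ rn R 2) (tot f)) (tot t) = tot t' by apply: endsP; est.
exists t'; rewrite -t'E.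
have key (x : rn R 2 ⇒ rT R) :
  cc (cl (L ∘ rT R) (tot f)) (cc (cl L (cr (tot x) F)) (tot t)) =
  cc (cl L (cr (tot x) F')) (cc (cl (L ∘ rn R 2) (tot f)) (tot t)).
  have E := congr1 (fun c => cc (cl L c) (tot t)) (ccX (tot x) (tot f)).
  rewrite /csrc /ctgt /= in E.
  by cnorm_in E; cnorm; rewrite E.
by split; apply: key.
Qed.

Lemma vsum_cr Y (L : hom1 X Y) A (F : hom1 A X) A' (E : hom1 A' A) a b c :
  vsum L F a b c -> vsum L (F ∘ E) (cr a E) (cr b E) (cr c E).
Proof.
move=> [Q [t [-> -> ->]]]; exists (Q ∘ E).
have [t' t'E] : exists t' : Q ∘ E ⇒ L ∘ rn R 2 ∘ (F ∘ E),
  cr (tot t) E = tot t' by apply: endsP; est.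
exists t'; rewrite -t'E.
by split; cnorm.
Qed.

Lemma vsum_cl Y (L : hom1 X Y) A (F : hom1 A X) Y' (M : hom1 Y Y') a b c :
  vsum L F a b c -> vsum (M ∘ L) F (cl M a) (cl M b) (cl M c).
Proof.
move=> [Q [t [-> -> ->]]]; exists (M ∘ Q).
have [t' t'E] : exists t' : M ∘ Q ⇒ M ∘ L ∘ rn R 2 ∘ F,
  cl M (tot t) = tot t' by apply: endsP; est.
exists t'; rewrite -t'E.
by split; cnorm.
Qed.

Lemma vsum_ends Y (L : hom1 X Y) A (F : hom1 A X) a b c : vsum L F a b c ->
  exists Q, [/\ ends a Q (L ∘ rT R ∘ F), ends b Q (L ∘ rT R ∘ F) &
               ends c Q (L ∘ rT R ∘ F)].
Proof.
by move=> [Q [t [-> -> ->]]]; exists Q; split; est.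
Qed.

Lemma vsum_p Y (L : hom1 X Y) A (F : hom1 A X) a b c :
  preserves 2 L -> vsum L F a b c ->
  cc (cl L (cr (tot (rp R)) F)) a = cc (cl L (cr (tot (rp R)) F)) b.
Proof.
move=> /(_ _ F)[_ pc _ _] [Q [t [-> -> _]]].
have E := congr1 (fun c => cc c (tot t)) (pc ord0 ord_max).
by cnorm_in E; cnorm.
Qed.

Lemma vsum_ps Y (L : hom1 X Y) A (F : hom1 A X) a b c :
  cc (tot (rp R)) (tot (rs R)) = cc (tot (rp R)) (tot (rpr R 2 ord0)) ->
  vsum L F a b c ->
  cc (cl L (cr (tot (rp R)) F)) c = cc (cl L (cr (tot (rp R)) F)) a.
Proof.
move=> ps [Q [t [-> _ ->]]].
have E := congr1 (fun c => cc (cl L (cr c F)) (tot t)) ps.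
by cnorm_in E; cnorm.
Qed.

Lemma preserves_id n : preserves n (id1 X) -> forall A (F : hom1 A X),
  cpb (cr (tot (rp R)) F) (fun k => cr (tot (rpr R n k)) F) (rn R n ∘ F) (rT R ∘ F).
Proof.
by move=> H A F; apply: cpb_ext (H A F) => [|k||]; rewrite ?cl_id1 ?comp1l.
Qed.

Lemma preserves_1 n Y (L : hom1 X Y) : preserves n L ->
  cpb (cl L (tot (rp R))) (fun k => cl L (tot (rpr R n k))) (L ∘ rn R n) (L ∘ rT R).
Proof.
by move=> /(_ _ (id1 X)); apply: cpb_ext => [|k||]; rewrite ?cr_id1 ?comp1r.
Qed.

(** Removes the identity factor, as [id1 X ∘ rn R 2 ∘ F] is not convertible to [rn R 2 ∘ F];
    [vsum_1] does the same on the other side. *)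
Lemma vsum_id A (F : hom1 A X) a b r : vsum (id1 X) F a b r <->
  exists Q (t : Q ⇒ rn R 2 ∘ F), [/\ a = cc (cr (tot (rpr R 2 ord0)) F) (tot t),
   b = cc (cr (tot (rpr R 2 ord_max)) F) (tot t) & r = cc (cr (tot (rs R)) F) (tot t)].
Proof.
split=> -[Q [t [-> -> ->]]].
  have [t' t'E] : exists t' : Q ⇒ rn R 2 ∘ F, tot t = tot t' by apply: endsP; est.
  by exists Q, t'; rewrite t'E; split; cnorm.
have [t' t'E] : exists t' : Q ⇒ id1 X ∘ rn R 2 ∘ F, tot t = tot t' by apply: endsP; est.
by exists Q, t'; rewrite -t'E; split; cnorm.
Qed.

Lemma vsum_1 Y (L : hom1 X Y) a b r : vsum L (id1 X) a b r <->
  exists Q (t : Q ⇒ L ∘ rn R 2), [/\ a = cc (cl L (tot (rpr R 2 ord0))) (tot t),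
   b = cc (cl L (tot (rpr R 2 ord_max))) (tot t) & r = cc (cl L (tot (rs R))) (tot t)].
Proof.
split=> -[Q [t [-> -> ->]]].
  have [t' t'E] : exists t' : Q ⇒ L ∘ rn R 2, tot t = tot t' by apply: endsP; est.
  by exists Q, t'; rewrite t'E; split; cnorm.
have [t' t'E] : exists t' : Q ⇒ L ∘ rn R 2 ∘ id1 X, tot t = tot t' by apply: endsP; est.
by exists Q, t'; rewrite -t'E; split; cnorm.
Qed.

Lemma vsum_1_pr Y (L : hom1 X Y) Q (t : Q ⇒ L ∘ rn R 2) a b :
  cc (cl L (tot (rpr R 2 ord0))) (tot t) = a ->
  cc (cl L (tot (rpr R 2 ord_max))) (tot t) = b ->
  vsum L (id1 X) a b (cc (cl L (tot (rs R))) (tot t)).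
Proof. by move=> ta tb; apply/vsum_1; exists Q, t; rewrite ta tb. Qed.

Lemma vsum_pr : vsum (id1 X) (id1 X) (tot (rpr R 2 ord0)) (tot (rpr R 2 ord_max))
  (tot (rs R)).
Proof.
apply/vsum_1; exists (rn R 2).
have [t tE] : exists t : rn R 2 ⇒ id1 X ∘ rn R 2, tot (id2 (rn R 2)) = tot t.
  by apply: endsP; est.
by exists t; rewrite -tE; split; cnorm.
Qed.

End Sum.

(** * Tangent structures in terms of sums *)

Section Square.
Variables (K : TwoCat) (X Y : K).

(* is_pb in the style of cpb. *)
Definition csq (a b f g : cell (@hom2 K X Y)) (P A B : hom1 X Y) : Prop :=
  [/\ ends a P A, ends b P B, cc f a = cc g b,
      forall Q a' b', ends a' Q A -> ends b' Q B -> cc f a' = cc g b' ->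
        exists u : Q ⇒ P, cc a (tot u) = a' /\ cc b (tot u) = b' &
      forall Q (u u' : Q ⇒ P), cc a (tot u) = cc a (tot u') ->
        cc b (tot u) = cc b (tot u') -> u = u'].

Lemma csq_ext a b f g P A B a' b' f' g' P' A' B' :
  a = a' -> b = b' -> f = f' -> g = g' -> P = P' -> A = A' -> B = B' ->
  csq a b f g P A B -> csq a' b' f' g' P' A' B'.
Proof. by move=> <- <- <- <- <- <- <-. Qed.

Lemma csqP (P A B C : @hom1 K X Y) (a : P ⇒ A) (b : P ⇒ B) (f : A ⇒ C) (g : B ⇒ C) :
  is_pb a b f g <-> csq (tot a) (tot b) (tot f) (tot g) P A B.
Proof.
split=> [[fa pb]|[_ _ fa pe pu]].
  have {}fa : cc (tot f) (tot a) = cc (tot g) (tot b).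
    by have := congr1 (@tot _ _ _ _) fa; rewrite !tot_vcomp.
  split=> // [Q a' b' /endsP[{}a' ->] /endsP[{}b' ->] ab|Q u u' ua ub].
    have [|u [[<- <-] _]] := pb Q a' b'; first by apply: tot_inj; rewrite !tot_vcomp.
    by exists u; rewrite !tot_vcomp.
  have [|w [_ wU]] := pb Q (a • u) (b • u).
    apply: tot_inj; have E := congr1 (fun c => cc c (tot u)) fa.
    by cnorm_in E; cnorm.
  rewrite -(wU u) // -(wU u') //.
  by split; apply: tot_inj; rewrite !tot_vcomp.
split=> [|Q a' b' ab]; first by apply: tot_inj; rewrite !tot_vcomp.
have [//|//||u [ua ub]] := pe Q (tot a') (tot b').
  by have := congr1 (@tot _ _ _ _) ab; rewrite !tot_vcomp.
exists u; split=> [|u' [u'a u'b]].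
  by split; apply: tot_inj; rewrite tot_vcomp.
by apply: pu; rewrite ?ua ?ub -?u'a -?u'b tot_vcomp.
Qed.

End Square.

Section IsTangent.
Variables (K : TwoCat) (X : K) (R : raw X).
Notation T := (rT R).
Notation p := (tot (rp R)).
Notation z := (tot (rz R)).
Notation s := (tot (rs R)).
Notation l := (tot (rl R)).
Notation c := (tot (rc R)).
Notation pr0 := (tot (rpr R 2 ord0)).
Notation pr1 := (tot (rpr R 2 ord_max)).

(* The axioms of a tangent structure, with the equations between pairings
   expressed by sums of generalised elements. *)
Record is_tangent : Prop := IsTangent {
  tg_pb : forall m n, 0 < n -> preserves R n (tpow T m);
  tg_pz : cc p z = tot (id2 (id1 X));
  tg_ps : cc p s = cc p pr0;
  tg_A : forall A (F : hom1 A X) a b ab d bd r,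
    vsum R (id1 X) F a b ab -> vsum R (id1 X) F ab d r ->
    vsum R (id1 X) F b d bd -> vsum R (id1 X) F a bd r;
  tg_C : forall A (F : hom1 A X) a b r,
    vsum R (id1 X) F a b r -> vsum R (id1 X) F b a r;
  tg_0 : forall A (F : hom1 A X) Q a, ends a Q (T ∘ F) ->
    vsum R (id1 X) F (cc (cr z F) (cc (cr p F) a)) a a;
  tg_lp : cc (cl T p) l = cc z p;
  tg_lz : cc l z = cc (cl T z) z;
  tg_ls : forall A (F : hom1 A X) a b r, vsum R (id1 X) F a b r ->
    vsum R T F (cc (cr l F) a) (cc (cr l F) b) (cc (cr l F) r);
  tg_cp : cc (cr p T) c = cl T p;
  tg_cz : cc c (cl T z) = cr z T;
  tg_cs : forall A (F : hom1 A X) a b r, vsum R T F a b r ->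
    vsum R (id1 X) (T ∘ F) (cc (cr c F) a) (cc (cr c F) b) (cc (cr c F) r);
  tg_ll : cc (cl T l) l = cc (cr l T) l;
  tg_cl : cc c l = l;
  tg_ccl : cc (cr c T) (cc (cl T c) (cr l T)) = cc (cl T l) c;
  tg_cc : cc c c = tot (id2 (T ∘ T));
  tg_YB : cc (cl T c) (cc (cr c T) (cl T c)) = cc (cr c T) (cc (cl T c) (cr c T));
  tg_univ : forall A (F : hom1 A X) Q a b,
    ends a Q (T ∘ T ∘ F) -> ends b Q F ->
    cc (cl T (cr p F)) a = cc (cr z F) b ->
    exists! t : Q ⇒ rn R 2 ∘ F,
      cc (cr (cc p pr0) F) (tot t) = b /\
      vsum R T F (cc (cr (cc l pr0) F) (tot t)) (cc (cr (cc (cr z T) pr1) F) (tot t)) a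
}.

End IsTangent.

Section TangentP.
Variables (K : TwoCat) (X : K) (S : tangent_structure X).
Notation R := (raw_of S).
Notation T := (tT S).

Lemma tangent_pb m n : 0 < n -> preserves R n (tpow T m).
Proof.
move=> n0 A F; have [_ /(_ A F)/cpbP] := tn_pow S m n0.
by apply: cpb_ext => // [|k]; rewrite tot_wr tot_wl cr_cl.
Qed.

Lemma pair_id_inj A (F : hom1 A X) Q (t t' : Q ⇒ tn S 2 ∘ F) :
  cc (cr (tot (tpr S 2 ord0)) F) (tot t) = cc (cr (tot (tpr S 2 ord0)) F) (tot t') ->
  cc (cr (tot (tpr S 2 ord_max)) F) (tot t) = cc (cr (tot (tpr S 2 ord_max)) F) (tot t') ->
  t = t'.
Proof.
have [_ _ _ pu] := preserves_id (tangent_pb 0 (isT : 0 < 2)) F.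
by move=> e0 e1; apply: pu => k; case: (ord2P k) => ->.
Qed.

(** The pairs [t1], [t2], [t3] come from one triple [x] in [T_3 F]: the maps [u12], [v] and [u23] of
    [ts_assoc] send [x] to them, and [w] sends [x] to the pairing that witnesses the conclusion. *)
Lemma tangent_A A (F : hom1 A X) a b ab d bd r :
  vsum R (id1 X) F a b ab -> vsum R (id1 X) F ab d r ->
  vsum R (id1 X) F b d bd -> vsum R (id1 X) F a bd r.
Proof.
move=> /vsum_id[Q [t1 [a1 b1 ab1]]] /vsum_id[Q2 [t2 [ab2 d2 r2]]] /vsum_id[Q3 [t3 [b3 d3 bd3]]].
have eQ : Q = Q2 by have := congr1 (@csrc _ _ _) ab1; rewrite ab2 !csrc_cc.
case: Q2 / eQ t2 ab2 d2 r2 => t2 ab2 d2 r2.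
have eQ : Q = Q3 by have := congr1 (@csrc _ _ _) b1; rewrite b3 !csrc_cc.
case: Q3 / eQ t3 b3 d3 bd3 => t3 b3 d3 bd3.
have [u12 [u23 [v [w [[u120 u121] [u230 u231] [v0 v1] [w0 w1] sE]]]]] := ts_assoc S.
have [_ /(_ A F)/cpbP[_ pc pe pu]] := tn_pb S (isT : 0 < 3).
have [_ /(_ A F)/cpbP[_ pc2 _ _]] := tn_pb S (isT : 0 < 2).
have [pab pbd] : cc (cr (tot (tp S)) F) a = cc (cr (tot (tp S)) F) b /\
                 cc (cr (tot (tp S)) F) b = cc (cr (tot (tp S)) F) d.
  have E := pc2 ord0 ord_max.
  have E1 := congr1 (fun x => cc x (tot t1)) E.
  have E3 := congr1 (fun x => cc x (tot t3)) E.
  by rewrite a1 {2}b3 d3 b1; cnorm_in E1; cnorm_in E3; cnorm.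
(* The triple [a], [b], [d]; the middle index is [lift ord0 ord0]. *)
pose q (k : 'I_3) := if k == ord0 then a else if k == ord_max then d else b.
have [k|i j|x xE] := pe Q q.
- rewrite /q; case: ifP => _; first by rewrite a1; est.
  by case: ifP => _; rewrite ?d2 ?b1; est.
- have pq k : cc (cr (tot (tp S)) F) (q k) = cc (cr (tot (tp S)) F) b.
    by rewrite /q; case: ifP => // _; case: ifP.
  by rewrite -tot_wr in pq; rewrite !pq.
have x0 := xE ord0; have x1 := xE (lift ord0 ord0); have x2 := xE ord_max.
rewrite /q /= in x0 x1 x2.
have [y yE] : exists y : Q ⇒ tn S 2 ∘ F, cc (cr (tot u12) F) (tot x) = tot y.
  by apply: endsP; est.
have [y' y'E] : exists y' : Q ⇒ tn S 2 ∘ F, cc (cr (tot u23) F) (tot x) = tot y'.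
  by apply: endsP; est.
have [y'' y''E] : exists y'' : Q ⇒ tn S 2 ∘ F, cc (cr (tot v) F) (tot x) = tot y''.
  by apply: endsP; est.
have [w' w'E] : exists w' : Q ⇒ tn S 2 ∘ F, cc (cr (tot w) F) (tot x) = tot w'.
  by apply: endsP; est.
have co (f : tn S 3 ⇒ tn S 2) (g h : _ ⇒ T) (e : g • f = h) :=
  @vcomp_at _ _ _ _ F _ _ _ _ _ _ _ _ (tot x) e erefl.
have co2 (f : tn S 3 ⇒ tn S 2) (g : tn S 2 ⇒ T) :
    cc (cr (tot (g • f)) F) (tot x) = cc (cr (tot g) F) (cc (cr (tot f) F) (tot x)).
  by cnorm.
have ey : y = t1.
  apply: pair_id_inj; rewrite -yE.
    by rewrite (co _ _ _ u120) -a1 -x0.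
  by rewrite (co _ _ _ u121) -b1 -x1.
have ey' : y' = t3.
  apply: pair_id_inj; rewrite -y'E.
    by rewrite (co _ _ _ u230) -b3 -x1.
  by rewrite (co _ _ _ u231) -d3 -x2.
have ey'' : y'' = t2.
  apply: pair_id_inj; rewrite -y''E.
    by rewrite (co _ _ _ v0) co2 yE ey -ab1 ab2.
  by rewrite (co _ _ _ v1) -d2 -x2.
apply/vsum_id; exists Q, w'; rewrite -w'E (co _ _ _ w0) (co _ _ _ w1).
split; first by rewrite -x0.
  by rewrite co2 y'E ey' bd3.
by rewrite r2 -ey'' -y''E -!co2 sE.
Qed.

Lemma tangent_C A (F : hom1 A X) a b r :
  vsum R (id1 X) F a b r -> vsum R (id1 X) F b a r.
Proof.
move=> /vsum_id[Q [t [-> -> ->]]]; apply/vsum_id.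
have [u [[u0 u1] us]] := ts_comm S.
have [t' t'E] : exists t' : Q ⇒ tn S 2 ∘ F, cc (cr (tot u) F) (tot t) = tot t'.
  by apply: endsP; est.
exists Q, t'; rewrite -t'E.
by split; rewrite ?(vcomp_at u0) ?(vcomp_at u1) ?(vcomp_at us).
Qed.

Lemma tangent_0 A (F : hom1 A X) Q a : ends a Q (T ∘ F) ->
  vsum R (id1 X) F (cc (cr (tot (tz S)) F) (cc (cr (tot (tp S)) F) a)) a a.
Proof.
move=> /endsP[{}a ->].
have [u [v [[u0 u1] us _ _]]] := ts_unit S; apply/vsum_id.
have [t' t'E] : exists t' : Q ⇒ tn S 2 ∘ F, cc (cr (tot u) F) (tot a) = tot t'.
  by apply: endsP; est.
exists Q, t'; rewrite -t'E.
by split; rewrite ?(vcomp_at u0) ?(vcomp_at u1) ?(vcomp_at us) //; cnorm.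
Qed.

Lemma tangent_ls A (F : hom1 A X) a b r : vsum R (id1 X) F a b r ->
  vsum R T F (cc (cr (tot (tl S)) F) a) (cc (cr (tot (tl S)) F) b)
    (cc (cr (tot (tl S)) F) r).
Proof.
move=> /vsum_id[Q [t [-> -> ->]]].
have [u [[u0 u1] us]] := tl_s S.
have [t' t'E] : exists t' : Q ⇒ T ∘ tn S 2 ∘ F, cc (cr (tot u) F) (tot t) = tot t'.
  by apply: endsP; est.
exists Q, t'; rewrite -t'E /=.
by split; rewrite -cr_cl -tot_wl ?(vcomp_at u0) ?(vcomp_at u1) ?(vcomp_at (esym us)) //; cnorm.
Qed.

Lemma tangent_univ A (F : hom1 A X) Q a b :
  ends a Q (T ∘ T ∘ F) -> ends b Q F ->
  cc (cl T (cr (tot (tp S)) F)) a = cc (cr (tot (tz S)) F) b ->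
  exists! t : Q ⇒ tn S 2 ∘ F,
    cc (cr (cc (tot (tp S)) (tot (tpr S 2 ord0))) F) (tot t) = b /\
    vsum R T F (cc (cr (cc (tot (tl S)) (tot (tpr S 2 ord0))) F) (tot t))
      (cc (cr (cc (cr (tot (tz S)) T) (tot (tpr S 2 ord_max))) F) (tot t)) a.
Proof.
have [u [[u0 u1] [_ /(_ A F)/csqP[_ _ _ pe pu]]]] := tl_univ S.
rewrite !(tot_wr, tot_cast, tot_wl, tot_vcomp) in pe pu.
(* As [u] is the pairing inside the top map of the universality square, the sum condition says that
   this map sends [t] to [a']. *)
have sumE (t : Q ⇒ tn S 2 ∘ F) a' :
    vsum R T F (cc (cr (cc (tot (tl S)) (tot (tpr S 2 ord0))) F) (tot t))
      (cc (cr (cc (cr (tot (tz S)) T) (tot (tpr S 2 ord_max))) F) (tot t)) a' <->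
    cc (cr (cc (cl T (tot (ts S))) (tot u)) F) (tot t) = a'.
  have [t' t'E] : exists t' : Q ⇒ T ∘ tn S 2 ∘ F, cc (cr (tot u) F) (tot t) = tot t'.
    by apply: endsP; est.
  have H : vsum R T F (cc (cr (cc (tot (tl S)) (tot (tpr S 2 ord0))) F) (tot t))
      (cc (cr (cc (cr (tot (tz S)) T) (tot (tpr S 2 ord_max))) F) (tot t))
      (cc (cr (cc (cl T (tot (ts S))) (tot u)) F) (tot t)).
    exists Q, t'; rewrite -t'E /=.
    by split; rewrite -cr_cl -tot_wl ?(vcomp_at u0) ?(vcomp_at u1) //; cnorm.
  split=> [|<- //]; have := tangent_pb 1 (isT : 0 < 2); rewrite /= comp1r => pT.
  exact: vsum_inj H.
move=> ea eb ab.
have [//||//|t [ta tb]] := pe Q a b.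
- by rewrite comp1l.
- by rewrite -ab -cr_cl.
exists t; split=> [|t' [tb' /sumE ta']].
  by split; [|apply/sumE; rewrite ta].
by apply: pu; rewrite ?ta ?tb ?ta' ?tb'.
Qed.

End TangentP.

(** The pairing [u] of [lax_s] is a comparison from [G T_2] to [T_2 G]; composing the given pairing
    with it yields the pairing for the images. *)
Lemma lax_vsum (K : TwoCat) (X Y : tangentad K) (G : lax_tangent_morphism X Y) A
  (F : hom1 A X) a b r : vsum (raw_of X) G F a b r ->
  vsum (raw_of Y) (id1 Y) (G ∘ F) (cc (cr (tot (la G)) F) a)
    (cc (cr (tot (la G)) F) b) (cc (cr (tot (la G)) F) r).
Proof.
move=> [Q [t [-> -> ->]]]; apply/vsum_id.
have [u [[u0 u1] us]] := lax_s (laP G).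
have [t' t'E] : exists t' : Q ⇒ tn Y 2 ∘ (G ∘ F), cc (cr (tot u) F) (tot t) = tot t'.
  by apply: endsP; est.
exists Q, t'; rewrite -t'E /=.
have key (g : tn Y 2 ⇒ tT Y) (h : tn X 2 ⇒ tT X) : wr g G • u = la G • wl G h ->
  cc (cr (tot (la G)) F) (cc (cl G (cr (tot h) F)) (tot t)) =
  cc (cr (tot g) (G ∘ F)) (cc (cr (tot u) F) (tot t)).
  move=> e; have E := congr1 (fun c => cc (cr (tot c) F) (tot t)) e.
  by cnorm_in E; cnorm; rewrite E.
by split; rewrite ?(key _ _ u0) ?(key _ _ u1) ?(key _ _ (esym us)).
Qed.

Lemma tangentP (K : TwoCat) (X : tangentad K) : is_tangent (raw_of X).
Proof.
split.
- exact: tangent_pb.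
- by have := congr1 (@tot _ _ _ _) (tpz X); rewrite tot_vcomp.
- by have := congr1 (@tot _ _ _ _) (tps X); rewrite !tot_vcomp.
- exact: tangent_A.
- exact: tangent_C.
- exact: tangent_0.
- by have := tl_p X; rewrite !tot_vcomp.
- by have := tl_z X; rewrite !tot_vcomp.
- exact: tangent_ls.
- by have := tc_p X; rewrite !tot_vcomp.
- by have := tc_z X; rewrite !tot_vcomp.
(* Additivity of [c] is [lax_s] for [Tbar X], whose structural 2-morphism is [c]. *)
- move=> A F a b r /(@lax_vsum _ X X (Tbar X)) //.
- by have := tl_l X; rewrite !tot_vcomp.
- by have := congr1 (@tot _ _ _ _) (tc_l X); rewrite !tot_vcomp.
- by have := tcc_l X; rewrite !tot_vcomp => E; cnorm_in E; cnorm; exact: E.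
- by have := congr1 (@tot _ _ _ _) (tcc X); rewrite !tot_vcomp.
- by have := tYB X; rewrite !tot_vcomp => E; cnorm_in E; cnorm; exact: E.
- exact: tangent_univ.
Qed.

Lemma raw_eta (K : TwoCat) (X : K) (R : raw X) :
  Raw (rpr R) (rp R) (rz R) (rs R) (rl R) (rc R) = R.
Proof. by case: R. Qed.

(** * Recovering a tangent structure from the axioms on sums *)

Section OfRaw.
Variables (K : TwoCat) (X : K) (R : raw X).
Hypothesis tg : is_tangent R.
Notation T := (rT R).
Notation p := (tot (rp R)).
Notation pr n k := (tot (rpr R n k)).
Notation s := (tot (rs R)).

Let pb_id n : 0 < n -> preserves R n (id1 X).
Proof. exact: (tg_pb tg 0). Qed.
Let pb_T n : 0 < n -> preserves R n T.
Proof. by move=> n0; have := tg_pb tg 1 n0; rewrite /= comp1r. Qed.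
Let pb2 := pb_id (isT : 0 < 2).
Let pbT2 := pb_T (isT : 0 < 2).

Let cpb1 n : 0 < n -> cpb p (fun k => pr n k) (rn R n) T.
Proof.
by move=> /pb_id/preserves_1; apply: cpb_ext => [|k||]; rewrite ?cl_id1 ?comp1l.
Qed.

(** The pairing comes together with its sum, so that the axioms on sums apply at once to the
    pairings that [tangent_structure] binds existentially. *)
Let pair_1 Q a b : ends a Q T -> ends b Q T -> cc p a = cc p b ->
  exists2 t : Q ⇒ rn R 2, cc (pr 2 ord0) (tot t) = a /\ cc (pr 2 ord_max) (tot t) = b &
    vsum R (id1 X) (id1 X) a b (cc s (tot t)).
Proof.
move=> ea eb ab.
have [_ _ pe _] := cpb1 (isT : 0 < 2).
have [k|i j|t tE] := pe Q (fun k => if k == ord0 then a else b).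
- by case: ifP.
- by case: ifP; case: ifP.
have t0 := tE ord0; have t1 := tE ord_max; rewrite /= in t0 t1.
exists t => //; apply/vsum_id; exists Q.
have [t' t'E] : exists t' : Q ⇒ rn R 2 ∘ id1 X, tot t = tot t' by apply: endsP; est.
by exists t'; rewrite -t'E !cr_id1 t0 t1.
Qed.

Let is_pairP Y (P B Q : @hom1 K Y X) (pi : 'I_2 -> P ⇒ B) (u : Q ⇒ P) a b :
  cc (tot (pi ord0)) (tot u) = tot a -> cc (tot (pi ord_max)) (tot u) = tot b ->
  is_pair pi u a b.
Proof. by move=> u0 u1; split; apply: tot_inj; rewrite tot_vcomp. Qed.

Let prC n i j : 0 < n -> cc p (pr n i) = cc p (pr n j).
Proof. by move=> n0; have [_ H _ _] := cpb1 n0; exact: H. Qed.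

Let assoc : exists u12 u23 v w : rn R 3 ⇒ rn R 2,
    [/\ is_pair (rpr R 2) u12 (rpr R 3 ord0) (rpr R 3 (lift ord0 ord0)),
        is_pair (rpr R 2) u23 (rpr R 3 (lift ord0 ord0)) (rpr R 3 ord_max),
        is_pair (rpr R 2) v (rs R • u12) (rpr R 3 ord_max),
        is_pair (rpr R 2) w (rpr R 3 ord0) (rs R • u23) &
        rs R • v = rs R • w].
Proof.
have sp (u : rn R 3 ⇒ rn R 2) k a : cc (pr 2 ord0) (tot u) = pr 3 a ->
    cc p (cc s (tot u)) = cc p (pr 3 k).
  move=> uE; have E := congr1 (fun c => cc c (tot u)) (tg_ps tg); cnorm_in E.
  by rewrite E uE; exact: prC.
have [//|//||u12 [u0 u1] su] := @pair_1 (rn R 3) (pr 3 ord0) (pr 3 (lift ord0 ord0)).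
  exact: prC.
have [//|//||u23 [u0' u1'] su'] := @pair_1 (rn R 3) (pr 3 (lift ord0 ord0)) (pr 3 ord_max).
  exact: prC.
have [||//|v [v0 v1] sv] := @pair_1 (rn R 3) (cc s (tot u12)) (pr 3 ord_max).
- by est.
- by est.
- exact: sp u0.
have [||//|w [w0 w1] sw] := @pair_1 (rn R 3) (pr 3 ord0) (cc s (tot u23)).
- by est.
- by est.
- by symmetry; exact: sp u0'.
exists u12, u23, v, w; split; try by apply: is_pairP; rewrite ?tot_vcomp.
apply: tot_inj; rewrite !tot_vcomp.
exact: vsum_inj pb2 (tg_A tg su sv su') sw.
Qed.

Let comm : exists u : rn R 2 ⇒ rn R 2,
    is_pair (rpr R 2) u (rpr R 2 ord_max) (rpr R 2 ord0) /\ rs R • u = rs R.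
Proof.
have [//|//||u [u0 u1] su] := @pair_1 (rn R 2) (pr 2 ord_max) (pr 2 ord0).
  exact: prC.
exists u; split; first exact: is_pairP.
apply: tot_inj; rewrite tot_vcomp; apply: vsum_inj pb2 su _; exact: (tg_C tg) (vsum_pr R).
Qed.

Let unit : exists u v : T ⇒ rn R 2,
    [/\ is_pair (rpr R 2) u (rz R • rp R) (id2 T), rs R • u = id2 T,
        is_pair (rpr R 2) v (id2 T) (rz R • rp R) & rs R • v = id2 T].
Proof.
have pzp : cc p (cc (tot (rz R)) p) = cc p (tot (id2 T)).
  by have := congr1 (fun c => cc c p) (tg_pz tg); cnorm.
have s0 := @tg_0 _ _ _ tg _ (id1 X) T (tot (id2 T)).
have {s0} : vsum R (id1 X) (id1 X) (cc (tot (rz R)) p) (tot (id2 T)) (tot (id2 T)).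
  have -> : cc (tot (rz R)) p = cc (cr (tot (rz R)) (id1 X))
    (cc (cr p (id1 X)) (tot (id2 T))) by cnorm.
  by apply: s0; split; rewrite ?comp1r.
move=> s0; have s1 := tg_C tg s0.
have [||//|u [u0 u1] su] := @pair_1 T (cc (tot (rz R)) p) (tot (id2 T)).
- by est.
- by est.
have [||//|v [v0 v1] sv] := @pair_1 T (tot (id2 T)) (cc (tot (rz R)) p).
- by est.
- by est.
exists u, v; split; try by apply: is_pairP; rewrite ?tot_vcomp.
  by apply: tot_inj; rewrite tot_vcomp; apply: vsum_inj pb2 su s0.
by apply: tot_inj; rewrite tot_vcomp; apply: vsum_inj pb2 sv s1.
Qed.

Let pairT_1 Q a b : ends a Q (T ∘ T) -> ends b Q (T ∘ T) ->
  cc (cl T p) a = cc (cl T p) b ->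
  exists t : Q ⇒ T ∘ rn R 2,
  cc (cl T (pr 2 ord0)) (tot t) = a /\ cc (cl T (pr 2 ord_max)) (tot t) = b.
Proof.
move=> ea eb ab.
have [_ _ pe _] := preserves_1 pbT2.
have [k|i j|t tE] := pe Q (fun k => if k == ord0 then a else b).
- by case: ifP.
- by case: ifP; case: ifP.
by exists t; split; [exact: (tE ord0)|exact: (tE ord_max)].
Qed.

Let pairrT_1 Q a b : ends a Q (T ∘ T) -> ends b Q (T ∘ T) ->
  cc (cr p T) a = cc (cr p T) b ->
  exists t : Q ⇒ rn R 2 ∘ T,
  cc (cr (pr 2 ord0) T) (tot t) = a /\ cc (cr (pr 2 ord_max) T) (tot t) = b.
Proof.
move=> ea eb ab.
have [_ _ pe _] := preserves_id pb2 T.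
have [k|i j|t tE] := pe Q (fun k => if k == ord0 then a else b).
- by case: ifP.
- by case: ifP; case: ifP.
by exists t; split; [exact: (tE ord0)|exact: (tE ord_max)].
Qed.

Let add_l : exists u : rn R 2 ⇒ T ∘ rn R 2,
    is_pair (fun k => wl T (rpr R 2 k)) u (rl R • rpr R 2 ord0) (rl R • rpr R 2 ord_max) /\
    rl R • rs R = wl T (rs R) • u.
Proof.
have lp := tg_lp tg.
have [|||u [u0 u1]] := @pairT_1 (rn R 2) (cc (tot (rl R)) (pr 2 ord0))
  (cc (tot (rl R)) (pr 2 ord_max)).
- by est.
- by est.
- have E0 := congr1 (fun c => cc c (pr 2 ord0)) lp.
  have E1 := congr1 (fun c => cc c (pr 2 ord_max)) lp.
  cnorm_in E0; cnorm_in E1; cnorm; rewrite E0 E1.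
  by rewrite (prC ord0 ord_max).
exists u; split; first by apply: is_pairP; rewrite ?tot_vcomp.
apply: tot_inj; rewrite !tot_vcomp; have := tg_ls tg (vsum_pr R); rewrite !cr_id1 => H.
exact: vsum_inj pbT2 H (vsum_1_pr u0 u1).
Qed.

Let add_c : exists u : T ∘ rn R 2 ⇒ rn R 2 ∘ T,
    is_pair (fun k => wr (rpr R 2 k) T) u
      (rc R • wl T (rpr R 2 ord0)) (rc R • wl T (rpr R 2 ord_max)) /\
    rc R • wl T (rs R) = wr (rs R) T • u.
Proof.
have cp := tg_cp tg.
have [|||u [u0 u1]] := @pairrT_1 (T ∘ rn R 2) (cc (tot (rc R)) (cl T (pr 2 ord0)))
  (cc (tot (rc R)) (cl T (pr 2 ord_max))).
- by est.
- by est.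
- have E0 := congr1 (fun c => cc c (cl T (pr 2 ord0))) cp.
  have E1 := congr1 (fun c => cc c (cl T (pr 2 ord_max))) cp.
  have E := congr1 (cl T) (@prC 2 ord0 ord_max isT).
  by cnorm_in E0; cnorm_in E1; cnorm_in E; cnorm; rewrite E0 E1.
exists u; split; first by apply: is_pairP; rewrite ?tot_vcomp.
apply: tot_inj; rewrite !tot_vcomp.
have := vsum_cl T (vsum_pr R); rewrite comp1r => /(tg_cs tg); rewrite cr_id1 comp1r => H.
apply: vsum_inj pb2 H _; apply/vsum_id; exists (T ∘ rn R 2), u; split=> //.
Qed.

Let univ : exists u : rn R 2 ⇒ T ∘ rn R 2,
    is_pair (fun k => wl T (rpr R 2 k)) u
      (rl R • rpr R 2 ord0) (⟦ wr (rz R) T : T ⇒ T ∘ T ⟧ • rpr R 2 ord_max) /\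
    pointwise_pb (wl T (rs R) • u) (rp R • rpr R 2 ord0)
      ⟦ wl T (rp R) : T ∘ T ⇒ T ⟧ (rz R).
Proof.
have lp := tg_lp tg.
have [|||u [u0 u1]] := @pairT_1 (rn R 2) (cc (tot (rl R)) (pr 2 ord0))
  (cc (cr (tot (rz R)) T) (pr 2 ord_max)).
- by est.
- by est.
- have E0 := congr1 (fun c => cc c (pr 2 ord0)) lp.
  have E1 := congr1 (fun c => cc c (pr 2 ord_max)) (ccX (tot (rz R)) p).
  rewrite /csrc /ctgt /= in E1.
  cnorm_in E0; cnorm_in E1; cnorm; rewrite E0 -E1.
  by rewrite (prC ord0 ord_max).
exists u; split; first by apply: is_pairP; rewrite !totE.
(* One square for all [F]: the identity gives the pullback, and arbitrary [F] its pointwise form. *)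
suff main : forall Y (F : hom1 Y X),
    csq (cr (cc (cl T s) (tot u)) F) (cr (cc p (pr 2 ord0)) F)
      (cr (cl T p) F) (cr (tot (rz R)) F) (rn R 2 ∘ F) (T ∘ T ∘ F) F.
  split.
    apply/csqP; rewrite !totE.
    by apply: csq_ext (main _ (id1 X)); rewrite ?cr_id1 ?comp1r.
  move=> Y F; apply/csqP; rewrite !totE.
  by apply: csq_ext (main _ F); rewrite // ?comp1l.
move=> Y F.
have sumE Q (t : Q ⇒ rn R 2 ∘ F) a' :
    vsum R T F (cc (cr (cc (tot (rl R)) (pr 2 ord0)) F) (tot t))
      (cc (cr (cc (cr (tot (rz R)) T) (pr 2 ord_max)) F) (tot t)) a' <->
    cc (cr (cc (cl T s) (tot u)) F) (tot t) = a'.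
  have [t' t'E] : exists t' : Q ⇒ T ∘ rn R 2 ∘ F, cc (cr (tot u) F) (tot t) = tot t'.
    by apply: endsP; est.
  have H : vsum R T F (cc (cr (cc (tot (rl R)) (pr 2 ord0)) F) (tot t))
      (cc (cr (cc (cr (tot (rz R)) T) (pr 2 ord_max)) F) (tot t))
      (cc (cr (cc (cl T s) (tot u)) F) (tot t)).
    exists Q, t'; rewrite -t'E -u0 -u1; split; cnorm => //.
  by split=> [|<- //]; exact: vsum_inj H.
split.
- by est.
- by split; rewrite ?csrc_cr ?ctgt_cr ?csrc_cc ?ctgt_cc // ctgt_tot comp1l.
- have E0 := congr1 (fun c => cl T c) (tg_ps tg).
  have E1 := congr1 (fun c => cc c (tot u)) E0.
  have E2 := congr1 (fun c => cc c (pr 2 ord0)) lp.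
  have E3 := congr1 (fun c => cc (cl T p) c) u0.
  cnorm_in E1; cnorm_in E2; cnorm_in E3.
  have E : cc (cl T p) (cc (cl T s) (tot u)) = cc (tot (rz R)) (cc p (pr 2 ord0)).
    by rewrite E1 E3 E2.
  by have := congr1 (fun c => cr c F) E; cnorm.
- move=> Q a b ea eb ab.
  rewrite cr_cl in ab.
  have [t [[tb /sumE ta] _]] := tg_univ tg ea eb ab.
  by exists t; split; [exact: ta|exact: tb].
move=> Q t t' ta tb.
(* [t] and [t'] both solve the problem posed by the images of [t], so both equal its unique solution
   [t0]. *)
have [|||t0 [_ tU]] := @tg_univ _ _ _ tg _ F Q (cc (cr (cc (cl T s) (tot u)) F) (tot t))
  (cc (cr (cc p (pr 2 ord0)) F) (tot t)).
- by est.
- by est.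
- have E0 := congr1 (fun c => cl T c) (tg_ps tg).
  have E1 := congr1 (fun c => cc c (tot u)) E0.
  have E2 := congr1 (fun c => cc c (pr 2 ord0)) lp.
  have E3 := congr1 (fun c => cc (cl T p) c) u0.
  cnorm_in E1; cnorm_in E2; cnorm_in E3.
  have E : cc (cl T p) (cc (cl T s) (tot u)) = cc (tot (rz R)) (cc p (pr 2 ord0)).
    by rewrite E1 E3 E2.
  by have := congr1 (fun c => cc (cr c F) (tot t)) E; cnorm.
suff H t1 : cc (cr (cc (cl T s) (tot u)) F) (tot t) = cc (cr (cc (cl T s) (tot u)) F) (tot t1) ->
    cc (cr (cc p (pr 2 ord0)) F) (tot t) = cc (cr (cc p (pr 2 ord0)) F) (tot t1) -> t0 = t1.
  by rewrite -(H t erefl erefl); exact: H.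
by move=> ta1 tb1; apply: tU; split; [exact: esym tb1|apply/sumE; exact: esym ta1].
Qed.

(** The equality [raw_of S = R] is part of the conclusion, so that facts proved about [R] can be
    rewritten into facts about [S]. *)
Lemma tangent_of_raw : exists S : tangent_structure X, raw_of S = R.
Proof.
have pbP n : 0 < n -> pointwise_nfold_pb (rp R) (@rpr _ _ R n).
  by move=> n0; split=> [|Y F]; apply/cpbP; [exact: cpb1|exact: preserves_id (pb_id n0) _ F].
have powP m n : 0 < n ->
    pointwise_nfold_pb (wl (tpow T m) (rp R)) (fun k => wl (tpow T m) (rpr R n k)).
  move=> /(tg_pb tg m) pb; split=> [|Y F]; apply/cpbP.
    by have := preserves_1 pb.
  by apply: cpb_ext (pb _ F) => [|k||] //; rewrite tot_wr tot_wl cr_cl.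
unshelve eexists (@TangentStructure K X T (rn R) (rpr R) (rp R) (rz R) (rs R) (rl R)
  (rc R) pbP powP _ _ assoc comm unit _ _ add_l _ _ add_c _ _ _ _ _ univ).
all: rewrite ?totE.
- by apply: tot_inj; rewrite totE; exact: tg_pz.
- by apply: tot_inj; rewrite !totE; exact: tg_ps.
- exact: tg_lp.
- exact: tg_lz.
- exact: tg_cp.
- exact: tg_cz.
- exact: tg_ll.
- by apply: tot_inj; rewrite totE; exact: tg_cl.
- by have E := tg_ccl tg; cnorm_in E; cnorm.
- by apply: tot_inj; rewrite totE; exact: tg_cc.
- by have E := tg_YB tg; cnorm_in E; cnorm.
exact: raw_eta.
Qed.

End OfRaw.

(** * Morphisms into the tangentad of vector fields *)

Section Strict.
Variables (K : TwoCat) (X Y : tangentad K) (F : lax_tangent_morphism X Y).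
Hypothesis sF : is_strict F.

Lemma strict_T : lF F ∘ tT X = tT Y ∘ lF F.
Proof. by have [_ ->] := cell_ends sF. Qed.

Lemma strict_la : tot (la F) = tot (id2 (lF F ∘ tT X)).
Proof. exact: sF. Qed.

Lemma strict_p : cl F (tot (tp X)) = cr (tot (tp Y)) F.
Proof.
have := lax_p (laP F); rewrite !totE strict_la cc1r //.
by rewrite csrc_cr csrc_tot strict_T.
Qed.

Lemma strict_z : cl F (tot (tz X)) = cr (tot (tz Y)) F.
Proof. by have := lax_z (laP F); rewrite !totE strict_la cc1l. Qed.

Lemma strict_l : cl F (tot (tl X)) = cr (tot (tl Y)) F.
Proof.
have := lax_l (laP F); rewrite !totE strict_la cl_id2 cr_id2.
rewrite cc1r; last by rewrite csrc_cr csrc_tot strict_T.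
rewrite cc1r; last by rewrite csrc_tot comp1A strict_T.
by rewrite cc1l // ctgt_cl ctgt_tot !comp1A strict_T.
Qed.

Lemma strict_c : cl F (tot (tc X)) = cr (tot (tc Y)) F.
Proof.
have := lax_c (laP F); rewrite !totE strict_la cl_id2 cr_id2.
have FTT : lF F ∘ tT X ∘ tT X = tT Y ∘ tT Y ∘ lF F.
  by rewrite strict_T -!comp1A strict_T.
rewrite cc1l; last by rewrite ctgt_tot comp1A strict_T.
rewrite cc1r; last by rewrite csrc_cr csrc_tot FTT.
by rewrite cc1l // ctgt_cl ctgt_tot comp1A.
Qed.

Lemma strict_vsum A (E : hom1 A X) a b r : vsum (raw_of X) (id1 X) E a b r ->
  vsum (raw_of Y) (id1 Y) (lF F ∘ E) (cl F a) (cl F b) (cl F r).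
Proof.
move=> H; have [Q [ea eb er]] := vsum_ends H.
have := vsum_cl F H; rewrite comp1r => /lax_vsum.
by rewrite strict_la cr_id2 !cc1l // ctgt_cl ?ea.2 ?eb.2 ?er.2 /=;
   rewrite comp1l comp1A.
Qed.

(** A strict morphism commutes with [T] on the nose but not necessarily with [T_2]; preservation of
    [s] is therefore phrased as a sum of the images of the projections. *)
Lemma strict_s : vsum (raw_of Y) (id1 Y) F (cl F (tot (tpr X 2 ord0)))
  (cl F (tot (tpr X 2 ord_max))) (cl F (tot (ts X))).
Proof. by have := strict_vsum (vsum_pr (raw_of X)); rewrite comp1r. Qed.

End Strict.

Lemma t2_cast (K : TwoCat) (X Y : tangentad K) (F G F' G' : @hom1 (Tng K) X Y)
  (a : F ⇒ G) (eF : F = F') (eG : G = G') : tot (t2 (cast a eF eG)) = tot (t2 a).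
Proof. by case: F' / eF; case: G' / eG. Qed.

Lemma la_compE (K : TwoCat) (X Y Z : tangentad K) (G : @hom1 (Tng K) Y Z)
  (F : @hom1 (Tng K) X Y) :
  tot (la (G ∘ F)) = cc (cr (tot (la G)) (lF F)) (cl (lF G) (tot (la F))).
Proof. by rewrite /= /la_comp !totE. Qed.

Lemma la_strict_comp (K : TwoCat) (X Y Z : tangentad K) (G : @hom1 (Tng K) Y Z)
  (F : @hom1 (Tng K) X Y) :
  is_strict G -> tot (la (G ∘ F)) = cl (lF G) (tot (la F)).
Proof. by move=> sG; rewrite la_compE (strict_la sG) cr_id2 cc1l //; cst. Qed.

Lemma la_comp_strict (K : TwoCat) (X Y Z : tangentad K) (G : @hom1 (Tng K) Y Z)
  (F : @hom1 (Tng K) X Y) :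
  is_strict F -> tot (la (G ∘ F)) = cr (tot (la G)) (lF F).
Proof.
move=> sF; rewrite la_compE (strict_la sF) cl_id2 cc1r //.
by rewrite csrc_cr csrc_tot -!comp1A (strict_T sF).
Qed.

Section VFBasics.
Variables (K : TwoCat) (C : forall X : tangentad K, vf_construction X).
Implicit Types (X Y A : tangentad K).
Notation U := (U C).
Notation eta := (eta C).

(* The same as f1 and f2 of VF_2functor C, with the objects written VF C X. *)
Definition VFh X Y (F : @hom1 (Tng K) X Y) : @hom1 (Tng K) (VF C X) (VF C Y) :=
  f1 (VF_2functor C) F.
Definition VF2 X Y (F G : @hom1 (Tng K) X Y) (a : F ⇒ G) : VFh F ⇒ VFh G :=
  f2 (VF_2functor C) a.

Definition vfc A X (F : @hom1 (Tng K) A X) (w : vector_field F) :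
  lF F ⇒ tT X ∘ lF F := t2 (vf w).

Definition vuniv X : lF (U X) ⇒ tT X ∘ lF (U X) := vfc (univ C X).

Lemma Gamma_v A X V (W : @hom1 (Tng K) V X) (w : vector_field W) (H : @hom1 (Tng K) A V) :
  tot (vfc (vfield (Gamma A w H))) = cr (tot (vfc w)) (lF H).
Proof.
have E : vf (vfield (Gamma A w H)) ≡ wr (vf w) H by exact: tot_cast.
exact: (t2_tot E).
Qed.

Lemma into_VF_eq A X (G G' : @hom1 (Tng K) A (VF C X)) :
  U X ∘ G = U X ∘ G' -> cr (tot (vuniv X)) (lF G) = cr (tot (vuniv X)) (lF G') -> G = G'.
Proof.
move=> eU ev; have [[cK _] _] := classifyK C A X.
suff E : Gamma A (univ C X) G = Gamma A (univ C X) G' by rewrite -(cK G) E cK.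
apply: vf_obj_eq; first exact: eU.
apply: t2_toteq; [exact: eU|exact: (congr1 (lax_comp (Tbar X)) eU)|].
by have := Gamma_v (univ C X) G; have := Gamma_v (univ C X) G'; rewrite /vfc => -> ->.
Qed.

Lemma into_VF_eq2 A X (G G' : @hom1 (Tng K) A (VF C X)) (a b : G ⇒ G') :
  cl (lF (U X)) (tot (t2 a)) = cl (lF (U X)) (tot (t2 b)) -> a = b.
Proof.
move=> e; have [[_ cK] _] := classifyK C A X.
have ea := cK _ _ a; have eb := cK _ _ b.
have E : fmap (Gamma A (univ C X)) a = fmap (Gamma A (univ C X)) b.
  by apply: vf_hom_eq; apply: t2_eq; apply: tot_inj; exact: e.
by apply: (@tot_inj (Tng K)); rewrite -[LHS]ea -[RHS]eb E.
Qed.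

Lemma U_classify A X (w : vf_obj A X) : U X ∘ classify C A X w = vob w.
Proof. by have [_ [cK _]] := classifyK C A X; rewrite -{2}(cK w). Qed.

Lemma v_classify A X (w : vf_obj A X) :
  cr (tot (vuniv X)) (lF (classify C A X w)) = tot (vfc (vfield w)).
Proof.
have [_ [cK _]] := classifyK C A X.
by rewrite -Gamma_v; exact: (congr1 (fun w => tot (vfc (vfield w))) (cK w)).
Qed.

Lemma U_classify2 A X (w w' : VF_category A X) (f : chom w w') :
  cl (U X) (tot (fmap (classify C A X) f)) = tot (vh f).
Proof.
have [_ [_ cK]] := classifyK C A X.
by have := congr1 (fun c : cell (@chom (VF_category A X)) => tot (vh (projT2 c))) (cK _ _ f).
Qed.

Lemma U_VF X Y (F : @hom1 (Tng K) X Y) : U Y ∘ VFh F = F ∘ U X.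
Proof. exact: U_classify. Qed.

Lemma v_VF X Y (F : @hom1 (Tng K) X Y) :
  cr (tot (vuniv Y)) (lF (VFh F)) =
  cc (cr (tot (la F)) (lF (U X))) (cl (lF F) (tot (vuniv X))).
Proof.
have E : vf (vfield (VF_mor_vf C F)) ≡
    wr (labar F) (U X) • wl F (vf (univ C X)) by exact: tot_cast.
by rewrite v_classify /vfc (t2_tot E) t2_vcomp.
Qed.

Lemma U_VF2 X Y (F G : @hom1 (Tng K) X Y) (a : F ⇒ G) :
  cl (U Y) (tot (VF2 a)) = cr (tot a) (U X).
Proof. exact: U_classify2. Qed.

Lemma U_eta X : U X ∘ eta X = @id1 (Tng K) X.
Proof. exact: U_classify. Qed.

Lemma v_eta X : cr (tot (vuniv X)) (lF (eta X)) = tot (tz X).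
Proof.
have E : vf (vfield (zero_vf X)) ≡ zbar X by exact: tot_cast.
by rewrite v_classify /vfc (t2_tot E).
Qed.

Lemma vfc_p A X (F : @hom1 (Tng K) A X) (w : vector_field F) :
  cc (cr (tot (tp X)) (lF F)) (tot (vfc w)) = tot (id2 (lF F)).
Proof. by have := vf_underP w; rewrite tot_vcomp. Qed.

Lemma vf_sum_vsum A X (F : @hom1 (Tng K) A X) (u w : vector_field F) :
  vsum (raw_of X) (id1 X) (lF F) (tot (vfc u)) (tot (vfc w)) (tot (vfc (vf_sum u w))).
Proof.
apply/vsum_id; exists (lF F), (vf_pair u w).
have [e0 e1] := vf_pairE u w.
split; rewrite /vfc /=; [by rewrite -e0 tot_vcomp|by rewrite -e1 tot_vcomp|].
exact: tot_vcomp.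
Qed.

Lemma U_strict X : is_strict (U X).
Proof. exact: VFU_strict. Qed.

Section Mu.
Variables (X : tangentad K) (W : vf_power C 2 X).

Let pair_pi k : VFpi W k ∘ mu_pair W = mu_legs C X k.
Proof.
exact: (proj2_sig (constructive_definite_description _
  (pb2_one (VFn_2pb_Tng W) (@mu_legsP K C X))) k).
Qed.

Lemma U_mu : U X ∘ mu_at W = U X ∘ U (VF C X).
Proof.
rewrite /mu_at comp1A U_classify -[RHS](congr1 (comp1 (U X)) (pair_pi ord0)).
by rewrite comp1A.
Qed.

(** The second summand arises as the vector field of [VF(U)]; since [U] is strict, [v_VF] reduces it
    to [U] applied to the universal vector field of [VF C X]. *)
Lemma v_mu : vsum (raw_of X) (id1 X) (lF (U X) ∘ lF (U (VF C X)))
  (cr (tot (vuniv X)) (lF (U (VF C X))))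
  (cl (lF (U X)) (tot (vuniv (VF C X))))
  (cr (tot (vuniv X)) (lF (mu_at W))).
Proof.
(* [univ2] was moved along the equality of the two composites with [U]; on untyped cells this
   transport disappears. *)
have vcast (F F' : @hom1 (Tng K) (VFn W) X) (e : F = F') (w : vector_field F) :
    tot (vfc (ecast F (vector_field F) e w)) = tot (vfc w) by case: F' / e.
have eL k : lF (VFpi W k) ∘ lF (mu_pair W) = lF (mu_legs C X k).
  by rewrite -pair_pi.
have := vsum_cr (lF (mu_pair W)) (vf_sum_vsum (univ1 W) (univ2 W)).
have sE : cr (tot (vuniv X)) (lF (plus W)) = tot (vfc (vf_sum (univ1 W) (univ2 W))).
  exact: (v_classify (VFObj (vf_sum (univ1 W) (univ2 W)))).
rewrite vcast !Gamma_v !cr_cr !eL -sE cr_cr v_VF (strict_la (U_strict X)) cr_id2 cc1l; last by cst.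
by rewrite -comp1A eL.
Qed.

End Mu.

End VFBasics.

(** * The 2-monad *)

Section Monad.
Variables (K : TwoCat) (C : forall X : tangentad K, vf_construction X).
Implicit Types (X Y Z A : tangentad K).
Notation U := (U C).
Notation VFh F := (VFh C F).
Notation VF2 a := (VF2 C a).
Notation eta := (eta C).
Notation v X := (vuniv C X).

Lemma into_VF_eqc A X (a b : cell (@hom2 (Tng K) A (VF C X))) :
  csrc a = csrc b -> ctgt a = ctgt b -> cl (U X) a = cl (U X) b -> a = b.
Proof.
elim/cellW: a => F G a; elim/cellW: b => F' G' b; rewrite /csrc /ctgt /= => eF eG.
case: F' / eF b => b; case: G' / eG b => b E; congr tot.
apply: into_VF_eq2; exact: (t2_tot (E : wl (U X) a ≡ wl (U X) b)).
Qed.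

Lemma lF_U_VF X Y (F : @hom1 (Tng K) X Y) : lF (U Y) ∘ lF (VFh F) = lF F ∘ lF (U X).
Proof. exact: (congr1 (@lF _ _ _) (U_VF C F)). Qed.

Lemma lF_U_eta X : lF (U X) ∘ lF (eta X) = id1 X.
Proof. exact: (congr1 (@lF _ _ _) (U_eta C X)). Qed.

Lemma VFh_id X : VFh (@id1 (Tng K) X) = @id1 (Tng K) (VF C X).
Proof.
apply: into_VF_eq; first by rewrite U_VF comp1r comp1l.
by rewrite v_VF; cnorm.
Qed.

Lemma VFh_comp X Y Z (G : @hom1 (Tng K) Y Z) (F : @hom1 (Tng K) X Y) :
  VFh (G ∘ F) = VFh G ∘ VFh F.
Proof.
apply: into_VF_eq.
  by rewrite U_VF comp1A U_VF -[RHS]comp1A U_VF comp1A.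
have E := congr1 (fun c => cr c (lF (VFh F))) (v_VF C G).
have E' := congr1 (cl (lF G)) (v_VF C F).
rewrite v_VF la_compE; cnorm_in E; cnorm_in E'; rewrite lF_U_VF in E.
by rewrite /= E E'; cnorm.
Qed.

Lemma VF2_id X Y (F : @hom1 (Tng K) X Y) : VF2 (id2 F) = id2 (VFh F).
Proof.
apply: (@tot_inj (Tng K)); apply: into_VF_eqc => //.
by rewrite U_VF2 cr_id2 cl_id2 U_VF.
Qed.

Lemma VF2_vc X Y (F G H : @hom1 (Tng K) X Y) (b : G ⇒ H) (a : F ⇒ G) :
  VF2 (vc b a) = vc (VF2 b) (VF2 a).
Proof.
apply: (@tot_inj (Tng K)); apply: into_VF_eqc => //.
by rewrite U_VF2 !tot_vc cl_cc // !U_VF2 cr_cc.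
Qed.

Lemma VF2_wl X Y Z (H : @hom1 (Tng K) Y Z) (F G : @hom1 (Tng K) X Y) (a : F ⇒ G) :
  VF2 (wl H a) ≡ wl (VFh H) (VF2 a).
Proof.
apply: into_VF_eqc; try exact: VFh_comp.
by rewrite U_VF2 !tot_wl cl_cl U_VF -cl_cl U_VF2 cr_cl.
Qed.

Lemma VF2_wr X Y Z (F G : @hom1 (Tng K) Y Z) (a : F ⇒ G) (E : @hom1 (Tng K) X Y) :
  VF2 (wr a E) ≡ wr (VF2 a) (VFh E).
Proof.
apply: into_VF_eqc; try exact: VFh_comp.
by rewrite U_VF2 !tot_wr -cr_cl U_VF2 !cr_cr U_VF.
Qed.

Lemma VF_is_2functor : is_2functor (VF_2functor C).
Proof.
split; [exact: VFh_id|exact: VFh_comp|exact: VF2_id|exact: VF2_vc|exact: VF2_wl|].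
exact: VF2_wr.
Qed.

Lemma eta_nat : is_2natural (id_2functor (Tng K)) (VF_2functor C) eta.
Proof.
(* On vector fields this square is the axiom [lax_z] of [F]. *)
have nat X Y (F : @hom1 (Tng K) X Y) : eta Y ∘ F = VFh F ∘ eta X.
  apply: into_VF_eq.
    by rewrite !comp1A U_VF U_eta comp1l -comp1A U_eta comp1r.
  have Ev := congr1 (fun c => cr c (lF F)) (v_eta C Y).
  have E := congr1 (fun c => cr c (lF (eta X))) (v_VF C F).
  have Ez := lax_z (laP F).
  cnorm_in Ev; cnorm_in E; cnorm_in Ez.
  by rewrite /= Ev E v_eta lF_U_eta cr_id1 Ez.
split=> // X Y F G a; apply: into_VF_eqc; try exact: nat.
rewrite !tot_wl tot_wr cl_cl -cr_cl U_VF2 cr_cr !U_eta /=.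
by rewrite cl_id1 cr_id1.
Qed.

(* By into_VF_eq these two properties determine mu. *)
Variable mu : forall X, @hom1 (Tng K) (VF C (VF C X)) (VF C X).
Hypothesis U_muE : forall X, U X ∘ mu X = U X ∘ U (VF C X).
Hypothesis v_muE : forall X,
  vsum (raw_of X) (id1 X) (lF (U X) ∘ lF (U (VF C X)))
    (cr (tot (v X)) (lF (U (VF C X))))
    (cl (lF (U X)) (tot (v (VF C X)))) (cr (tot (v X)) (lF (mu X))).

Lemma v_muP X A (G : @hom1 K A (VF C (VF C X))) :
  vsum (raw_of X) (id1 X) (lF (U X) ∘ lF (U (VF C X)) ∘ G)
    (cr (tot (v X)) (lF (U (VF C X)) ∘ G))
    (cl (lF (U X)) (cr (tot (v (VF C X))) G))
    (cr (tot (v X)) (lF (mu X) ∘ G)).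
Proof. by have := vsum_cr G (v_muE X); rewrite !cr_cr cr_cl. Qed.

Lemma lF_U_mu X : lF (U X) ∘ lF (mu X) = lF (U X) ∘ lF (U (VF C X)).
Proof. exact: (congr1 (@lF _ _ _) (U_muE X)). Qed.

Let pres X : preserves (raw_of X) 2 (id1 X).
Proof. exact: (tangent_pb X 0 (isT : 0 < 2)). Qed.

(** Compares the structural 2-morphisms of the two sides of [U_VF]: both copies of [U] are strict
    and contribute identities. *)
Lemma cl_U_la_VF X Y (F : @hom1 (Tng K) X Y) :
  cl (lF (U Y)) (tot (la (VFh F))) = cr (tot (la F)) (lF (U X)).
Proof. by rewrite -(la_strict_comp _ (U_strict C Y)) U_VF (la_comp_strict _ (U_strict C X)). Qed.

Lemma mu_nat :
  is_2natural (comp_2functor (VF_2functor C) (VF_2functor C)) (VF_2functor C) mu.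
Proof.
have nat X Y (F : @hom1 (Tng K) X Y) : mu Y ∘ VFh (VFh F) = VFh F ∘ mu X.
  have UE : U Y ∘ U (VF C Y) ∘ VFh (VFh F) = F ∘ U X ∘ U (VF C X).
    by rewrite -comp1A U_VF comp1A U_VF.
  apply: into_VF_eq.
    by rewrite !comp1A U_VF (U_muE Y) -[RHS]comp1A (U_muE X) comp1A.
  (* [S] computes the vector field of [mu Y ∘ VFh (VFh F)]; [S'] below is the sum defining [mu X],
     carried over by [F] and its structural 2-morphism. The rewriting shows that the summands
     agree. *)
  have S := v_muP (lF (VFh (VFh F))).
  have := vsum_cl (lF F) (v_muE X); rewrite comp1r => /lax_vsum S'.
  have UEl := congr1 (@lF _ _ _) UE; rewrite /= in UEl.
  have Ev := congr1 (fun c => cr c (lF (U (VF C X)))) (v_VF C F).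
  have Ev' := congr1 (cl (lF (U Y))) (v_VF C (VFh F)).
  have Em := congr1 (fun c => cr c (lF (mu X))) (v_VF C F).
  cnorm_in Ev; cnorm_in Ev'; cnorm_in Em.
  have Ela := congr1 (fun c => cr c (lF (U (VF C X)))) (cl_U_la_VF F).
  cnorm_in Ela; rewrite Ela lF_U_VF in Ev'.
  rewrite lF_U_mu in Em.
  rewrite UEl lF_U_VF Ev Ev' in S.
  rewrite /= Em; cnorm_in S'; apply: vsum_inj (@pres Y) S _.
  exact: S'.
split=> // X Y F G a; apply: into_VF_eqc; try exact: nat.
rewrite !tot_wl tot_wr cl_cl (U_muE Y) -cl_cl -cr_cl !U_VF2.
by rewrite cr_cr (U_muE X) -cr_cl U_VF2 cr_cr.
Qed.

Lemma cl_U_z X : cl (lF (U X)) (tot (tz (VF C X))) = cr (tot (tz X)) (lF (U X)).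
Proof.
have := lax_z (laP (U X)); rewrite tot_vcomp (strict_la (U_strict C X)) cc1l //.
Qed.

Lemma vsum_v0 X : vsum (raw_of X) (id1 X) (lF (U X)) (cr (tot (tz X)) (lF (U X)))
  (tot (v X)) (tot (v X)).
Proof.
have := tangent_0 (ends_tot (v X)); rewrite vfc_p cc1r //.
by rewrite csrc_cr csrc_tot comp1l.
Qed.

(** The sum is [v + z]: the universal vector field of [VF C X] becomes zero along [eta], and [U]
    preserves zero. *)
Lemma mu_eta_id X : mu X ∘ eta (VF C X) = @id1 (Tng K) (VF C X).
Proof.
apply: into_VF_eq.
  by rewrite comp1A (U_muE X) -comp1A U_eta.
have S := v_muP (lF (eta (VF C X))).
rewrite -comp1A lF_U_eta comp1r v_eta cr_id1 cl_U_z in S.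
rewrite cr_id1; apply: vsum_inj (@pres X) S _.
exact: tangent_C (vsum_v0 X).
Qed.

(** The sum is [z + v]: naturality of [U] makes the first summand zero along [eta], and the second
    reduces to [v] because [U ∘ eta] is the identity. *)
Lemma mu_VF_eta_id X : mu X ∘ VFh (eta X) = @id1 (Tng K) (VF C X).
Proof.
apply: into_VF_eq.
  by rewrite comp1A (U_muE X) -comp1A U_VF comp1A U_eta comp1l comp1r.
have S := v_muP (lF (VFh (eta X))).
have E := congr1 (fun c => cr c (lF (U X))) (v_eta C X).
have E' := congr1 (cl (lF (U X))) (v_VF C (eta X)).
have la1 : cl (lF (U X)) (tot (la (eta X))) = tot (id2 (tT X)).
  by rewrite -(la_strict_comp _ (U_strict C X)) U_eta /= /la_id tot_cast.
have Ela := congr1 (fun c => cr c (lF (U X))) la1.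
cnorm_in E; cnorm_in E'; cnorm_in Ela; rewrite Ela lF_U_eta cl_id1 in E'.
rewrite cc1l // in E'.
rewrite -comp1A lF_U_VF comp1A lF_U_eta comp1l E E' in S.
by rewrite cr_id1; apply: vsum_inj (@pres X) S (vsum_v0 X).
Qed.

(** Write [V = VF X] and [V' = VF V], with universal vector fields [w] and [w']. Both sides add the
    same three elements: [a], which is [v] at [U_V U_V']; [b], which is [U] of [w] at [U_V']; and
    [d], which is [U U_V] of [w']. The left side is [a + (b + d)], by [S1] and [S2]; the right side
    is [(a + b) + d], by [S4] and [S3]. *)
Lemma mu_assoc X : mu X ∘ mu (VF C X) = mu X ∘ VFh (mu X).
Proof.
apply: into_VF_eq.
  rewrite !comp1A (U_muE X) -comp1A (U_muE (VF C X)).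
  by rewrite -[RHS]comp1A U_VF [RHS]comp1A (U_muE X) -comp1A.
have S1 := v_muP (lF (mu (VF C X))).
have S2 := strict_vsum (U_strict C X) (v_muE (VF C X)).
have S3 := v_muP (lF (VFh (mu X))).
have S4 := v_muP (lF (U (VF C (VF C X)))).
(* [mu X] need not be strict, but [U X ∘ mu X] is a composite of strict morphisms, so the structural
   2-morphism of [mu X] becomes an identity under [U X]. *)
have la1 : cl (lF (U X)) (tot (la (mu X))) =
    tot (id2 (lF (U X) ∘ lF (U (VF C X)) ∘ tT (VF C (VF C X)))).
  rewrite -(la_strict_comp _ (U_strict C X)) (U_muE X).
  rewrite (la_strict_comp _ (U_strict C X)) (strict_la (U_strict C _)) cl_id2.
  by rewrite comp1A.
have E := congr1 (cl (lF (U X))) (v_VF C (mu X)).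
have Ela := congr1 (fun c => cr c (lF (U (VF C (VF C X))))) la1.
cnorm_in E; cnorm_in Ela; rewrite Ela lF_U_mu cc1l in E; last by cst.
rewrite lF_U_VF E -comp1A lF_U_VF comp1A lF_U_mu in S3.
rewrite -comp1A lF_U_mu comp1A in S1.
rewrite cl_cl comp1A in S2.
exact: vsum_inj (@pres X) S1 (tangent_A S4 S3 S2).
Qed.

Lemma VF_is_2monad : is_2monad (VF_2functor C) eta mu.
Proof.
split; [exact: VF_is_2functor|exact: eta_nat|exact: mu_nat|exact: mu_eta_id| |].
  exact: mu_VF_eta_id.
exact: mu_assoc.
Qed.

End Monad.

(** * The lax tangent morphisms T_n *)

Lemma lax_s_of_vsum (K : TwoCat) (X Y : tangentad K) (F : hom1 X Y)
  (al : F ∘ tT X ⇒ tT Y ∘ F) :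
  vsum (raw_of Y) (id1 Y) F (cc (tot al) (cl F (tot (tpr X 2 ord0))))
    (cc (tot al) (cl F (tot (tpr X 2 ord_max)))) (cc (tot al) (cl F (tot (ts X)))) ->
  exists u : F ∘ tn X 2 ⇒ tn Y 2 ∘ F,
    is_pair (fun k => wr (tpr Y 2 k) F) u
      (al • wl F (tpr X 2 ord0)) (al • wl F (tpr X 2 ord_max)) /\
    al • wl F (ts X) = wr (ts Y) F • u.
Proof.
move=> /vsum_id[Q [t [e0 e1 es]]].
have eQ : Q = F ∘ tn X 2 by have := congr1 (@csrc _ _ _) e0; rewrite !csrc_cc.
case: _ / (esym eQ) t e0 e1 es => t e0 e1 es.
by exists t; split; [split|]; apply: tot_inj; rewrite !tot_vcomp.
Qed.

(* A 2-morphism f : F => G into a lax tangent morphism that is a pullback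
   projection reflects the axioms. *)
Lemma lax_reflect (K : TwoCat) (X Y : tangentad K) (F : hom1 X Y)
  (al : F ∘ tT X ⇒ tT Y ∘ F) (I : Type) (G : I -> lax_tangent_morphism X Y)
  (f : forall k, F ⇒ lF (G k)) :
  (forall k, cc (cl (tT Y) (tot (f k))) (tot al) =
             cc (tot (la (G k))) (cr (tot (f k)) (tT X))) ->
  (forall m A (E : hom1 A X) Q a b, ends a Q (tpow (tT Y) m ∘ F ∘ E) ->
     ends b Q (tpow (tT Y) m ∘ F ∘ E) ->
     (forall k, cc (cl (tpow (tT Y) m) (cr (tot (f k)) E)) a =
                cc (cl (tpow (tT Y) m) (cr (tot (f k)) E)) b) -> a = b) ->
  is_lax al.
Proof.
move=> sq mono.
(* Proved first because additivity uses it: the two summands must lie over the same base. *)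
have alp : wr (tp Y) F • al ≡ wl F (tp X).
  apply: (mono 0 _ (id1 X) (F ∘ tT X)) => [||k] /=; rewrite ?totE; try est.
  have E1 := congr1 (fun c => cc c (tot al)) (ccX (tot (tp Y)) (tot (f k))).
  have E2 := congr1 (cc (cr (tot (tp Y)) (G k))) (sq k).
  have E3 := congr1 (fun c => cc c (cr (tot (f k)) (tT X))) (lax_p (laP (G k))).
  have E4 := ccX (tot (f k)) (tot (tp X)).
  rewrite /csrc /ctgt /= in E1 E4.
  by cnorm_in E1; cnorm_in E2; cnorm_in E3; cnorm_in E4; cnorm; rewrite -E1 E2 E3 E4.
split=> //.
- apply: (mono 1 _ (id1 X) F) => [||k] /=; rewrite ?totE; try est.
  have E1 := congr1 (fun c => cc c (cl F (tot (tz X)))) (sq k).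
  have E2 := congr1 (cc (tot (la (G k)))) (ccX (tot (f k)) (tot (tz X))).
  have E3 := congr1 (fun c => cc c (tot (f k))) (lax_z (laP (G k))).
  have E4 := ccX (tot (tz Y)) (tot (f k)).
  rewrite /csrc /ctgt /= in E2 E4.
  cnorm_in E1; cnorm_in E2; cnorm_in E3; cnorm_in E4; cnorm.
  by rewrite E1 E2 E3 E4.
- apply: lax_s_of_vsum.
  have alp' := alp; rewrite !totE in alp'.
  have pY := tangent_pb Y 0 (isT : 0 < 2).
  have pc := preserves_1 (tangent_pb X 0 (isT : 0 < 2)).
  (* Let [e] be the sum of the two images. After each [f k], both [e] and the image of [s] become
     the same sum, by additivity of [G k]; joint monicity then identifies them. *)
  have [|||e ee eE] := @vsum_ex _ _ _ Y (id1 Y) _ F (F ∘ tn X 2)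
    (cc (tot al) (cl F (tot (tpr X 2 ord0))))
    (cc (tot al) (cl F (tot (tpr X 2 ord_max)))) pY.
  + by est.
  + by est.
  + have key k := congr1 (fun c => cc c (cl F (tot (tpr X 2 k)))) alp'.
    have E0 := key ord0; have E1 := key ord_max.
    have [_ /(_ ord0 ord_max) E _ _] := pc.
    have {}E := congr1 (cl F) E.
    by cnorm_in E0; cnorm_in E1; cnorm_in E; cnorm; rewrite E0 E1 E.
  suff <- : e = cc (tot al) (cl F (tot (ts X))) by [].
  apply: (mono 1 _ (id1 X) (F ∘ tn X 2)) => [||k] /=; try est.
    by move: ee; rewrite /= comp1l !comp1r.
  rewrite comp1r cr_id1.
  have H := vsum_nat (f k) eE; rewrite comp1l in H.
  have key (x : tn X 2 ⇒ tT X) :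
      cc (cl (tT Y) (tot (f k))) (cc (tot al) (cl F (tot x))) =
      cc (cr (tot (la (G k))) (id1 X)) (cc (cl (G k) (tot x)) (cr (tot (f k)) (tn X 2))).
    have E1 := congr1 (fun c => cc c (cl F (tot x))) (sq k).
    have E2 := congr1 (cc (tot (la (G k)))) (ccX (tot (f k)) (tot x)).
    rewrite /csrc /ctgt /= in E2.
    by cnorm_in E1; cnorm_in E2; cnorm; rewrite E1 E2.
  rewrite !key in H *.
  apply: (vsum_inj pY H).
  have := @lax_vsum _ _ _ (G k) _ (id1 X); rewrite comp1r; apply.
  apply/vsum_1; exists (F ∘ tn X 2).
  have [t tE] : exists t : F ∘ tn X 2 ⇒ G k ∘ tn X 2,
    cr (tot (f k)) (tn X 2) = tot t by apply: endsP; est.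
  by exists t; rewrite -tE.
- apply: (mono 2 _ (id1 X) (F ∘ tT X)) => [||k] /=; rewrite ?totE; try est.
  have E1 := congr1 (fun c => cc c (tot al)) (ccX (tot (tl Y)) (tot (f k))).
  have E2 := congr1 (cc (cr (tot (tl Y)) (G k))) (sq k).
  have E3 := congr1 (fun c => cc c (cr (tot (f k)) (tT X))) (lax_l (laP (G k))).
  have E4 := congr1 (fun c => cc (cl (tT Y) (tot (la (G k))))
    (cc (cr (tot (la (G k))) (tT X)) c)) (ccX (tot (f k)) (tot (tl X))).
  have E5 := congr1 (fun c => cc (cl (tT Y) (tot (la (G k))))
    (cc (cr c (tT X)) (cl F (tot (tl X))))) (sq k).
  have E6 := congr1 (fun c => cc (cl (tT Y) c) (cc (cr (tot al) (tT X)) (cl F (tot (tl X)))))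
    (sq k).
  rewrite /csrc /ctgt /= in E1 E4.
  cnorm_in E1; cnorm_in E2; cnorm_in E3; cnorm_in E4; cnorm_in E5; cnorm_in E6; cnorm.
  by rewrite -E1 E2 E3 -E4 -E5 -E6.
apply: (mono 2 _ (id1 X) (F ∘ tT X ∘ tT X)) => [||k] /=; rewrite ?totE; try est.
have E1 := congr1 (fun c => cc c (cc (cl (tT Y) (tot al)) (cr (tot al) (tT X))))
  (ccX (tot (tc Y)) (tot (f k))).
have E5 := congr1 (fun c => cc (cr (tot (tc Y)) (G k))
  (cc (cl (tT Y) c) (cr (tot al) (tT X)))) (sq k).
have E6 := congr1 (fun c => cc (cr (tot (tc Y)) (G k))
  (cc (cl (tT Y) (tot (la (G k)))) (cr c (tT X)))) (sq k).
have E3 := congr1 (fun c => cc c (cr (tot (f k)) (tT X ∘ tT X))) (lax_c (laP (G k))).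
have E4 := congr1 (fun c => cc (cl (tT Y) (tot (la (G k)))) (cc (cr (tot (la (G k))) (tT X)) c))
    (ccX (tot (f k)) (tot (tc X))).
have E7 := congr1 (fun c => cc (cl (tT Y) (tot (la (G k)))) (cc (cr c (tT X)) (cl F (tot (tc X)))))
    (sq k).
have E8 := congr1 (fun c => cc (cl (tT Y) c) (cc (cr (tot al) (tT X)) (cl F (tot (tc X)))))
    (sq k).
rewrite /csrc /ctgt /= in E1 E4.
cnorm_in E1; cnorm_in E3; cnorm_in E4; cnorm_in E5; cnorm_in E6; cnorm_in E7.
cnorm_in E8; cnorm.
by rewrite -E1 E5 E6 E3 -E4 -E7 -E8.
Qed.

Section TangentCell.
Variables (K : TwoCat).
Implicit Types X Y Z : tangentad K.

(** Tangent 2-morphisms as untyped cells, so that they compose by [cc] even when the end points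
    agree only propositionally. *)
Definition tng X Y (G G' : lax_tangent_morphism X Y) (a : cell (@hom2 K X Y)) : Prop :=
  ends a (lF G) (lF G') /\
  cc (cl (tT Y) a) (tot (la G)) = cc (tot (la G')) (cr a (tT X)).

Lemma tngP X Y (G G' : lax_tangent_morphism X Y) a :
  tng G G' a -> exists a' : tangent_2morphism G G', a = tot (t2 a').
Proof.
move=> [/endsP[{}a ->] e].
have aP : wl (tT Y) a • la G = la G' • wr a (tT X).
  by apply: tot_inj; rewrite !totE.
by exists (Tangent2Morphism aP).
Qed.

Lemma t2_tng X Y (G G' : lax_tangent_morphism X Y) (a : tangent_2morphism G G') :
  tng G G' (tot (t2 a)).
Proof. by split=> //; have := congr1 (@tot _ _ _ _) (t2P a); rewrite !totE. Qed.

Lemma tng_cc X Y (G G' G'' : lax_tangent_morphism X Y) b a :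
  tng G' G'' b -> tng G G' a -> tng G G'' (cc b a).
Proof.
move=> [/endsP[{}b ->] eb] [/endsP[{}a ->] ea]; split; first exact: ends_cc.
have E := congr1 (cc (cl (tT Y) (tot b))) ea.
have E' := congr1 (fun c => cc c (cr (tot a) (tT X))) eb.
by cnorm_in E; cnorm_in E'; cnorm; rewrite E E'.
Qed.

Lemma tng_id X Y (G : lax_tangent_morphism X Y) : tng G G (tot (id2 (lF G))).
Proof. exact: (t2_tng (t2_id G)). Qed.

Lemma tng_p X : tng (Tbar X) (lax_id X) (tot (tp X)).
Proof. exact: (t2_tng (pbar X)). Qed.

End TangentCell.

Lemma cpb_iso (K : TwoCat) (X Y : K) n p (pi pi' : 'I_n -> cell (@hom2 K X Y)) P T P'
  (th ze : cell (@hom2 K X Y)) :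
  cpb p pi P T -> csrc p = T -> ends th P' P -> ends ze P P' ->
  cc th ze = tot (id2 P) -> cc ze th = tot (id2 P') ->
  (forall k, pi' k = cc (pi k) th) -> cpb p pi' P' T.
Proof.
move=> [pE pc pe pu] sp /endsP[{}th ->] /endsP[{}ze ->] tz zt e.
have es k : csrc (pi k) = P := (pE k).1.
have et k : ctgt (pi k) = csrc p by rewrite sp (pE k).2.
split.
- by move=> k; rewrite e; exact: ends_cc (pE k) (ends_tot th).
- by move=> i j; rewrite !e ccA ?es ?et // (pc i j) -ccA ?es ?et.
- move=> Q q eq cq; have [u uE] := pe Q q eq cq.
  have [u' u'E] := endsP (ends_cc (ends_tot ze) (ends_tot u)).
  exists u' => k; rewrite e -u'E -ccA ?es //; last by rewrite ctgt_cc.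
  by rewrite (@ccA _ _ _ (tot th)) // tz cc1l.
move=> Q u u' uE.
have [w wE] := endsP (ends_cc (ends_tot th) (ends_tot u)).
have [w' w'E] := endsP (ends_cc (ends_tot th) (ends_tot u')).
have ww : w = w'.
  by apply: pu => k; rewrite -wE -w'E; have := uE k; rewrite !e -!ccA ?es.
apply: tot_inj; have := congr1 (cc (tot ze)) (congr1 (@tot _ _ _ _) ww).
by rewrite -wE -w'E !ccA // zt !cc1l.
Qed.

Section Power.
Variables (K : TwoCat) (X : tangentad K) (n : nat).
Hypothesis n0 : 0 < n.

(** The 2-morphism is induced by [c] after each projection; these components share a base because
    [Tp ∘ c = p_T], by the axiom on [p_T ∘ c] and [c ∘ c = id]. Its axioms are reflected from
    [Tbar X] along the projections, which are jointly monic after every iterate of [T]. *)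
Lemma tn_lax_ex : exists al : tn X n ∘ tT X ⇒ tT X ∘ tn X n, is_lax al /\
  forall k, cc (cl (tT X) (tot (tpr X n k))) (tot al) =
            cc (tot (tc X)) (cr (tot (tpr X n k)) (tT X)).
Proof.
have pT := tangent_pb X 1 n0; have p1 := tangent_pb X 0 n0.
have pcp : cc (cl (tT X) (tot (tp X))) (tot (tc X)) = cr (tot (tp X)) (tT X).
  have := congr1 (fun c => cc c (tot (tc X))) (tg_cp (tangentP X)).
  by rewrite -ccA // ?(tg_cc (tangentP X)) //= cc1r //=.
have [_ pc _ _] := preserves_id p1 (tT X).
have [_ _ pe _] := preserves_1 pT; rewrite /= comp1r in pe.
have [k|i j|al alE] := pe (tn X n ∘ tT X)
  (fun k => cc (tot (tc X)) (cr (tot (tpr X n k)) (tT X))).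
- by est.
- rewrite !ccA ?pcp //; exact: pc.
exists al; split=> //.
apply: (@lax_reflect _ _ _ _ _ _ (fun k : 'I_n => Tbar X) (fun k => tpr X n k)) => [k|].
  exact: alE.
move=> m A E Q a b /endsP[{}a ->] /endsP[{}b ->] ab.
have [_ _ _ pu] := tangent_pb X m n0 E.
by congr tot; apply: pu.
Qed.

Definition lax_tn : lax_tangent_morphism X X :=
  LaxTangentMorphism (proj1 (proj2_sig
    (constructive_indefinite_description _ tn_lax_ex))).

Lemma lax_tn_la k : cc (cl (tT X) (tot (tpr X n k))) (tot (la lax_tn)) =
  cc (tot (tc X)) (cr (tot (tpr X n k)) (tT X)).
Proof.
exact: (proj2 (proj2_sig (constructive_indefinite_description _ tn_lax_ex))).
Qed.

Lemma tng_pr k : tng lax_tn (Tbar X) (tot (tpr X n k)).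
Proof. by split=> //; exact: lax_tn_la. Qed.

End Power.

(** * Comparison of T_n with VF(T_n) *)

Section IntoVF.
Variables (K : TwoCat) (C : forall X : tangentad K, vf_construction X).
Implicit Types (X Y Z A : tangentad K).
Notation U := (U C).
Notation VFh F := (VFh C F).
Notation VF2 a := (VF2 C a).
Notation v X := (vuniv C X).

Lemma tng_into_VF_inj A X (G G' : @hom1 (Tng K) A (VF C X)) a b :
  tng G G' a -> tng G G' b -> cl (lF (U X)) a = cl (lF (U X)) b -> a = b.
Proof.
by move=> /tngP[{}a ->] /tngP[{}b ->] /into_VF_eq2 ->.
Qed.

(** Fullness of [Gamma]: a morphism of vector fields is the image of a 2-morphism into [VF C X]. The
    inverse functor returns [G] and [G'] only up to equality, hence the cast in the proof. *)
Lemma tng_into_VF A X (G G' : @hom1 (Tng K) A (VF C X)) a :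
  tng (U X ∘ G) (U X ∘ G') a ->
  cc (cl (tT X) a) (cr (tot (v X)) (lF G)) = cc (cr (tot (v X)) (lF G')) a ->
  exists2 b, tng G G' b & cl (lF (U X)) b = a.
Proof.
move=> /tngP[{}a ->] va.
have hP : wl (Tbar X) (a : @hom2 (Tng K) _ _ _ _) • vfield (Gamma A (univ C X) G) =
    vfield (Gamma A (univ C X) G') • (a : @hom2 (Tng K) _ _ _ _).
  apply: t2_eq; apply: tot_inj; rewrite !t2_vcomp.
  have := Gamma_v (univ C X) G; have := Gamma_v (univ C X) G'.
  by rewrite /vfc => -> ->.
have [[cK _] _] := classifyK C A X.
pose f : chom (Gamma A (univ C X) G) (Gamma A (univ C X) G') :=
  @VFHom K A X (Gamma A (univ C X) G) (Gamma A (univ C X) G') a hP.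
pose b := cast (fmap (classify C A X) f) (cK G) (cK G').
exists (tot (t2 b)); first exact: t2_tng.
have E := congr1 (@t2_cell _ _ _) (U_classify2 C f).
rewrite /b t2_cast; exact: E.
Qed.

End IntoVF.

(** Variant of [cst] for end points that agree only after using a commutation [e], such as that of
    [U] with [T]. *)
Ltac cst_by e :=
  rewrite ?(csrc_cl, ctgt_cl, csrc_cr, ctgt_cr, csrc_tot, ctgt_tot, csrc_cc) /=;
  repeat (rewrite ctgt_cc; [|cst_by e]);
  rewrite ?(csrc_cl, ctgt_cl, csrc_cr, ctgt_cr, csrc_tot, ctgt_tot, csrc_cc) /=;
  rewrite ?comp1A ?e -?comp1A ?e ?comp1A; reflexivity.

Section VFPower.
Variables (K : TwoCat) (C : forall X : tangentad K, vf_construction X).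
Variables (X : tangentad K) (n : nat).
Hypothesis n0 : 0 < n.
Notation U := (Defs.U C X).
Notation V := (VF C X).
Notation v := (vuniv C X).
Notation sU := (U_strict C X).
Notation Tn := (lax_tn X n0).
Notation TnV := (lax_tn V n0).
Notation H := (VFh C Tn).

(** The universal vector field is itself a tangent 2-morphism; with [U] strict, its compatibility
    square is this equation up to [c], which is an involution. *)
Lemma v_Tbar : cc (cr (tot (tc X)) (lF U)) (cl (tT X) (tot v)) = cr (tot v) (tT V).
Proof.
have := (t2_tng (vf (univ C X))).2.
rewrite la_compE (strict_la sU) cl_id2 cc1r; last first.
  by rewrite csrc_cl csrc_tot (strict_T sU).
rewrite cc1r; last by rewrite csrc_cr csrc_tot /= (strict_T sU) comp1A.
move=> /(congr1 (cc (cr (tot (tc X)) (lF U)))).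
by rewrite (@tcKl _ X _ (lF U)) // ctgt_cr ctgt_tot /= -comp1A (strict_T sU) comp1A.
Qed.

Lemma U_Tbar : U ∘ Tbar V = Tbar X ∘ U.
Proof.
apply: lax_eq; first exact: (strict_T sU).
by rewrite (la_strict_comp _ sU) (la_comp_strict _ sU) (strict_c sU).
Qed.

Lemma tng_cr A Y Z (G G' : @hom1 (Tng K) Y Z) (E : @hom1 (Tng K) A Y) a :
  tng G G' a -> tng (G ∘ E) (G' ∘ E) (cr a (lF E)).
Proof. by move=> /tngP[{}a ->]; exact: (t2_tng (t2_wr a E)). Qed.

(* The components of VF(pr_k). *)
Lemma VF_pr_ex k : exists2 h, tng H (Tbar V) h & cl (lF U) h = cr (tot (tpr X n k)) (lF U).
Proof.
apply: tng_into_VF.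
  by rewrite U_VF U_Tbar; apply: tng_cr; exact: tng_pr.
rewrite v_VF -v_Tbar.
have E1 := congr1 (fun c => cc (cr c (lF U)) (cl (tn X n) (tot v))) (lax_tn_la X n0 k).
have E2 := congr1 (cc (cr (tot (tc X)) (lF U))) (ccX (tot (tpr X n k)) (tot v)).
rewrite /csrc /ctgt /= in E2.
by cnorm_in E1; cnorm_in E2; cnorm; rewrite E1 E2.
Qed.

Variable h : 'I_n -> cell (@hom2 K V V).
Hypothesis tng_h : forall k, tng H (Tbar V) (h k).
Hypothesis U_h : forall k, cl (lF U) (h k) = cr (tot (tpr X n k)) (lF U).

Let pV := preserves_id (tangent_pb V 0 n0).
Let pX := preserves_id (tangent_pb X 0 n0).
Let pTV : cpb (cl (tT V) (tot (tp V))) (fun k => cl (tT V) (tot (tpr V n k)))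
  (tT V ∘ tn V n) (tT V ∘ tT V).
Proof. by have := preserves_1 (tangent_pb V 1 n0); rewrite /= comp1r. Qed.
Let pTX : cpb (cl (tT X) (cr (tot (tp X)) (lF U)))
  (fun k => cl (tT X) (cr (tot (tpr X n k)) (lF U)))
  (tT X ∘ tn X n ∘ lF U) (tT X ∘ tT X ∘ lF U).
Proof. by have := tangent_pb X 1 n0 (lF U); rewrite /= comp1r. Qed.

Lemma VF_pr_to_tn : exists2 th, tng H TnV th & forall k, cc (tot (tpr V n k)) th = h k.
Proof.
have [_ _ pe _] := cpb_ext (cr_id1 _) (fun k => cr_id1 _) (comp1r _) (comp1r _) (pV (id1 V)).
have [k|i j|th thE] := pe (lF H) h.
- by have [] := tng_h k.
(* Tangent 2-morphisms into [VF] are determined by their images under [U], and there the base points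
   agree by the pullback in [X]. *)
- have tp_h k := tng_cc (tng_p V) (tng_h k).
  apply: (tng_into_VF_inj (tp_h i) (tp_h j)).
  rewrite !cl_cc ?(tng_h _).1.2 // !U_h (strict_p sU) -!cr_cc //.
  by have [_ pc _ _] := preserves_1 (tangent_pb X 0 n0); move: (pc i j); rewrite /= !cl_id1 => ->.
exists (tot th) => //; split; first exact: ends_tot.
have [l lE] : exists l : lF H ∘ tT V ⇒ tT V ∘ tn V n,
   cc (cl (tT V) (tot th)) (tot (la H)) = tot l by apply: endsP; est.
have [r rE] : exists r : lF H ∘ tT V ⇒ tT V ∘ tn V n,
   cc (tot (la TnV)) (cr (tot th) (tT V)) = tot r by apply: endsP; est.
rewrite lE rE; congr tot; have [_ _ _ pu] := pTV; apply: pu => k.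
rewrite -lE -rE.
have E1 := congr1 (fun c => cc (cl (tT V) c) (tot (la H))) (thE k).
have E2 := (tng_h k).2.
have E3 := congr1 (fun c => cc c (cr (tot th) (tT V))) (lax_tn_la V n0 k).
have E4 := congr1 (fun c => cc (tot (tc V)) (cr c (tT V))) (thE k).
cnorm_in E1; cnorm_in E3; cnorm_in E4; cnorm.
by rewrite E1 E2 E3 E4.
Qed.

Lemma tn_to_VF_pr : exists2 ze, tng TnV H ze & forall k, cc (h k) ze = tot (tpr V n k).
Proof.
have [_ _ pe _] := pX (lF U).
(* [z] is the comparison from [U T_n] to [T_n U], induced by the images of the projections. *)
have [k|i j|z zE] := pe (lF U ∘ tn V n) (fun k => cl (lF U) (tot (tpr V n k))).
- by split; rewrite ?csrc_cl ?ctgt_cl // ctgt_tot /= (strict_T sU).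
- rewrite -(strict_p sU) -!cl_cc //.
  have [_ pc _ _] := preserves_1 (tangent_pb V 0 n0).
  by move: (pc i j); rewrite /= !cl_id1 => ->.
have [||ze tze zeE] := @tng_into_VF _ C _ _ TnV H (tot z).
(* The comparison is a tangent 2-morphism, as can be tested on the projections of [T T_n U]. *)
- rewrite U_VF; split; first exact: ends_tot.
  rewrite (la_strict_comp _ sU) (la_comp_strict _ sU) /=.
  have [l lE] : exists l : lF U ∘ tn V n ∘ tT V ⇒ tT X ∘ tn X n ∘ lF U,
     cc (cl (tT X) (tot z)) (cl (lF U) (tot (la TnV))) = tot l.
    by apply: endsP; split;
      rewrite ?ctgt_cc ?csrc_cc ?ctgt_cl ?csrc_cl ?ctgt_tot ?csrc_tot /= !comp1A // (strict_T sU).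
  have [r rE] : exists r : lF U ∘ tn V n ∘ tT V ⇒ tT X ∘ tn X n ∘ lF U,
     cc (cr (tot (la Tn)) (lF U)) (cr (tot z) (tT V)) = tot r.
    by apply: endsP; split;
      rewrite ?ctgt_cc ?csrc_cc ?ctgt_cr ?csrc_cr ?ctgt_tot ?csrc_tot /= ?comp1A //
        -!comp1A (strict_T sU).
  rewrite lE rE; congr tot; have [_ _ _ pu] := pTX; apply: pu => k.
  rewrite -lE -rE.
  have E1 := congr1 (fun c => cc (cl (tT X) c) (cl (lF U) (tot (la TnV)))) (zE k).
  have E2 := congr1 (cl (lF U)) (lax_tn_la V n0 k).
  have E3 := congr1 (fun c => cc (cr c (lF U)) (cr (tot z) (tT V))) (lax_tn_la X n0 k).
  have E4 := congr1 (fun c => cc (cr (tot (tc X)) (lF U)) (cr c (tT V))) (zE k).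
  have sT := strict_T sU.
  cnorm_in E1; cnorm_in E2; cnorm_in E3; cnorm_in E4; cnorm.
  rewrite -ccA in E1; [|cst_by sT|cst_by sT].
  rewrite -!ccA in E3; [|cst_by sT|cst_by sT|cst_by sT|cst_by sT].
  by rewrite E1 E3 -sT E2 E4 (strict_c sU).
(* The comparison respects the vector fields, by the same test and [v_Tbar]. *)
- rewrite v_VF.
  have [l lE] : exists l : lF U ∘ tn V n ⇒ tT X ∘ tn X n ∘ lF U,
     cc (cl (tT X) (tot z)) (cr (tot v) (tn V n)) = tot l by apply: endsP; est.
  have [r rE] : exists r : lF U ∘ tn V n ⇒ tT X ∘ tn X n ∘ lF U,
     cc (cc (cr (tot (la Tn)) (lF U)) (cl (tn X n) (tot v))) (tot z) = tot r.
    by apply: endsP; est.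
  rewrite lE /= rE; congr tot; have [_ _ _ pu] := pTX; apply: pu => k.
  rewrite -lE -rE.
  have E1 := congr1 (fun c => cc (cl (tT X) c) (cr (tot v) (tn V n))) (zE k).
  have E2 := ccX (tot v) (tot (tpr V n k)).
  have E3 := congr1 (fun c => cc (cr c (lF U)) (cc (cl (tn X n) (tot v)) (tot z)))
    (lax_tn_la X n0 k).
  have E4 := congr1 (fun c => cc (cr (tot (tc X)) (lF U)) (cc c (tot z)))
    (ccX (tot (tpr X n k)) (tot v)).
  have E5 := congr1 (cc (cr (tot (tc X)) (lF U))) (congr1 (cc (cl (tT X) (tot v))) (zE k)).
  have E6 := congr1 (fun c => cc c (cl (lF U) (tot (tpr V n k)))) v_Tbar.
  rewrite /csrc /ctgt /= in E2 E4.
  cnorm_in E1; cnorm_in E2; cnorm_in E3; cnorm_in E4; cnorm_in E5; cnorm_in E6; cnorm.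
  rewrite -ccA in E6; [|cst_by (strict_T sU)|cst_by (strict_T sU)].
  by rewrite E1 -E2 E3 E4 E5 E6.
exists ze => // k.
apply: (tng_into_VF_inj (tng_cc (tng_h k) tze) (tng_pr V n0 k)).
by rewrite cl_cc ?tze.1.2 ?(tng_h k).1.1 // zeE U_h zE.
Qed.

End VFPower.

(* The endomorphism Hn = VF(T_n) of VF X is isomorphic to T_n, and unlike T_n
   it commutes strictly with U. *)
Lemma VF_tn_iso (K : TwoCat) (C : forall X : tangentad K, vf_construction X)
    (X : tangentad K) n : 0 < n ->
  exists (Hn : hom1 (VF C X) (VF C X)) (h : 'I_n -> Hn ⇒ tT (VF C X))
      (th : Hn ⇒ tn (VF C X) n) (ze : tn (VF C X) n ⇒ Hn),
  [/\ lF (U C X) ∘ Hn = tn X n ∘ lF (U C X),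
      forall k, cl (lF (U C X)) (tot (h k)) = cr (tot (tpr X n k)) (lF (U C X)),
      cc (tot th) (tot ze) = tot (id2 (tn (VF C X) n)),
      cc (tot ze) (tot th) = tot (id2 Hn) &
      forall k, cc (tot (tpr (VF C X) n k)) (tot th) = tot (h k)].
Proof.
move=> n0; pose H := VFh C (lax_tn X n0); exists (lF H).
have ex k : exists h, tng H (Tbar (VF C X)) h /\
    cl (lF (U C X)) h = cr (tot (tpr X n k)) (lF (U C X)).
  by have [h th Uh] := VF_pr_ex C X n0 k; exists h.
have [h hP] := fin_all_exists ex.
have th k := (hP k).1; have Uh k := (hP k).2.
exists (fun k => typed (th k).1).
have [t tt tE] := VF_pr_to_tn th Uh; have [z tz zE] := tn_to_VF_pr th Uh.
have tz_ends := tng_cc tt tz; have zt_ends := tng_cc tz tt.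
exists (typed tt.1), (typed tz.1); rewrite !tot_typed; split.
- exact: lF_U_VF.
- by move=> k; rewrite tot_typed.
- have [tz' tz'E] := endsP tz_ends.1; rewrite tz'E; congr tot.
  have [_ _ _ pu] := preserves_1 (tangent_pb (VF C X) 0 n0).
  rewrite /= comp1l in pu; apply: pu => k; rewrite cl_id1 -tz'E cc1r //.
  by rewrite ccA ?tE ?zE // ?tt.1.1 ?tt.1.2 ?tz.1.2.
(* No universal property of [Hn] is available here, so this composite is compared with the identity
   under [U], on the projections of [X]. *)
- apply: (tng_into_VF_inj zt_ends (tng_id H)).
  have UH : lF (U C X) ∘ lF H = tn X n ∘ lF (U C X) := lF_U_VF C (lax_tn X n0).
  have e1 : ends (cl (lF (U C X)) (cc z t)) (lF (U C X) ∘ lF H) (tn X n ∘ lF (U C X)).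
    by rewrite -UH; apply: ends_cl; exact: zt_ends.1.
  have e2 : ends (cl (lF (U C X)) (tot (id2 (lF H)))) (lF (U C X) ∘ lF H)
      (tn X n ∘ lF (U C X)).
    by rewrite -UH; apply: ends_cl; exact: ends_tot.
  have [x xE] := endsP e1; have [y yE] := endsP e2; rewrite xE yE; congr tot.
  have [_ _ _ pu] := preserves_id (tangent_pb X 0 n0) (lF (U C X)).
  apply: pu => k; rewrite -xE -yE /= -Uh -!cl_cc //.
  - by rewrite ccA ?zE ?tE ?cc1r // ?(th k).1.1 ?tz.1.1 ?tz.1.2 ?tt.1.2.
  - by rewrite (th k).1.1.
  by rewrite zt_ends.1.2 (th k).1.1.
by move=> k; rewrite tot_typed.
Qed.

(** * The tangent structure of a 2-pullback power *)

(** The hypothesis on [s] contains a comparison [x] from [G T_2] to [T_2 G], which carries pairings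
    along [G]. Stated for raw data, it applies to the projections of [P] before [P] is known to be a
    tangentad. *)
Lemma vsum_map (K : TwoCat) (X Y : K) (R : raw X) (R' : raw Y) (G : hom1 X Y) :
  vsum R' (id1 Y) G (cl G (tot (rpr R 2 ord0))) (cl G (tot (rpr R 2 ord_max)))
    (cl G (tot (rs R))) ->
  forall (L : hom1 X X) (L' : hom1 Y Y) A (F : hom1 A X) a b c, G ∘ L = L' ∘ G ->
  vsum R L F a b c -> vsum R' L' (G ∘ F) (cl G a) (cl G b) (cl G c).
Proof.
move=> /vsum_id[Q0 [x [x0 x1 xs]]] L L' A F a b c GL [Q [t [-> -> ->]]].
have eQ : Q0 = G ∘ rn R 2 by have := congr1 (@csrc _ _ _) x0; rewrite !csrc_cc.
case: _ / (esym eQ) x x0 x1 xs => x x0 x1 xs.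
have eL : G ∘ (L ∘ rn R 2 ∘ F) = L' ∘ (G ∘ rn R 2) ∘ F by rewrite !comp1A GL.
have [t' t'E] : exists t' : G ∘ Q ⇒ L' ∘ rn R' 2 ∘ (G ∘ F),
    cc (cl L' (cr (tot x) F)) (cl G (tot t)) = tot t'.
  apply: endsP; apply: (@ends_cc _ _ _ _ _ _ (L' ∘ (G ∘ rn R 2) ∘ F)); first by est.
  by rewrite -eL.
exists (G ∘ Q), t'; rewrite -t'E.
have key (g : rn R 2 ⇒ rT R) (g' : rn R' 2 ⇒ rT R') :
    cl G (tot g) = cc (cr (tot g') G) (tot x) ->
  cl G (cc (cl L (cr (tot g) F)) (tot t)) =
  cc (cl L' (cr (tot g') (G ∘ F))) (cc (cl L' (cr (tot x) F)) (cl G (tot t))).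
  move=> e; have E := congr1 (fun c => cc (cl L' (cr c F)) (cl G (tot t))) e.
  rewrite cl_cc; last by cst.
  rewrite cl_cl GL -cl_cl -cr_cl E cr_cc // cl_cc // cr_cr -ccA //.
    by rewrite ctgt_cl ctgt_tot eL; cst.
  by cst.
by split; [exact: key x0|exact: key x1|exact: key xs].
Qed.

(** * Lifting 1- and 2-morphisms to a 2-pullback *)

Section TwoPullback.
Variables (K : TwoCat) (V X : K) (u : hom1 V X) (n : nat) (P : K) (pi : 'I_n -> hom1 P V).
Hypothesis pb : is_nfold_2pb u pi.

Lemma pb2_eq1 A (f g : hom1 A P) : (forall k, pi k ∘ f = pi k ∘ g) -> f = g.
Proof.
move=> e; have [|w [_ wU]] := pb2_one pb (h := fun k => pi k ∘ f).
  by move=> i j; rewrite !comp1A (pb2_comm pb i j).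
by rewrite -(wU f) // -(wU g).
Qed.

Lemma pb2_eq2 A (a b : cell (@hom2 K A P)) :
  (forall k, cl (pi k) a = cl (pi k) b) -> a = b.
Proof.
elim/cellW: a => F G a; elim/cellW: b => F' G' b e.
have eF : F = F' by apply: pb2_eq1 => k; exact: (congr1 (@csrc _ _ _) (e k)).
have eG : G = G' by apply: pb2_eq1 => k; exact: (congr1 (@ctgt _ _ _) (e k)).
case: F' / eF b e => b; case: G' / eG b => b e.
have [|w [_ wU]] := pb2_two pb (a := fun k => wl (pi k) a).
  by move=> i j; rewrite !tot_wl !cl_cl (pb2_comm pb i j).
rewrite -(wU a) // -(wU b) // => k; apply: tot_inj; rewrite !tot_wl.
by rewrite e.
Qed.

Lemma pb2_ex1 A (h : 'I_n -> hom1 A V) : (forall i j, u ∘ h i = u ∘ h j) ->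
  exists f : hom1 A P, forall k, pi k ∘ f = h k.
Proof. by move=> /(pb2_one pb)[f [fE _]]; exists f. Qed.

Lemma pb2_ex2 A (f g : hom1 A P) (a : 'I_n -> cell (@hom2 K A V)) :
  (forall k, ends (a k) (pi k ∘ f) (pi k ∘ g)) ->
  (forall i j, cl u (a i) = cl u (a j)) ->
  exists b : f ⇒ g, forall k, cl (pi k) (tot b) = a k.
Proof.
move=> ea e; have [|b [bE _]] := pb2_two pb (a := fun k => typed (ea k)).
  by move=> i j; rewrite !tot_wl !tot_typed.
by exists b => k; rewrite -tot_wl bE tot_typed.
Qed.

(* An endomorphism, or a 2-morphism of endomorphisms, of P whose components are
   those of a single one of V. *)
Definition lifts1 (f : hom1 P P) (F : hom1 V V) : Prop :=
  forall k, pi k ∘ f = F ∘ pi k.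
Definition lifts2 (a : cell (@hom2 K P P)) (b : cell (@hom2 K V V)) : Prop :=
  forall k, cl (pi k) a = cr b (pi k).

(** [F] has to lie over an endomorphism of [X]: then [u ∘ F ∘ pi k = G ∘ u ∘ pi k] does not depend
    on [k]. This is the condition that [T_n] of [V] may fail and [Hn] satisfies. *)
Lemma lifts1_ex F G : u ∘ F = G ∘ u -> exists f, lifts1 f F.
Proof.
move=> e; apply: pb2_ex1 => i j.
by rewrite !comp1A e -!comp1A (pb2_comm pb i j).
Qed.

Lemma lifts1_comp f g F G : lifts1 f F -> lifts1 g G -> lifts1 (f ∘ g) (F ∘ G).
Proof. by move=> eF eG k; rewrite comp1A eF -comp1A eG comp1A. Qed.

Lemma lifts1_id : lifts1 (id1 P) (id1 V).
Proof. by move=> k; rewrite comp1l comp1r. Qed.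

Lemma lifts2_ex f g F G (b : cell (@hom2 K V V)) (c : cell (@hom2 K X X)) :
  ends b F G -> lifts1 f F -> lifts1 g G -> cl u b = cr c u ->
  exists a : f ⇒ g, lifts2 (tot a) b.
Proof.
move=> eb fF gG e; apply: pb2_ex2 => [k|i j].
  by rewrite fF gG; exact: ends_cr.
by rewrite -!cr_cl e !cr_cr (pb2_comm pb i j).
Qed.

Lemma lifts2_eq a b c : lifts2 a c -> lifts2 b c -> a = b.
Proof. by move=> ac bc; apply: pb2_eq2 => k; rewrite ac bc. Qed.

Lemma lifts2_cc a a' b b' : lifts2 a b -> lifts2 a' b' -> ctgt a' = csrc a ->
  ctgt b' = csrc b -> lifts2 (cc a a') (cc b b').
Proof. by move=> ab ab' e e' k; rewrite cl_cc // cr_cc // ab ab'. Qed.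

Lemma lifts2_cl f F a b : lifts1 f F -> lifts2 a b -> lifts2 (cl f a) (cl F b).
Proof. by move=> fF ab k; rewrite cl_cl fF -cl_cl ab cr_cl. Qed.

Lemma lifts2_cr f F a b : lifts1 f F -> lifts2 a b -> lifts2 (cr a f) (cr b F).
Proof. by move=> fF ab k; rewrite -cr_cl ab !cr_cr fF. Qed.

Lemma lifts2_id f F : lifts1 f F -> lifts2 (tot (id2 f)) (tot (id2 F)).
Proof. by move=> fF k; rewrite cl_id2 cr_id2 fF. Qed.

Lemma lifts1_pow f F m : lifts1 f F -> lifts1 (tpow f m) (tpow F m).
Proof.
by move=> fF; elim: m => [|m IH]; [exact: lifts1_id|exact: lifts1_comp].
Qed.

End TwoPullback.

Lemma comm_pow (K : TwoCat) (V X : K) (u : hom1 V X) F G m :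
  u ∘ F = G ∘ u -> u ∘ tpow F m = tpow G m ∘ u.
Proof.
move=> e; elim: m => [|m IH] /=; first by rewrite comp1r comp1l.
by rewrite comp1A e -comp1A IH comp1A.
Qed.

Lemma cl_app (K : TwoCat) (A X Y : K) (G : hom1 X Y) (E : hom1 A X) f g y :
  cl G f = cr g G -> ctgt y = csrc f ∘ E ->
  cl G (cc (cr f E) y) = cc (cr g (G ∘ E)) (cl G y).
Proof. by move=> e ty; rewrite cl_cc // -cr_cl e cr_cr. Qed.

Section Univ.
Variables (K : TwoCat) (X : K) (R : raw X).
Notation T := (rT R).
Notation p := (tot (rp R)).
Notation pr0 := (tot (rpr R 2 ord0)).
Notation pr1 := (tot (rpr R 2 ord_max)).

(* In the pullback square of axiom (6), <y0, y1> is the element of T_2 F induced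
   by a and b. *)
Definition usol A (F : hom1 A X) (a b y0 y1 : cell (@hom2 K A X)) : Prop :=
  cc (cr p F) y0 = b /\
  vsum R T F (cc (cr (tot (rl R)) F) y0) (cc (cr (cr (tot (rz R)) T) F) y1) a.

Lemma usolP A (F : hom1 A X) Q (t : Q ⇒ rn R 2 ∘ F) a b :
  (cc (cr (cc p pr0) F) (tot t) = b /\
   vsum R T F (cc (cr (cc (tot (rl R)) pr0) F) (tot t))
     (cc (cr (cc (cr (tot (rz R)) T) pr1) F) (tot t)) a) <->
  usol F a b (cc (cr pr0 F) (tot t)) (cc (cr pr1 F) (tot t)).
Proof.
rewrite /usol !cr_cc; try cst.
by rewrite !ccA //; cst.
Qed.

Lemma usol_inj A (F : hom1 A X) Q (t t' : Q ⇒ rn R 2 ∘ F) a b : is_tangent R ->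
  usol F a b (cc (cr pr0 F) (tot t)) (cc (cr pr1 F) (tot t)) ->
  usol F a b (cc (cr pr0 F) (tot t')) (cc (cr pr1 F) (tot t')) -> t = t'.
Proof.
move=> tg st st'; have [eb S] := st.
have [Q' [el _ ea]] := vsum_ends S.
have eQ : Q' = Q by rewrite -el.1 !csrc_cc.
rewrite eQ in ea.
have [//|||x [_ xU]] := @tg_univ _ _ _ tg _ F Q a b.
- by rewrite -eb; est.
- rewrite (vsum_ps (tg_ps tg) S) -eb.
  have E := congr1 (fun c => cc (cr c F) (cc (cr pr0 F) (tot t))) (tg_lp tg).
  by cnorm_in E; cnorm.
by rewrite -(xU t (proj2 (usolP _ _ _) st)) (xU t' (proj2 (usolP _ _ _) st')).
Qed.

End Univ.

(** Only a solution is transported: [G] is not asked to preserve the universality square or to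
    commute with [T_2], and uniqueness can then be used in the target. *)
Lemma usol_map (K : TwoCat) (X Y : K) (R : raw X) (R' : raw Y) (G : hom1 X Y)
    A (F : hom1 A X) Q a b y0 y1 :
  G ∘ rT R = rT R' ∘ G -> cl G (tot (rp R)) = cr (tot (rp R')) G ->
  cl G (tot (rz R)) = cr (tot (rz R')) G -> cl G (tot (rl R)) = cr (tot (rl R')) G ->
  vsum R' (id1 Y) G (cl G (tot (rpr R 2 ord0)))
    (cl G (tot (rpr R 2 ord_max))) (cl G (tot (rs R))) ->
  ends y0 Q (rT R ∘ F) -> ends y1 Q (rT R ∘ F) -> usol R F a b y0 y1 ->
  usol R' (G ∘ F) (cl G a) (cl G b) (cl G y0) (cl G y1).
Proof.
move=> GT Gp Gz Gl Gs e0 e1 [<- S].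
have Gz' : cl G (cr (tot (rz R)) (rT R)) = cr (cr (tot (rz R')) (rT R')) G.
  by rewrite -cr_cl Gz !cr_cr GT.
have := vsum_map Gs GT S.
rewrite (cl_app (g := tot (rl R'))) ?e0.2 //.
rewrite (cl_app (g := cr (tot (rz R')) (rT R'))) //; last by rewrite e1.2; cst.
by split=> //; rewrite (cl_app (g := tot (rp R'))) ?e0.2.
Qed.

Section VFPowers.
Variables (K : TwoCat) (C : forall X : tangentad K, vf_construction X).
Variables (X : tangentad K) (n : nat) (P : K) (pi : 'I_n -> @hom1 K P (VF C X)).
Notation U := (Defs.U C X).
Notation u := (lF U).
Notation V := (VF C X).
Hypothesis pb : is_nfold_2pb u pi.
Notation sU := (U_strict C X).
Notation TV := (tT V).
Notation TX := (tT X).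

Let uT : u ∘ TV = TX ∘ u := strict_T sU.
Let uT_pow m : u ∘ tpow TV m = tpow TX m ∘ u := comm_pow m uT.

(* Hn with the projections h is the n-fold pullback VF(T_n) of VF_tn_iso. *)
Definition strict_power m (Hn : hom1 V V) (h : 'I_m -> Hn ⇒ TV) : Prop :=
  exists (th : Hn ⇒ tn V m) (ze : tn V m ⇒ Hn),
  [/\ u ∘ Hn = tn X m ∘ u,
      forall k, cl u (tot (h k)) = cr (tot (tpr X m k)) u,
      cc (tot th) (tot ze) = tot (id2 (tn V m)),
      cc (tot ze) (tot th) = tot (id2 Hn) &
      forall k, cc (tot (tpr V m k)) (tot th) = tot (h k)].

(** By [li_n] the powers of [P] lie over [Hn] and not over [tn V m], so [s] cannot be required to
    lie over [ts V]; [li_s] describes its components as sums instead. *)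
Record is_lift (R : raw P) : Prop := IsLift {
  li_T : lifts1 pi (rT R) TV;
  li_n : forall m, 0 < m -> exists (Hn : hom1 V V) (h : 'I_m -> Hn ⇒ TV),
    [/\ strict_power h, lifts1 pi (rn R m) Hn &
        forall k, lifts2 pi (tot (rpr R m k)) (tot (h k))];
  li_p : lifts2 pi (tot (rp R)) (tot (tp V));
  li_z : lifts2 pi (tot (rz R)) (tot (tz V));
  li_s : forall k, vsum (raw_of V) (id1 V) (pi k)
    (cl (pi k) (tot (rpr R 2 ord0))) (cl (pi k) (tot (rpr R 2 ord_max)))
    (cl (pi k) (tot (rs R)));
  li_l : lifts2 pi (tot (rl R)) (tot (tl V));
  li_c : lifts2 pi (tot (rc R)) (tot (tc V))
}.

Lemma lift_ex : exists R, is_lift R.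
Proof.
have [TP TPE] := lifts1_ex pb uT.
have tn_ex m : exists Tnpr : {Tn : hom1 P P & 'I_m -> Tn ⇒ TP}, 0 < m ->
    exists (Hn : hom1 V V) (h : 'I_m -> Hn ⇒ TV),
    [/\ strict_power h, lifts1 pi (projT1 Tnpr) Hn &
        forall k, lifts2 pi (tot (projT2 Tnpr k)) (tot (h k))].
  (* Nothing is required for [m = 0]; the tangent bundle 1-morphism serves as a default. *)
  case: m => [|m]; first by exists (existT (fun Tn => 'I_0 -> Tn ⇒ TP) TP (fun k => id2 TP)).
  have [Hn [h [th [ze [uH uh tz zt the]]]]] := VF_tn_iso C X (ltn0Sn m).
  have [Tn TnE] := lifts1_ex pb uH.
  have [pr prE] : exists pr : 'I_m.+1 -> Tn ⇒ TP,
      forall k, lifts2 pi (tot (pr k)) (tot (h k)).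
    have ex k : exists a : Tn ⇒ TP, lifts2 pi (tot a) (tot (h k)).
      exact: (lifts2_ex pb (ends_tot (h k)) TnE TPE (uh k)).
    exact: fin_all_exists ex.
  exists (existT (fun Tn => 'I_m.+1 -> Tn ⇒ TP) Tn pr) => _; exists Hn, h; split=> //.
  by exists th, ze.
pose tnf m := proj1_sig (constructive_indefinite_description _ (tn_ex m)).
have tnE m : 0 < m -> exists (Hn : hom1 V V) (h : 'I_m -> Hn ⇒ TV),
    [/\ strict_power h, lifts1 pi (projT1 (tnf m)) Hn &
        forall k, lifts2 pi (tot (projT2 (tnf m) k)) (tot (h k))].
  exact: (proj2_sig (constructive_indefinite_description _ (tn_ex m))).
have idE := lifts1_id pi; have TTE := lifts1_comp TPE TPE.
have [p pE] := lifts2_ex pb (ends_tot (tp V)) TPE idE (strict_p sU).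
have [z zE] := lifts2_ex pb (ends_tot (tz V)) idE TPE (strict_z sU).
have [l lE] := lifts2_ex pb (ends_tot (tl V)) TPE TTE (strict_l sU).
have [c cE] := lifts2_ex pb (ends_tot (tc V)) TTE TTE (strict_c sU).
have [H2 [h [[th [ze [uH uh tz zt the]]] H2E hE]]] := tnE 2 isT.
(* The addition on [H2] is that of [V] transported along [th]. *)
have sumV : vsum (raw_of V) (id1 V) (id1 V) (tot (h ord0)) (tot (h ord_max))
    (cc (tot (ts V)) (tot th)).
  apply/vsum_1; exists H2.
  have [t tE] : exists t : H2 ⇒ id1 V ∘ rn (raw_of V) 2, tot th = tot t.
    by apply: endsP; est.
  by exists t; rewrite -tE !cl_id1 !the.
(* Under [u] this addition and that of [X] are sums of the same projections, hence equal; so it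
   lifts to [P]. *)
have us : cl u (cc (tot (ts V)) (tot th)) = cr (tot (ts X)) u.
  have pX := tangent_pb X 0 (isT : 0 < 2).
  have := strict_vsum sU sumV; rewrite !uh comp1r => H.
  apply: vsum_inj pX H _.
  by have := vsum_cr u (vsum_pr (raw_of X)); rewrite comp1l.
have es : ends (cc (tot (ts V)) (tot th)) H2 TV by est.
have [s sE] := lifts2_ex pb es H2E TPE us.
exists (@Raw K P TP (fun m => projT1 (tnf m)) (fun m => projT2 (tnf m)) p z s l c).
split=> // k; rewrite /= !hE sE.
by have := vsum_cr (pi k) sumV; rewrite comp1l.
Qed.

Lemma strict_power_cpb m (m0 : 0 < m) (Hn : hom1 V V) (h : 'I_m -> Hn ⇒ TV) :
  strict_power h -> forall r A (E : hom1 A V),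
  cpb (cl (tpow TV r) (cr (tot (tp V)) E)) (fun k => cl (tpow TV r) (cr (tot (h k)) E))
    (tpow TV r ∘ Hn ∘ E) (tpow TV r ∘ TV ∘ E).
Proof.
move=> [th [ze [uH uh tz zt the]]] r A E.
apply: (cpb_iso (tangent_pb V r m0 E) (th := cl (tpow TV r) (cr (tot th) E))
  (ze := cl (tpow TV r) (cr (tot ze) E))); try est.
- by cst.
- by rewrite -cl_cc // -cr_cc // tz cr_id2 cl_id2 comp1A.
- by rewrite -cl_cc // -cr_cc // zt cr_id2 cl_id2 comp1A.
by move=> k; rewrite -cl_cc // -cr_cc // -the.
Qed.

Section Lift.
Variable R : raw P.
Hypothesis lR : is_lift R.
Notation TP := (rT R).

Let Tpow r : lifts1 pi (tpow TP r) (tpow TV r) := lifts1_pow r (li_T lR).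

Lemma lift_pb r m : 0 < m -> preserves R m (tpow TP r).
Proof.
move=> m0 A F; have [Hn [h [sp nE prE]]] := li_n lR m0.
have pbV k := strict_power_cpb m0 sp r (pi k ∘ F).
have [th [ze [uH uh _ _ _]]] := sp.
have l2 (f : TP ⇒ id1 P) (f' : TV ⇒ id1 V) k : lifts2 pi (tot f) (tot f') ->
    cl (pi k) (cl (tpow TP r) (cr (tot f) F)) = cl (tpow TV r) (cr (tot f') (pi k ∘ F)).
  by move=> e; rewrite cl_cl Tpow -cl_cl -cr_cl e cr_cr.
have l2n j k : cl (pi k) (cl (tpow TP r) (cr (tot (rpr R m j)) F)) =
    cl (tpow TV r) (cr (tot (h j)) (pi k ∘ F)).
  by rewrite cl_cl Tpow -cl_cl -cr_cl prE cr_cr.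
have p2 k := l2 _ _ k (li_p lR).
have ePn k : pi k ∘ (tpow TP r ∘ rn R m ∘ F) = tpow TV r ∘ Hn ∘ (pi k ∘ F).
  by rewrite !comp1A Tpow -(comp1A _ (pi k)) nE comp1A.
have ePT k : pi k ∘ (tpow TP r ∘ TP ∘ F) = tpow TV r ∘ TV ∘ (pi k ∘ F).
  by rewrite !comp1A Tpow -(comp1A _ (pi k)) (li_T lR) comp1A.
split.
- by move=> k; est.
- move=> i j; apply: (pb2_eq2 pb) => k; rewrite !cl_cc; try cst.
  by rewrite !l2n p2; have [_ pc _ _] := pbV k; exact: pc.
- move=> Q q eq cq.
  (* The problem is solved in each component; to glue, the solutions must agree under [u]. *)
  have ex k : exists w : pi k ∘ Q ⇒ tpow TV r ∘ Hn ∘ (pi k ∘ F), forall j,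
      cc (cl (tpow TV r) (cr (tot (h j)) (pi k ∘ F))) (tot w) = cl (pi k) (q j).
    have [_ _ pe _] := pbV k; apply: pe.
      by move=> j; rewrite -ePT; exact: ends_cl.
    move=> i j; rewrite -p2.
    have eqs l : ctgt (q l) = csrc (cl (tpow TP r) (cr (tot (rp R)) F)).
      by rewrite (eq l).2; cst.
    by rewrite -!cl_cc ?eqs // (cq i j).
  have [w wE] := fin_all_exists ex.
  have [k|i j|t tE] := pb2_ex2 pb (f := Q)
    (g := tpow TP r ∘ rn R m ∘ F) (a := fun k => tot (w k)).
  + by rewrite ePn.
  + have e k : ends (cl u (tot (w k)))
        (u ∘ pi k ∘ Q) (tpow TX r ∘ tn X m ∘ (u ∘ pi k ∘ F)).
      split; rewrite ?csrc_cl ?ctgt_cl ?csrc_tot ?ctgt_tot ?comp1A // uT_pow.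
      by rewrite -(comp1A _ u) uH !comp1A.
    have [x xE] := endsP (e i); have [y yE] := endsP (e j).
    (* The projections of [cl u (w k)] are the images of the [q l], which do not depend on [k];
       uniqueness in the pullback of [X] gives the agreement. *)
    have uw k l : cc (cl (tpow TX r) (cr (tot (tpr X m l)) (u ∘ pi k ∘ F))) (cl u (tot (w k))) =
        cl (u ∘ pi k) (q l).
      rewrite -[RHS]cl_cl -wE cl_cc; last by cst.
      by rewrite cl_cl uT_pow -[in RHS]cl_cl -(cr_cl u) uh cr_cr (comp1A u (pi k) F).
    rewrite xE yE; have uij := pb2_comm pb j i.
    have [y' y'E] : exists y' : u ∘ pi i ∘ Q ⇒ tpow TX r ∘ tn X m ∘ (u ∘ pi i ∘ F),
        tot y = tot y' by apply: endsP; split; rewrite /= ?csrc_tot ?ctgt_tot uij.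
    rewrite y'E; congr tot; have [_ _ _ pu] := tangent_pb X r m0 (u ∘ pi i ∘ F).
    apply: pu => l /=; rewrite -xE -y'E -yE uw.
    by rewrite -uij uw uij.
  exists t => j; apply: (pb2_eq2 pb) => k.
  by rewrite cl_cc ?l2n ?tE //; cst.
move=> Q w w' ww; apply: tot_inj; apply: (pb2_eq2 pb) => k.
have [x xE] : exists x : pi k ∘ Q ⇒ tpow TV r ∘ Hn ∘ (pi k ∘ F),
    cl (pi k) (tot w) = tot x.
  by apply: endsP; rewrite -ePn; exact: ends_cl.
have [y yE] : exists y : pi k ∘ Q ⇒ tpow TV r ∘ Hn ∘ (pi k ∘ F),
    cl (pi k) (tot w') = tot y.
  by apply: endsP; rewrite -ePn; exact: ends_cl.
rewrite xE yE; congr tot; have [_ _ _ pu] := pbV k; apply: pu => j.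
rewrite -xE -yE -l2n -!cl_cc ?ww //; cst.
Qed.

Lemma lift_vsum (L : hom1 P P) (L' : hom1 V V) A (F : hom1 A P) a b c k :
  lifts1 pi L L' -> vsum R L F a b c ->
  vsum (raw_of V) L' (pi k ∘ F) (cl (pi k) a) (cl (pi k) b) (cl (pi k) c).
Proof. by move=> LL; apply: vsum_map; [exact: li_s lR k|exact: LL]. Qed.

Let pres2 : preserves R 2 (id1 P).
Proof. exact: (@lift_pb 0 2 isT). Qed.
Let pres2T : preserves R 2 TP.
Proof. by have := @lift_pb 1 2 isT; rewrite /= comp1r. Qed.
Let presV2 : preserves (raw_of V) 2 (id1 V).
Proof. exact: (@tangent_pb _ _ V 0 2 isT). Qed.
Let presV2T : preserves (raw_of V) 2 TV.
Proof. by have := @tangent_pb _ _ V 1 2 isT; rewrite /= comp1r. Qed.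
(** The sum of [a] and [b] exists in [P] because their bases agree in every component; it equals [c]
    because sums in [V] are unique. *)
Lemma vsum_reflect (L : hom1 P P) (L' : hom1 V V) A (F : hom1 A P) Q a b c :
  preserves R 2 L -> preserves (raw_of V) 2 L' -> lifts1 pi L L' ->
  ends a Q (L ∘ TP ∘ F) -> ends b Q (L ∘ TP ∘ F) ->
  (forall k, vsum (raw_of V) L' (pi k ∘ F) (cl (pi k) a) (cl (pi k) b) (cl (pi k) c)) ->
  vsum R L F a b c.
Proof.
move=> pL pL' LL ea eb H.
have [|e ee eE] := vsum_ex pL ea eb.
  apply: (pb2_eq2 pb) => k.
  rewrite !cl_cc ?ea.2 ?eb.2; try by rewrite csrc_cl csrc_cr comp1A.
  rewrite cl_cl LL -cl_cl -cr_cl (li_p lR) cr_cr.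
  exact: vsum_p pL' (H k).
suff <- : e = c by [].
apply: (pb2_eq2 pb) => k; exact: vsum_inj pL' (lift_vsum k LL eE) (H k).
Qed.

Let id_id := lifts1_id pi.
Let T_T := li_T lR.

Ltac lift2 := repeat first
  [ exact: id_id | exact: T_T | exact: (lifts1_comp T_T T_T)
  | exact: (li_p lR) | exact: (li_z lR) | exact: (li_l lR) | exact: (li_c lR)
  | apply: lifts2_id | apply: lifts2_cl | apply: lifts2_cr
  | apply: lifts2_cc; [ | | cst | cst ] ].

Lemma lift_ps : cc (tot (rp R)) (tot (rs R)) = cc (tot (rp R)) (tot (rpr R 2 ord0)).
Proof.
apply: (pb2_eq2 pb) => k; rewrite !cl_cc //.
have E : cl (pi k) (tot (rp R)) = cr (tot (tp V)) (pi k) := li_p lR k.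
have [Q [t [e0 _ es]]] := proj1 (vsum_id _ _ _ _ _) (li_s lR k).
rewrite E e0 es.
have E' := congr1 (fun c => cc (cr c (pi k)) (tot t)) (tg_ps (tangentP V)).
by cnorm_in E'; cnorm.
Qed.

(** Universality of [V] solves the problem in each component; the solutions glue because under [u]
    they all solve one problem in [X], where solutions are unique. *)
Lemma lift_univ A (F : hom1 A P) Q a b :
    ends a Q (TP ∘ TP ∘ F) -> ends b Q F ->
    cc (cl TP (cr (tot (rp R)) F)) a = cc (cr (tot (rz R)) F) b ->
    exists! t : Q ⇒ rn R 2 ∘ F,
      cc (cr (cc (tot (rp R)) (tot (rpr R 2 ord0))) F) (tot t) = b /\
      vsum R TP F (cc (cr (cc (tot (rl R)) (tot (rpr R 2 ord0))) F) (tot t))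
        (cc (cr (cc (cr (tot (rz R)) TP) (tot (rpr R 2 ord_max))) F) (tot t)) a.
Proof.
move=> ea eb ab.
have tV := tangentP V; have tX := tangentP X.
have [Hn [h [[th [ze [uH uh tz zt the]]] nE prE]]] := li_n lR (isT : 0 < 2).
have hze j : cc (tot (h j)) (tot ze) = tot (tpr V 2 j).
  by rewrite -the -ccA // tz cc1r.
have zth (E : hom1 _ V) (y : cell (@hom2 K A V)) : ctgt y = Hn ∘ E ->
  cc (cr (tot ze) E) (cc (cr (tot th) E) y) = y.
  by move=> ty; rewrite ccA // -cr_cc // zt cr_id2 cc1l.
have ePn k : pi k ∘ (rn R 2 ∘ F) = Hn ∘ (pi k ∘ F) by rewrite comp1A nE -comp1A.
have ePT k : pi k ∘ (TP ∘ F) = TV ∘ (pi k ∘ F) by rewrite comp1A T_T -comp1A.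
have piP j k t : ctgt t = rn R 2 ∘ F ->
    cl (pi k) (cc (cr (tot (rpr R 2 j)) F) t) = cc (cr (tot (h j)) (pi k ∘ F)) (cl (pi k) t).
  by move=> tt; rewrite (cl_app (g := tot (h j))) ?tt //; exact: prE.
have exV k : exists! t : pi k ∘ Q ⇒ tn V 2 ∘ (pi k ∘ F),
    usol (raw_of V) (pi k ∘ F) (cl (pi k) a) (cl (pi k) b)
      (cc (cr (tot (tpr V 2 ord0)) (pi k ∘ F)) (tot t))
      (cc (cr (tot (tpr V 2 ord_max)) (pi k ∘ F)) (tot t)).
  have [|||t [/usolP st tU]] := @tg_univ _ _ _ tV _ (pi k ∘ F) (pi k ∘ Q)
    (cl (pi k) a) (cl (pi k) b).
  - by have := ends_cl (pi k) ea; rewrite !comp1A !T_T -(comp1A TV (pi k)) T_T comp1A.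
  - exact: ends_cl.
  - have E := congr1 (cl (pi k)) ab.
    rewrite !cl_cc in E; try by rewrite ?ea.2 ?eb.2; cst.
    rewrite cl_cl T_T -cl_cl -2!(cr_cl (pi k)) (li_p lR) (li_z lR) !cr_cr in E.
    exact: E.
  by exists t; split=> // t' /usolP; exact: tU.
have [t tE] := fin_all_exists exV.
pose y j k := cc (cr (tot (tpr V 2 j)) (pi k ∘ F)) (tot (t k)).
(* [ze] moves the solution from [T_2] to [Hn], over which [rn R 2] lies and which commutes strictly
   with [u]. *)
pose w k := cc (cr (tot ze) (pi k ∘ F)) (tot (t k)).
have ey j k : ends (y j k) (pi k ∘ Q) (TV ∘ (pi k ∘ F)) by est.
have ew k : ends (w k) (pi k ∘ Q) (Hn ∘ (pi k ∘ F)) by est.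
have hw j k : cc (cr (tot (h j)) (pi k ∘ F)) (w k) = y j k.
  by rewrite /w ccA // -cr_cc // hze.
have uwE j k : cc (cr (tot (tpr X 2 j)) (u ∘ (pi k ∘ F))) (cl u (w k)) = cl u (y j k).
  by rewrite -hw (cl_app (g := tot (tpr X 2 j))) // (ew k).2.
have uw k : exists2 x : u ∘ pi k ∘ Q ⇒ tn X 2 ∘ (u ∘ pi k ∘ F), cl u (w k) = tot x &
    usol (raw_of X) (u ∘ pi k ∘ F) (cl (u ∘ pi k) a) (cl (u ∘ pi k) b)
      (cc (cr (tot (tpr X 2 ord0)) (u ∘ pi k ∘ F)) (tot x))
      (cc (cr (tot (tpr X 2 ord_max)) (u ∘ pi k ∘ F)) (tot x)).
  have [x xE] : exists x : u ∘ pi k ∘ Q ⇒ tn X 2 ∘ (u ∘ pi k ∘ F), cl u (w k) = tot x.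
    apply: endsP; split; rewrite ?csrc_cl ?ctgt_cl ?(ew k).1 ?(ew k).2 comp1A //.
    by rewrite uH !comp1A.
  exists x => //; rewrite -xE -comp1A !uwE -!cl_cl.
  exact: (@usol_map K V X (raw_of V) (raw_of X) u _ _ _ _ _ _ _ uT
    (strict_p sU) (strict_z sU) (strict_l sU) (strict_s sU)
    (ey ord0 k) (ey ord_max k) (proj1 (tE k))).
have [k|i j|r rE] := pb2_ex2 pb (f := Q) (g := rn R 2 ∘ F) (a := w).
- by rewrite ePn.
- have [x xE sx] := uw i; have [x' x'E sx'] := uw j; rewrite xE x'E.
  have uij := pb2_comm pb j i.
  have [x'' x''E] : exists x'' : u ∘ pi i ∘ Q ⇒ tn X 2 ∘ (u ∘ pi i ∘ F),
      tot x' = tot x''.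
    by apply: endsP; split; rewrite /= ?csrc_tot ?ctgt_tot uij.
  by rewrite x''E uij in sx'; rewrite x''E (usol_inj tX sx sx').
have piy j k : cl (pi k) (cc (cr (tot (rpr R 2 j)) F) (tot r)) = y j k.
  by rewrite piP // rE hw.
have tc k : ctgt (y ord0 k) = TV ∘ (pi k ∘ F) := (ey ord0 k).2.
exists r; split=> [|r' /usolP sr'].
  apply/usolP; split.
    apply: (pb2_eq2 pb) => k; rewrite (cl_app (li_p lR k)) ?piy; last by cst.
    by have [[-> _] _] := tE k.
  have e0 : ends (cc (cr (tot (rl R)) F) (cc (cr (tot (rpr R 2 ord0)) F) (tot r)))
    Q (TP ∘ TP ∘ F) by est.
  have e1 : ends (cc (cr (cr (tot (rz R)) TP) F) (cc (cr (tot (rpr R 2 ord_max)) F) (tot r)))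
    Q (TP ∘ TP ∘ F) by est.
  apply: (vsum_reflect pres2T presV2T T_T e0 e1) => k.
  rewrite (cl_app (li_l lR k)); last by cst.
  rewrite (cl_app (lifts2_cr T_T (li_z lR) k)); last by cst.
  by rewrite !piy; have [[_ ?] _] := tE k.
(* Uniqueness: another solution [r'], projected to component [k] and carried to [T_2] by [th],
   solves the problem that determines [t k]. *)
apply: tot_inj; apply: (pb2_eq2 pb) => k; rewrite rE.
have [x xE] : exists x : pi k ∘ Q ⇒ tn V 2 ∘ (pi k ∘ F),
    cc (cr (tot th) (pi k ∘ F)) (cl (pi k) (tot r')) = tot x.
  apply: endsP; apply: (@ends_cc _ _ _ _ _ _ (Hn ∘ (pi k ∘ F))); first by est.
  by rewrite -ePn; exact: ends_cl.
have xt : x = t k.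
  symmetry; apply: (tE k).2; rewrite -xE.
  have prx j : cc (cr (tot (tpr V 2 j)) (pi k ∘ F))
      (cc (cr (tot th) (pi k ∘ F)) (cl (pi k) (tot r'))) =
      cl (pi k) (cc (cr (tot (rpr R 2 j)) F) (tot r')).
    by rewrite piP // ccA // -?cr_cc ?the // ctgt_cl ePn.
  have er j : ends (cc (cr (tot (rpr R 2 j)) F) (tot r')) Q (TP ∘ F) by est.
  rewrite !prx.
  exact: (@usol_map K P V R (raw_of V) (pi k) _ F Q _ _ _ _ (T_T k) (li_p lR k)
    (li_z lR k) (li_l lR k) (li_s lR k) (er ord0) (er ord_max) sr').
by rewrite /w -xt -xE zth // ctgt_cl ePn.
Qed.

Lemma lift_is_tangent : is_tangent R.
Proof.
have tV := tangentP V.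
split.
- by move=> m k k0; exact: lift_pb.
(* Scheme of the equational axioms: both sides on [P] lift a common 2-morphism [c] of [V], one of
   them after rewriting with the same axiom on [V]. *)
- apply: (lifts2_eq pb (c := tot (id2 (id1 V))));
    [rewrite -(tg_pz tV)|]; by lift2.
- exact: lift_ps.
- move=> A F a b ab d bd r s1 s2 s3.
  have [Q [ea eb _]] := vsum_ends s1; have [Q' [eb' _ ebd]] := vsum_ends s3.
  have eQ : Q' = Q by rewrite -eb'.1 eb.1.
  rewrite eQ in ebd.
  apply: (vsum_reflect pres2 presV2 id_id ea ebd) => k.
  exact: (tg_A tV (lift_vsum k id_id s1) (lift_vsum k id_id s2) (lift_vsum k id_id s3)).
- move=> A F a b r s; have [Q [ea eb _]] := vsum_ends s.
  apply: (vsum_reflect pres2 presV2 id_id eb ea) => k.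
  exact: (tg_C tV (lift_vsum k id_id s)).
- move=> A F Q a ea.
  have ea' : ends a Q (id1 P ∘ TP ∘ F) by rewrite comp1l.
  have [a' aE] := endsP ea.
  apply: (vsum_reflect pres2 presV2 id_id _ ea') => [|k]; first by rewrite aE; est.
  have -> : cl (pi k) (cc (cr (tot (rz R)) F) (cc (cr (tot (rp R)) F) a)) =
    cc (cr (tot (tz V)) (pi k ∘ F)) (cc (cr (tot (tp V)) (pi k ∘ F)) (cl (pi k) a)).
    rewrite aE !cl_cc; try cst.
    by rewrite -!cr_cl (li_z lR) (li_p lR) !cr_cr.
  apply: (tg_0 tV (Q := pi k ∘ Q)).
  by have := ends_cl (pi k) ea; rewrite !comp1A (li_T lR) -comp1A.
- apply: (lifts2_eq pb (c := cc (tot (tz V)) (tot (tp V))));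
    [rewrite -(tg_lp tV)|]; by lift2.
- apply: (lifts2_eq pb (c := cc (tot (tl V)) (tot (tz V))));
    [|rewrite (tg_lz tV)]; by lift2.
- move=> A F a b r s; have [Q [ea eb er]] := vsum_ends s.
  have el x : ends x Q (id1 P ∘ TP ∘ F) -> ends (cc (cr (tot (rl R)) F) x) Q (TP ∘ TP ∘ F).
    by rewrite comp1l; apply: ends_cc; est.
  apply: (vsum_reflect pres2T presV2T T_T (el _ ea) (el _ eb)) => k.
  have lE x : ends x Q (id1 P ∘ TP ∘ F) -> cl (pi k) (cc (cr (tot (rl R)) F) x) =
      cc (cr (tot (tl V)) (pi k ∘ F)) (cl (pi k) x).
    by case=> _ tx; rewrite cl_cc ?tx ?comp1l // -cr_cl (li_l lR) cr_cr.
  rewrite !lE //; exact: (tg_ls tV (lift_vsum k id_id s)).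
- apply: (lifts2_eq pb (c := cl TV (tot (tp V))));
    [rewrite -(tg_cp tV)|]; by lift2.
- apply: (lifts2_eq pb (c := cr (tot (tz V)) TV));
    [rewrite -(tg_cz tV)|]; by lift2.
- move=> A F a b r s; have [Q [ea eb er]] := vsum_ends s.
  have el x : ends x Q (TP ∘ TP ∘ F) ->
      ends (cc (cr (tot (rc R)) F) x) Q (id1 P ∘ TP ∘ (TP ∘ F)).
    by rewrite comp1l comp1A; apply: ends_cc; est.
  apply: (vsum_reflect pres2 presV2 id_id (el _ ea) (el _ eb)) => k.
  have lE x : ends x Q (TP ∘ TP ∘ F) -> cl (pi k) (cc (cr (tot (rc R)) F) x) =
      cc (cr (tot (tc V)) (pi k ∘ F)) (cl (pi k) x).
    by case=> _ tx; rewrite cl_cc ?tx // -cr_cl (li_c lR) cr_cr.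
  rewrite !lE // comp1A (li_T lR) -comp1A.
  exact: (tg_cs tV (lift_vsum k T_T s)).
- apply: (lifts2_eq pb (c := cc (cl TV (tot (tl V))) (tot (tl V))));
    [|rewrite (tg_ll tV)]; by lift2.
- apply: (lifts2_eq pb (c := tot (tl V)));
    [rewrite -(tg_cl tV)|]; by lift2.
- apply: (lifts2_eq pb (c := cc (cl TV (tot (tl V))) (tot (tc V))));
    [rewrite -(tg_ccl tV)|]; by lift2.
- apply: (lifts2_eq pb (c := tot (id2 (TV ∘ TV))));
    [rewrite -(tg_cc tV)|]; by lift2.
- apply: (lifts2_eq pb
    (c := cc (cl TV (tot (tc V))) (cc (cr (tot (tc V)) TV) (cl TV (tot (tc V))))));
    [|rewrite (tg_YB tV)]; by lift2.
exact: lift_univ.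
Qed.

End Lift.

End VFPowers.

(** * The powers as 2-pullbacks of tangentads *)

Lemma strict_is_lax (K : TwoCat) (X Y : tangentad K) (G : hom1 X Y)
    (GT : G ∘ tT X = tT Y ∘ G) :
  cl G (tot (tp X)) = cr (tot (tp Y)) G -> cl G (tot (tz X)) = cr (tot (tz Y)) G ->
  cl G (tot (tl X)) = cr (tot (tl Y)) G -> cl G (tot (tc X)) = cr (tot (tc Y)) G ->
  vsum (raw_of Y) (id1 Y) G (cl G (tot (tpr X 2 ord0))) (cl G (tot (tpr X 2 ord_max)))
    (cl G (tot (ts X))) ->
  is_lax (cast (id2 (G ∘ tT X)) erefl GT).
Proof.
move=> Gp Gz Gl Gc Gs.
have GTT : G ∘ tT X ∘ tT X = tT Y ∘ tT Y ∘ G by rewrite GT -!comp1A GT.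
have id3 : cc (cl (tT Y) (tot (id2 (G ∘ tT X)))) (cr (tot (id2 (G ∘ tT X))) (tT X)) =
    tot (id2 (G ∘ tT X ∘ tT X)).
  by rewrite cl_id2 cr_id2 cc1l // ctgt_tot comp1A GT.
split.
- by rewrite !totE cc1r ?Gp // csrc_cr csrc_tot GT.
- by rewrite !totE cc1l ?Gz // ctgt_cl ctgt_tot GT.
- apply: lax_s_of_vsum; rewrite tot_cast !cc1l //.
- rewrite !totE id3 cc1l; last by rewrite ctgt_cl ctgt_tot comp1A.
  by rewrite cc1r ?Gl // csrc_cr csrc_tot GT.
rewrite !totE id3 cc1l; last by rewrite ctgt_cl ctgt_tot comp1A.
by rewrite cc1r ?Gc // csrc_cr csrc_tot GTT.
Qed.

Lemma strict_2pb (K : TwoCat) (V X PT : tangentad K) (U : @hom1 (Tng K) V X) n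
    (rho : 'I_n -> @hom1 (Tng K) PT V) :
  is_strict U -> (forall k, is_strict (rho k)) ->
  is_nfold_2pb (lF U) (fun k => lF (rho k)) -> is_nfold_2pb U rho.
Proof.
move=> sU srho pb.
have srT k : lF (rho k) ∘ tT PT = tT V ∘ lF (rho k) := strict_T (srho k).
split.
- move=> i j; have e : lF (U ∘ rho i) = lF (U ∘ rho j) := pb2_comm pb i j.
  apply: lax_eq => //; rewrite !(la_strict_comp _ sU) !(strict_la (srho _)) !cl_id2.
  by rewrite !comp1A; move: e => /= ->.
- move=> A h hU.
  have [f fE] := pb2_ex1 pb (h := fun k => lF (h k)) (fun i j => congr1 (@lF _ _ _) (hU i j)).
  (* The components [la (h k)] glue: as [U] is strict, their images under [U] are the structural
     2-morphisms of [U ∘ h k], which do not depend on [k]. *)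
  have [k|i j|al alE] := pb2_ex2 pb (f := f ∘ tT A) (g := tT PT ∘ f)
    (a := fun k => tot (la (h k))).
  + by rewrite !comp1A srT -(comp1A (tT V)) !fE.
  + by rewrite -!(la_strict_comp _ sU) (hU i j).
  have clT (a : cell (@hom2 K (A : tangentad K) PT)) k :
      cl (lF (rho k)) (cl (tT PT) a) = cl (tT V) (cl (lF (rho k)) a).
    by rewrite !cl_cl srT.
  have alp : cc (cr (tot (tp PT)) f) (tot al) = cl f (tot (tp A)).
    apply: (pb2_eq2 pb) => k.
    rewrite (cl_app (strict_p (srho k))) // alE cl_cl fE.
    by have := lax_p (laP (h k)); rewrite !totE.
  have lf : is_lax al.
    split.
    * by rewrite !totE.
    * rewrite !totE; apply: (pb2_eq2 pb) => k.
      rewrite cl_cc; last by cst.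
      rewrite alE cl_cl fE -cr_cl (strict_z (srho k)) cr_cr fE.
      by have := lax_z (laP (h k)); rewrite !totE.
    * apply: lax_s_of_vsum.
      have pP := tangent_pb PT 0 (isT : 0 < 2); have pV := tangent_pb V 0 (isT : 0 < 2).
      have [|||e ee eE] := @vsum_ex _ _ _ PT (id1 PT) _ f (f ∘ tn A 2)
        (cc (tot al) (cl f (tot (tpr A 2 ord0))))
        (cc (tot al) (cl f (tot (tpr A 2 ord_max)))) pP.
      - by est.
      - by est.
      - have [_ /(_ ord0 ord_max) E _ _] := preserves_1 (tangent_pb A 0 (isT : 0 < 2)).
        rewrite /= !cl_id1 in E.
        have key k := congr1 (fun c => cc c (cl f (tot (tpr A 2 k)))) alp.
        have E0 := key ord0; have E1 := key ord_max; have E2 := congr1 (cl f) E.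
        by cnorm_in E0; cnorm_in E1; cnorm_in E2; cnorm; rewrite E0 E1 E2.
      suff <- : e = cc (tot al) (cl f (tot (ts A))) by [].
      apply: (pb2_eq2 pb) => k.
      have S := strict_vsum (srho k) eE.
      have S' := vsum_cl (lF (h k)) (vsum_pr (raw_of (tstr A))).
      rewrite comp1r in S'; have {}S' := lax_vsum S'.
      rewrite comp1r !cr_id1 in S'.
      have cf x : ctgt (cl f x) = f ∘ tT A -> cl (lF (rho k)) (cc (tot al) (cl f x)) =
          cc (tot (la (h k))) (cl (lF (h k)) x).
        by move=> tx; rewrite cl_cc // alE cl_cl fE.
      rewrite !cf // fE in S; rewrite cf //.
      exact: vsum_inj pV S S'.
    * rewrite !totE; apply: (pb2_eq2 pb) => k.
      have E := lax_l (laP (h k)); rewrite !totE in E.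
      rewrite (cl_app (strict_l (srho k))) // alE.
      rewrite cl_cc; last by cst.
      rewrite cl_cc; last by cst.
      by rewrite clT -cr_cl alE cl_cl fE.
    rewrite !totE; apply: (pb2_eq2 pb) => k.
    have E := lax_c (laP (h k)); rewrite !totE in E.
    rewrite (cl_app (strict_c (srho k))); last by cst.
    rewrite cl_cc; last by cst.
    rewrite cl_cc; last by cst.
    rewrite cl_cc; last by cst.
    by rewrite clT -cr_cl alE cl_cl fE.
  exists (LaxTangentMorphism lf); split=> [k|f' f'E].
    by apply: lax_eq; [exact: fE|rewrite (la_strict_comp _ (srho k)) alE].
  apply: lax_eq => /=.
    by apply: (pb2_eq1 pb) => k; rewrite fE -f'E.
  apply: (pb2_eq2 pb) => k; rewrite alE -f'E.
  exact: (la_strict_comp _ (srho k)).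
move=> A f g a aU.
have [k|i j|b bE] := pb2_ex2 pb (f := lF f) (g := lF g) (a := fun k => tot (t2 (a k))).
- by [].
- exact: (t2_tot (aU i j)).
have bP : wl (tT PT) b • la f = la g • wr b (tT A).
  apply: tot_inj; rewrite !totE; apply: (pb2_eq2 pb) => k.
  have E := (t2_tng (a k)).2; rewrite !(la_strict_comp _ (srho k)) in E.
  rewrite cl_cc; last by cst.
  rewrite cl_cc; last by cst.
  by rewrite cl_cl srT -cl_cl -cr_cl bE.
exists (Tangent2Morphism bP); split=> [k|b' b'E].
  by apply: t2_eq; apply: tot_inj; exact: bE.
apply: t2_eq; apply: tot_inj; apply: (pb2_eq2 pb) => k /=.
by rewrite bE -b'E.
Qed.

Lemma VF_power_tangent (K : TwoCat) (C : forall X : tangentad K, vf_construction X)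
    (X : tangentad K) n (P : K) (pi : 'I_n -> @hom1 K P (VF C X)) :
  is_nfold_2pb (lF (U C X)) pi ->
  exists (S : tangent_structure P)
         (rho : 'I_n -> @hom1 (Tng K) (Tangentad S) (VF C X)),
    (forall k, lF (rho k) = pi k) /\
    (forall k, is_strict (rho k)) /\
    is_nfold_2pb (U C X) rho.
Proof.
move=> pb; have [R lR] := lift_ex pb.
have [S SE] := tangent_of_raw (lift_is_tangent pb lR).
(* The lifting data now concern [S] itself and provide what [strict_is_lax] asks of each [pi k]. *)
move: lR; rewrite -SE => lR.
pose rho k := @LaxTangentMorphism K (Tangentad S) (VF C X) _ _
  (@strict_is_lax K (Tangentad S) (VF C X) (pi k) (li_T lR k) (li_p lR k) (li_z lR k)
    (li_l lR k) (li_c lR k) (li_s lR k)).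
have srho k : is_strict (rho k) by exact: tot_cast.
exists S, rho; split=> //; split=> //.
exact: strict_2pb (U_strict C X) srho pb.
Qed.

Theorem theorem3p21 (K : TwoCat) (C : forall X : tangentad K, vf_construction X)
    (HP : forall (X : tangentad K) (n : nat), 0 < n ->
      exists (P : K) (pi : 'I_n -> @hom1 K P (VF C X)), is_nfold_2pb (lF (U C X)) pi) :
  (forall (X : tangentad K) (n : nat) (P : K) (pi : 'I_n -> @hom1 K P (VF C X)),
    0 < n -> is_nfold_2pb (lF (U C X)) pi ->
    exists (S : tangent_structure P)
           (rho : 'I_n -> @hom1 (Tng K) (Tangentad S) (VF C X)),
      (forall k, lF (rho k) = pi k) /\
      (forall k, is_strict (rho k)) /\
      is_nfold_2pb (U C X) rho)
  /\
  (forall W : forall X : tangentad K, vf_power C 2 X,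
    is_2monad (VF_2functor C) (eta C) (mu W)).
Proof.
split=> [X n P pi _|W]; first exact: VF_power_tangent.
exact: VF_is_2monad (fun X => U_mu (W X)) (fun X => v_mu (W X)).
Qed.
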